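(* Let $k\ge 1$ be a fixed integer (not depending on $n$). Consider the graph $\mathbb{G}(n,K_n,P_n,p_n)$ with $P_n=\Omega(n)$ and $K_n/P_n=o(1)$. Let $q_n$ be its edge probability and define the sequence $\alpha_n$ by $$q_n=\frac{\ln n+(k-1)\ln\ln n+\alpha_n}{n}.$$ If $\lim_{n\to\infty}\alpha_n=\alpha^*\in(-\infty,\infty)$, then as $n\to\infty$, $$\mathbb{P}\big[\mathbb{G}(n,K_n,P_n,p_n)\text{ is $k$-connected}\big]\to e^{-\frac{e^{-\alpha^*}}{(k-1)!}}.$$
   Context: The random graph $\mathbb{G}(n,K_n,P_n,p_n)$ is defined on nodes $v_1,\dots,v_n$. There is a pool of $P_n$ distinct keys. Each node $v_i$ independently receives a key set $S_i$, chosen uniformly at random among all $K_n$-element subsets of the pool ($K_n\le P_n$ positive integers). Independently of the keys, each unordered pair $\{v_i,v_j\}$ has a channel that is ''on'' with probability $p_n$ and ''off'' otherwise, independently over pairs. Nodes $v_i$ and $v_j$ are adjacent iff $S_i\cap S_j\neq\emptyset$ and their channel is on. Put $s_n=\mathbb{P}[S_i\cap S_j\ne\emptyset]$, which equals $1-\binom{P_n-K_n}{K_n}/\binom{P_n}{K_n}$ if $P_n>2K_n$ and $1$ otherwise. The edge probability is $q_n=p_n s_n$. A graph is $k$-connected if it remains connected after deleting any $k-1$ nodes. Here $K_n,P_n,p_n$ are sequences indexed by $n$, and asymptotic notation is as $n\to\infty$. *)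

(* Defs.v *)
From mathcomp Require Import all_boot all_order all_algebra.

Set Implicit Arguments.
Unset Strict Implicit.
Unset Printing Implicit Defensive.

Import GRing.Theory.
Local Open Scope ring_scope.

Definition connected_without (T : finType) (e : rel T) (A : {set T}) : bool :=
  let e' := [rel x y | [&& x \notin A, y \notin A & e x y]] in
  [forall x, forall y, (x \notin A) ==> (y \notin A) ==> connect e' x y].

(* Meaningful for k >= 1; when #|T| < k.-1 it holds vacuously. *)
Definition k_connected (k : nat) (T : finType) (e : rel T) : bool :=
  [forall A : {set T}, (#|A| == k.-1) ==> connected_without e A].

Definition key_set (K P : nat) : finType := {A : {set 'I_P} | #|A| == K}.

Definition node_pair (n : nat) : finType := {e : {set 'I_n} | #|e| == 2}.

(* An outcome: the key set of every node, and the set of channels that are on,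
   given by its indicator function. *)
Definition outcome (n K P : nat) : finType :=
  ({ffun 'I_n -> key_set K P} * {ffun node_pair n -> bool})%type.

Definition share_key (K P : nat) (A B : key_set K P) : bool :=
  val A :&: val B != set0.

(* [i = j] is excluded: no [node_pair] has [[set i; i]] as its value. *)
Definition channel_on (n : nat) (c : {ffun node_pair n -> bool}) : rel 'I_n :=
  [rel i j | [exists e : node_pair n, (val e == [set i; j]) && c e]].

Definition adjacent (n K P : nat) (w : outcome n K P) : rel 'I_n :=
  [rel i j | share_key (w.1 i) (w.1 j) && channel_on w.2 i j].

(* Independent uniform key sets, and independent Bernoulli(p) channels. *)
Definition weight (R : numFieldType) (n K P : nat) (p : R)
    (w : outcome n K P) : R :=
  (\prod_(i < n) #|key_set K P|%:R^-1) *
  (\prod_(e : node_pair n) (if w.2 e then p else 1 - p)).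

Definition Pr (R : numFieldType) (n K P : nat) (p : R)
    (E : pred (outcome n K P)) : R :=
  \sum_(w | E w) weight p w.

Definition Pr_k_connected (R : numFieldType) (k n K P : nat) (p : R) : R :=
  Pr p (fun w : outcome n K P => k_connected k (adjacent w)).

(* The probability that two independent uniform K-subsets of the pool meet. *)
Definition key_share_prob (R : numFieldType) (K P : nat) : R :=
  \sum_(AB : key_set K P * key_set K P | share_key AB.1 AB.2)
    #|key_set K P|%:R^-1 * #|key_set K P|%:R^-1.

Definition edge_prob (R : numFieldType) (K P : nat) (p : R) : R :=
  p * key_share_prob R K P.

(* Main.v *)
(** Let [q] be the edge probability. The number [X] of nodes of degree less than [k] is shown to
    be asymptotically Poisson: for a fixed set [T] of [m] nodes, conditionally on the keys of [T]
    the other nodes attach to [T] independently, and unless the key sets of [T] overlap too much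
    (which Markov's inequality makes rare) their common attachment law is close to independent
    Bernoulli([q]) choices. Hence the [m]-th binomial moment of [X] tends to [lam ^ m / m!] with
    [lam = exp (- alpha) / (k - 1)!], and the Bonferroni inequalities give [P(X = 0) -> exp (- lam)].

    If [X = 0] but the graph is not [k]-connected, some set [T] with [2 <= #|T| <= n / 2] has no
    isolated node inside and at most [k - 1] neighbours outside. With high probability the key
    sets are expanding: any [M = eta P / K] nodes or fewer hold nearly as many distinct keys as
    possible, so an outside node misses [T] with probability at most [exp (- 3/4 #|T| q)] as long
    as [#|T| q <= 9]. Each node of [T] has a neighbour in [T], so half of [T] has a neighbour of
    smaller (or of larger) index, which costs [(#|T| q) ^ (#|T| / 2)]; this extra factor pays for
    the loss in the exponent and makes the sum over [T] vanish. *)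
Require Import Defs.
From mathcomp Require Import all_boot all_order all_algebra.
From mathcomp Require Import zify ring lra.

Set Implicit Arguments.
Unset Strict Implicit.
Unset Printing Implicit Defensive.

Import Order.TTheory GRing.Theory Num.Theory.
Local Open Scope ring_scope.

(** * Expectation over independent coordinates *)

Section ProductExpectation.
Variables (R : realFieldType) (I X : finType) (w : I -> X -> R).

(** For [T] of size [m] the chance of low degrees throughout [T] is of order [n^-m], while Markov's
    inequality bounds the probability of too much overlap only by about [1/n], up to powers of
    [ln n]. Rarity alone therefore does not remove the overlapping case from the [m]-th moment; that
    case needs its own bound on low degrees. Expansion supplies about [n^-(m - 1/2)], and the
    product with [1/n] is negligible against [n^-m]. Expansion on a fixed [T] fails with probability
    at most [n^-(m+1)].

    Hence [expanding] carries a precision [d], the loss in the exponent being [3/d]: [d = 6 m] for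
    moments, and [d = 12] for cuts, where the sum over [T] converges as soon as more than half of
    the exponent survives. It is stated relative to [T], because the nodes outside [T] stay
    independent only if the event reads no key outside [T]. Two limits make expansion work:
    [P = Omega(n)] forces [K] to infinity, and with [K/P = o(1)] the share probability times [M]
    diverges, so truncating at [M] nodes costs little. *)

Definition Ex (F : {ffun I -> X} -> R) : R :=
  \sum_(f : {ffun I -> X}) (\prod_i w i (f i)) * F f.

Definition mix (A : {set I}) (f g : {ffun I -> X}) : {ffun I -> X} :=
  [ffun i => if i \in A then f i else g i].

Definition depends_on (U : Type) (A : {set I}) (F : {ffun I -> X} -> U) : Prop :=
  forall f g : {ffun I -> X}, (forall i, i \in A -> f i = g i) -> F f = F g.

Lemma eq_Ex F G : (forall f, F f = G f) -> Ex F = Ex G.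
Proof. by move=> FG; apply: eq_bigr => f _; rewrite FG. Qed.

Lemma ExD F G : Ex (fun f => F f + G f) = Ex F + Ex G.
Proof. by rewrite /Ex -big_split; apply: eq_bigr => f _; rewrite mulrDr. Qed.

Lemma ExN F : Ex (fun f => - F f) = - Ex F.
Proof. by rewrite /Ex -sumrN; apply: eq_bigr => f _; rewrite mulrN. Qed.

Lemma ExB F G : Ex (fun f => F f - G f) = Ex F - Ex G.
Proof. by rewrite ExD ExN. Qed.

Lemma ExZl c F : Ex (fun f => c * F f) = c * Ex F.
Proof. by rewrite /Ex mulr_sumr; apply: eq_bigr => f _; rewrite mulrCA. Qed.

Lemma ExZr c F : Ex (fun f => F f * c) = Ex F * c.
Proof. by rewrite mulrC -ExZl; apply: eq_Ex => f; rewrite mulrC. Qed.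

Lemma Ex_sum (J : Type) (r : seq J) (Q : pred J) (F : J -> {ffun I -> X} -> R) :
  Ex (fun f => \sum_(j <- r | Q j) F j f) = \sum_(j <- r | Q j) Ex (F j).
Proof. by rewrite /Ex exchange_big /=; apply: eq_bigr => f _; rewrite mulr_sumr. Qed.

Lemma Ex_prod (g : I -> X -> R) :
  Ex (fun f => \prod_i g i (f i)) = \prod_i \sum_x w i x * g i x.
Proof.
by rewrite bigA_distr_bigA; apply: eq_bigr => f _; rewrite -big_split.
Qed.

Hypothesis w1 : forall i, \sum_x w i x = 1.

Lemma Ex1 : Ex (fun=> 1) = 1.
Proof.
rewrite /Ex; under eq_bigr do rewrite mulr1.
by rewrite -bigA_distr_bigA big1.
Qed.

Lemma Ex_coord (v : I) (g : X -> R) :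
  Ex (fun f => g (f v)) = \sum_x w v x * g x.
Proof.
pose h i x := if i == v then g x else 1.
rewrite (eq_Ex (G := fun f : {ffun I -> X} => \prod_i h i (f i))); last first.
  move=> f; rewrite (bigD1 v) //= /h eqxx big1 ?mulr1 //.
  by move=> i /negPf ->.
rewrite Ex_prod (bigD1 v) //= [X in _ * X]big1 ?mulr1.
  by apply: eq_bigr => x _; rewrite /h eqxx.
move=> i /negPf ne; rewrite -[RHS](w1 i); apply: eq_bigr => x _.
by rewrite /h ne mulr1.
Qed.

Lemma Ex_cst c : Ex (fun=> c) = c.
Proof. by rewrite -[RHS]mulr1 -[in RHS]Ex1 -ExZl; apply: eq_Ex => f; rewrite mulr1. Qed.

(* Swapping the coordinates outside [A] of two independent copies preserves the product law. *)
Lemma Ex_mix (A : {set I}) F : Ex F = Ex (fun f => Ex (fun g => F (mix A f g))).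
Proof.
pose s (fg : {ffun I -> X} * {ffun I -> X}) := (mix A fg.1 fg.2, mix A fg.2 fg.1).
have sK : involutive s.
  by case=> f g; congr pair; apply/ffunP => i; rewrite !ffunE /=; case: (i \in A).
transitivity (\sum_(fg : {ffun I -> X} * {ffun I -> X}) (\prod_i w i (fg.1 i)) * (\prod_i w i (fg.2 i)) * F fg.1).
  rewrite -(pair_bigA _ (fun f g : {ffun I -> X} =>
     (\prod_i w i (f i)) * (\prod_i w i (g i)) * F f)) /=.
  apply: eq_bigr => f _; rewrite -mulr_suml -mulr_sumr.
  by rewrite -bigA_distr_bigA [X in _ * X * _]big1 ?mulr1 // => i _; rewrite w1.
rewrite (reindex_inj (inv_inj sK)) /=.
rewrite -(pair_bigA _ (fun f g : {ffun I -> X} =>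
   (\prod_i w i (mix A f g i)) * (\prod_i w i (mix A g f i)) * F (mix A f g))) /=.
apply: eq_bigr => f _; rewrite mulr_sumr; apply: eq_bigr => g _.
rewrite mulrA -!big_split /=; congr (_ * _).
by apply: eq_bigr => i _; rewrite !ffunE; case: ifP => // _; rewrite mulrC.
Qed.

Lemma Ex_indep (A : {set I}) F G :
  depends_on A F -> depends_on (~: A) G ->
  Ex (fun f => F f * G f) = Ex F * Ex G.
Proof.
move=> dF dG; rewrite (Ex_mix A) -ExZr; apply: eq_Ex => f.
rewrite -ExZl; apply: eq_Ex => g; congr (_ * _).
  by apply: dF => i iA; rewrite ffunE iA.
by apply: dG => i; rewrite inE ffunE => /negPf ->.
Qed.

Lemma Ex_indep_prod (J : eqType) (r : seq J) (D : J -> {set I})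
    (F : J -> {ffun I -> X} -> R) :
  uniq r -> (forall j, j \in r -> depends_on (D j) (F j)) ->
  (forall i j, i \in r -> j \in r -> i != j -> [disjoint D i & D j]) ->
  Ex (fun f => \prod_(j <- r) F j f) = \prod_(j <- r) Ex (F j).
Proof.
elim: r => [|j r IH] /= => [_ _ _|/andP[jr ur] dF dD].
  by rewrite big_nil; under eq_Ex do rewrite big_nil; rewrite Ex1.
rewrite big_cons -IH //; last 2 first.
- by move=> i ir; apply: dF; rewrite inE ir orbT.
- by move=> i l ir lr; apply: dD; rewrite inE ?ir ?lr orbT.
under eq_Ex do rewrite big_cons.
apply: (@Ex_indep (D j)); first by apply: dF; rewrite mem_head.
move=> f g fg; rewrite !big_seq; apply: eq_bigr => i ir.
apply: dF; first by rewrite inE ir orbT.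
move=> x xi; apply: fg; rewrite inE.
have /dD : i \in j :: r by rewrite inE ir orbT.
move=> /(_ j); rewrite mem_head => /(_ isT); have -> : i != j.
  by apply: contraNneq jr => <-.
by move=> /(_ isT); rewrite disjoint_subset => /subsetP /(_ x xi).
Qed.

Hypothesis w0 : forall i x, 0 <= w i x.

Lemma Ex_le F G : (forall f, F f <= G f) -> Ex F <= Ex G.
Proof.
move=> FG; apply: ler_sum => f _; apply: ler_wpM2l => //.
by apply: prodr_ge0 => i _.
Qed.

Lemma Ex_ge0 F : (forall f, 0 <= F f) -> 0 <= Ex F.
Proof. by move=> F0; rewrite -(Ex_cst 0); apply: Ex_le. Qed.

Lemma Ex_le_cst F c : (forall f, F f <= c) -> Ex F <= c.
Proof. by move=> F0; rewrite -(Ex_cst c); apply: Ex_le. Qed.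

End ProductExpectation.

(** * Random sets with independent elements *)

Section BernoulliSets.
Variables (R : realFieldType) (V : finType).

Definition bern (x : V -> R) (B : {set V}) : R :=
  \prod_j (if j \in B then x j else 1 - x j).

Lemma bern_ge0 x B : (forall j, 0 <= x j <= 1) -> 0 <= bern x B.
Proof.
move=> x01; apply: prodr_ge0 => j _; case/andP: (x01 j) => x0 x1.
by case: ifP; rewrite ?subr_ge0.
Qed.

Lemma sum_bern_supset x (C : {set V}) :
  \sum_(B : {set V} | C \subset B) bern x B = \prod_(j in C) x j.
Proof.
(* Giving weight 0 to the absence of an element of [C] turns the sum over supersets into a sum over
   all sets, which factors as the product of the [x j + y j]. *)
pose y j := if j \in C then 0 else 1 - x j.
transitivity (\sum_(B : {set V}) \prod_j (if j \in B then x j else y j)).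
  rewrite big_mkcond; apply: eq_bigr => B _; case: ifPn => [/subsetP CB|].
    apply: eq_bigr => j _; case: ifPn => // jB; rewrite /y ifN //.
    by apply: contraNN jB; apply: CB.
  case/subsetPn => j jC jB; rewrite (bigD1 j) //= (negPf jB) /y jC.
  by rewrite mul0r.
rewrite -bigA_distr [RHS]big_mkcond; apply: eq_bigr => j _.
by rewrite /y; case: (j \in C) => /=; [exact: addr0 | rewrite [LHS]addrC; exact: subrK].
Qed.

Lemma sum_bern x : \sum_(B : {set V}) bern x B = 1.
Proof.
rewrite -[RHS](@big_pred0_eq _ 1 *%R V (index_enum V) (fun j => x j)).
rewrite -(eq_bigl _ _ (in_set0 (T := V))) -sum_bern_supset.
by apply: eq_bigl => B; rewrite sub0set.
Qed.

Lemma bern0 x : bern x set0 = \prod_j (1 - x j).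
Proof. by apply: eq_bigr => j _; rewrite inE. Qed.

(** The nodes of [T] get the constant entry [set0], so that a pattern is a function on all of [V]
    and its law a plain product. *)
Definition ext_weight (T : {set V}) (a : {set V} -> R) (v : V) (B : {set V}) : R :=
  if v \in T then (B == set0)%:R else a B.

(** An event about a whole set becomes a product over single elements, the form to which
    independence applies. *)
Lemma eq_set_prod (A B : {set V}) :
  (A == B)%:R = \prod_j (if j \in B then (j \in A)%:R else 1 - (j \in A)%:R) :> R.
Proof.
case: eqP => [->|/eqP AB].
  by rewrite big1 // => j _; case: (j \in B); rewrite ?subr0.
have : [exists j, (j \in A) != (j \in B)].
  apply: contraNT AB; rewrite negb_exists => /forallP h; apply/eqP/setP => j.
  by have /negPn/eqP := h j.
case/existsP=> j jAB; rewrite (bigD1 j) //=; move: jAB.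
by case: (j \in A); case: (j \in B); rewrite //= ?subrr mul0r.
Qed.

End BernoulliSets.

(** * Ratios of falling factorials and of binomial coefficients *)

Lemma ffact_ratio_le (x P K : nat) : (x <= P)%N -> (x ^_ K * P ^ K <= x ^ K * P ^_ K)%N.
Proof.
move=> xP; elim: K => [|K IH]; first by rewrite !ffactn0 !expn0.
rewrite !ffactnSr !expnS.
(* One factor at a time: [(x - K) / (P - K) <= x / P], cross-multiplied to stay in [nat]. *)
have h : ((x - K) * P <= x * (P - K))%N by nia.
by have := leq_mul h IH; rewrite mulnACA [X in (_ <= X)%N]mulnACA; lia.
Qed.

Lemma bin_ratio_le (x P K : nat) : (x <= P)%N -> ('C(x, K) * P ^ K <= x ^ K * 'C(P, K))%N.
Proof.
move=> xP; have := ffact_ratio_le K xP; rewrite -!bin_ffact => h.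
by rewrite -(leq_pmul2r (fact_gt0 K)); lia.
Qed.

(** The factors [(x - i) / (P - i)] decrease with [i], so each of them is at least its value at
    [i = K]. Used with [x = P - K] to bound the share probability from above. *)
Lemma ffact_ratio_ge (x P K i : nat) : (K <= x)%N -> (x <= P)%N -> (i <= K)%N ->
  (P ^_ i * (x - K) ^ i <= x ^_ i * (P - K) ^ i)%N.
Proof.
move=> Kx xP; elim: i => [|i IH] iK; first by rewrite !ffactn0 !expn0.
rewrite !ffactnSr !expnS.
have h : ((P - i) * (x - K) <= (x - i) * (P - K))%N by nia.
by have := leq_mul (IH (ltnW iK)) h; lia.
Qed.

Lemma bin_ratio_ge (x P K : nat) : (K <= x)%N -> (x <= P)%N ->
  ('C(P, K) * (x - K) ^ K <= 'C(x, K) * (P - K) ^ K)%N.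
Proof.
move=> Kx xP; have := ffact_ratio_ge Kx xP (leqnn K); rewrite -!bin_ffact => h.
by rewrite -(leq_pmul2r (fact_gt0 K)); lia.
Qed.

(** * One uniform key set *)

Section Keys.
Variables (R : realFieldType) (K P : nat).

Definition key_ex (g : key_set K P -> R) : R := \sum_s #|key_set K P|%:R^-1 * g s.

Lemma card_key_sub (X : {set 'I_P}) :
  #|[set s : key_set K P | val s \subset X]| = 'C(#|X|, K).
Proof.
rewrite -cards_draws -(card_imset _ val_inj); apply: eq_card => A.
apply/imsetP/idP => [[s]|]; rewrite !inE.
  by move=> sX ->; rewrite sX; apply: (valP s).
by case/andP=> AX AK; exists (Sub A AK : key_set K P); rewrite ?inE ?SubK.
Qed.

Lemma card_key_set : #|key_set K P| = 'C(P, K).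
Proof.
have := card_key_sub [set: 'I_P]; rewrite cardsT card_ord => <-.
by rewrite -cardsT; apply: eq_card => s; rewrite !inE subsetT.
Qed.

Hypothesis KP : (K <= P)%N.

Lemma key_card_gt0 : 0 < #|key_set K P|%:R :> R.
Proof. by rewrite ltr0n card_key_set bin_gt0. Qed.

Lemma key_ex_sub (X : {set 'I_P}) :
  key_ex (fun s => (val s \subset X)%:R) = 'C(#|X|, K)%:R / 'C(P, K)%:R.
Proof.
rewrite /key_ex -mulr_sumr mulrC card_key_set; congr (_ / _).
rewrite -card_key_sub -sum1_card natr_sum [RHS]big_mkcond /=.
by apply: eq_bigr => s _; rewrite inE; case: ifP.
Qed.

Lemma key_ex1 : key_ex (fun=> 1) = 1.
Proof.
rewrite /key_ex -mulr_sumr sumr_const mulVf //.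
by have := key_card_gt0; rewrite lt0r => /andP[].
Qed.

Lemma key_w1 : \sum_(s : key_set K P) #|key_set K P|%:R^-1 = 1 :> R.
Proof. by rewrite -[RHS]key_ex1; apply: eq_bigr => s _; rewrite mulr1. Qed.

Lemma eq_key_ex f g : (forall s, f s = g s) -> key_ex f = key_ex g.
Proof. by move=> fg; apply: eq_bigr => s _; rewrite fg. Qed.

Lemma key_exB f g : key_ex (fun s => f s - g s) = key_ex f - key_ex g.
Proof. by rewrite /key_ex -sumrB; apply: eq_bigr => s _; rewrite mulrBr. Qed.

Lemma key_exZl c f : key_ex (fun s => c * f s) = c * key_ex f.
Proof. by rewrite /key_ex mulr_sumr; apply: eq_bigr => s _; rewrite mulrCA. Qed.

Lemma key_ex_sum (J : Type) (r : seq J) (Q : pred J) (F : J -> key_set K P -> R) :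
  key_ex (fun s => \sum_(j <- r | Q j) F j s) = \sum_(j <- r | Q j) key_ex (F j).
Proof. by rewrite /key_ex exchange_big /=; apply: eq_bigr => f _; rewrite mulr_sumr. Qed.

Lemma key_ex_le f g : (forall s, f s <= g s) -> key_ex f <= key_ex g.
Proof.
by move=> fg; apply: ler_sum => s _; apply: ler_wpM2l => //; rewrite invr_ge0.
Qed.

Lemma key_ex_cst c : key_ex (fun=> c) = c.
Proof.
by rewrite -[RHS]mulr1 -[in RHS]key_ex1 -key_exZl; apply: eq_key_ex => f; rewrite mulr1.
Qed.

Lemma key_ex_ge0 f : (forall s, 0 <= f s) -> 0 <= key_ex f.
Proof. by move=> f0; rewrite -(key_ex_cst 0); apply: key_ex_le. Qed.

Lemma key_ex_avoid (X : {set 'I_P}) :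
  key_ex (fun s => (val s :&: X == set0)%:R) = 'C(P - #|X|, K)%:R / 'C(P, K)%:R.
Proof.
have -> : (P - #|X|)%N = #|~: X| by rewrite [RHS]cardsCs setCK card_ord.
rewrite -key_ex_sub; apply: eq_key_ex => s.
by rewrite setI_eq0 disjoints_subset.
Qed.

Lemma key_ex_sub_le (X : {set 'I_P}) : (0 < P)%N ->
  key_ex (fun s => (val s \subset X)%:R) <= (#|X|%:R / P%:R) ^+ K.
Proof.
move=> P0; rewrite key_ex_sub expr_div_n ler_pdivrMr ?ltr0n ?bin_gt0 //.
rewrite mulrAC ler_pdivlMr ?exprn_gt0 ?ltr0n // -!natrX -!natrM ler_nat.
by apply: bin_ratio_le; rewrite -[P in (_ <= P)%N]card_ord max_card.
Qed.

Lemma key_ex_avoid_le (X : {set 'I_P}) : (0 < P)%N ->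
  key_ex (fun s => (val s :&: X == set0)%:R) <= (1 - #|X|%:R / P%:R) ^+ K.
Proof.
move=> P0; apply: le_trans (_ : (#|~: X|%:R / P%:R) ^+ K <= _).
  apply: le_trans (key_ex_sub_le _ P0).
  by apply: key_ex_le => s; rewrite setI_eq0 disjoints_subset.
have XP : (#|X| <= P)%N by rewrite -[P in (_ <= P)%N]card_ord max_card.
rewrite cardsCs setCK card_ord natrB // mulrBl divff //.
by rewrite pnatr_eq0 -lt0n.
Qed.

Lemma share_keyC (A B : key_set K P) : share_key A B = share_key B A.
Proof. by rewrite /share_key setIC. Qed.

Lemma key_ex_share (A : key_set K P) :
  key_ex (fun s => (share_key s A)%:R) = 1 - 'C(P - K, K)%:R / 'C(P, K)%:R.
Proof.
have -> : 'C(P - K, K)%:R / 'C(P, K)%:R = key_ex (fun s => (val s :&: val A == set0)%:R).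
  by rewrite key_ex_avoid (eqP (valP A)).
rewrite -[X in _ = X - _]key_ex1 -key_exB; apply: eq_key_ex => s.
by rewrite /share_key; case: eqP; rewrite /= ?subrr ?subr0.
Qed.

(** The value in [key_ex_share] is the same for every fixed set [A], so averaging over [A] does not
    change it. If [P < 2 K] the upper binomial vanishes and the value is 1. *)
Lemma key_share_probE :
  key_share_prob R K P = 1 - 'C(P - K, K)%:R / 'C(P, K)%:R.
Proof.
rewrite /key_share_prob big_mkcond /=.
rewrite -(pair_bigA _ (fun A B : key_set K P => if share_key A B then
   #|key_set K P|%:R^-1 * #|key_set K P|%:R^-1 else 0 : R)) /=.
rewrite -[RHS]key_ex_cst; apply: eq_bigr => A _.
rewrite -(key_ex_share A) mulr_sumr; apply: eq_bigr => B _.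
by rewrite share_keyC; case: share_key; rewrite ?mulr1 ?mulr0.
Qed.

Lemma key_ex_shareE (A : key_set K P) :
  key_ex (fun s => (share_key s A)%:R) = key_share_prob R K P.
Proof. by rewrite key_ex_share key_share_probE. Qed.

Lemma key_share_ge0 : 0 <= key_share_prob R K P.
Proof.
by apply: sumr_ge0 => AB _; rewrite mulr_ge0 ?invr_ge0.
Qed.

Lemma key_share_le1 : key_share_prob R K P <= 1.
Proof. by rewrite key_share_probE gerBl divr_ge0. Qed.

Lemma key_share_ge : (0 < P)%N -> 1 - (1 - K%:R / P%:R) ^+ K <= key_share_prob R K P.
Proof.
move=> P0; rewrite key_share_probE lerB //.
have [X XK] : exists X : {set 'I_P}, #|X| = K.
  have : (0 < #|key_set K P|)%N by rewrite card_key_set bin_gt0.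
  by case/card_gt0P => A _; exists (val A); apply/eqP/(valP A).
by have := key_ex_avoid_le X P0; rewrite key_ex_avoid XK.
Qed.

Lemma key_share_le : (2 * K < P)%N ->
  key_share_prob R K P <= 1 - (1 - K%:R / (P%:R - K%:R)) ^+ K.
Proof.
move=> KP2; rewrite key_share_probE lerB //.
have PK : 0 < P%:R - K%:R :> R by rewrite -natrB // ltr0n; lia.
have -> : 1 - K%:R / (P%:R - K%:R) = (P - K - K)%:R / (P - K)%:R :> R.
  rewrite [X in _ = _ / X]natrB // natrB; last by lia.
  by rewrite natrB // mulrBl divff // gt_eqF.
rewrite expr_div_n ler_pdivrMr; last by rewrite exprn_gt0 // ltr0n; lia.
rewrite mulrAC ler_pdivlMr ?ltr0n ?bin_gt0 // -!natrX -!natrM ler_nat.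
by rewrite mulnC; apply: bin_ratio_ge; lia.
Qed.

End Keys.

(** * Channels as coordinates indexed by pairs *)

Section Channels.
Variable n : nat.

Definition chan_set (i j : 'I_n) : {set node_pair n} := [set e | val e == [set i; j]].

Definition chan (i j : 'I_n) (ij : i != j) : node_pair n :=
  exist (fun e : {set 'I_n} => #|e| == 2) [set i; j] (introT eqP (etrans (cards2 i j) (congr1 S (congr1 nat_of_bool ij)))).

Lemma channel_onE (c : {ffun node_pair n -> bool}) i j (ij : i != j) :
  channel_on c i j = c (chan ij).
Proof.
rewrite /channel_on /=; apply/existsP/idP => [[e /andP[/eqP ve ce]]|ce].
  by rewrite (_ : chan ij = e) //; apply: val_inj.
by exists (chan ij); rewrite eqxx.
Qed.

Lemma channel_onC (c : {ffun node_pair n -> bool}) i j :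
  channel_on c i j = channel_on c j i.
Proof. by rewrite /channel_on /=; apply: eq_existsb => e; rewrite setUC. Qed.

Lemma channel_on_irr (c : {ffun node_pair n -> bool}) i : channel_on c i i = false.
Proof.
rewrite /channel_on /=; apply/existsP => -[e /andP[/eqP ve _]].
by have /= := valP e; rewrite ve setUid cards1.
Qed.

Lemma channel_on_dep i j : depends_on (chan_set i j) (fun c => channel_on c i j).
Proof.
move=> c c' cc'; rewrite /channel_on /=; apply: eq_existsb => e.
by case: eqP => //= ve; rewrite cc' // inE; apply/eqP.
Qed.

End Channels.

(** * The model as a product law, and attachment to a fixed set *)

Section Model.
Variables (R : realFieldType) (n K P : nat) (p : R).
Hypothesis KP : (K <= P)%N.
Hypothesis p01 : 0 <= p <= 1.

Definition kw : 'I_n -> key_set K P -> R := fun _ _ => #|key_set K P|%:R^-1.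
Definition cw : node_pair n -> bool -> R := fun _ b => if b then p else 1 - p.

Lemma kw1 i : \sum_s kw i s = 1. Proof. exact: key_w1. Qed.
Lemma kw0 i s : 0 <= kw i s. Proof. by rewrite invr_ge0. Qed.
Lemma cw1 e : \sum_b cw e b = 1.
Proof. by rewrite big_bool /= addrC subrK. Qed.
Lemma cw0 e b : 0 <= cw e b.
Proof. by case/andP: p01 => p0 p1; case: b; rewrite //= subr_ge0. Qed.

Local Notation keys := {ffun 'I_n -> key_set K P}.
Local Notation chans := {ffun node_pair n -> bool}.

(** Channels are integrated inside the keys, so the inner [Ex] is the conditional expectation given
    all key sets. *)
Definition EE (F : keys -> chans -> R) : R := Ex kw (fun S => Ex cw (F S)).

Lemma PrE (E : pred (outcome n K P)) : Pr p E = EE (fun S c => (E (S, c))%:R).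
Proof.
rewrite /Pr big_mkcond /EE /Ex /=.
rewrite (eq_bigr (fun w : keys * chans => weight p w * (E w)%:R)); last first.
  by move=> w _; case: (E w); rewrite ?mulr1 ?mulr0.
rewrite (eq_bigr (fun w : keys * chans => (\prod_i kw i (w.1 i)) *
    ((\prod_e cw e (w.2 e)) * (E (w.1, w.2))%:R))); last first.
  by case=> S c _; rewrite mulrA.
rewrite -(pair_bigA _ (fun (S : keys) (c : chans) => (\prod_i kw i (S i)) *
    ((\prod_e cw e (c e)) * (E (S, c))%:R))) /=.
by apply: eq_bigr => S _; rewrite mulr_sumr.
Qed.

Lemma eq_EE F G : (forall S c, F S c = G S c) -> EE F = EE G.
Proof. by move=> FG; apply: eq_Ex => S; apply: eq_Ex => c. Qed.

Lemma EE_le F G : (forall S c, F S c <= G S c) -> EE F <= EE G.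
Proof.
by move=> FG; apply: (Ex_le kw0) => S; apply: (Ex_le cw0) => c.
Qed.

Lemma EE_sum (J : Type) (r : seq J) (Q : pred J) (F : J -> keys -> chans -> R) :
  EE (fun S c => \sum_(j <- r | Q j) F j S c) = \sum_(j <- r | Q j) EE (F j).
Proof. by rewrite /EE -Ex_sum; apply: eq_Ex => S; rewrite Ex_sum. Qed.

Lemma EED F G : EE (fun S c => F S c + G S c) = EE F + EE G.
Proof. by rewrite /EE -ExD; apply: eq_Ex => S; rewrite ExD. Qed.

Lemma EEB F G : EE (fun S c => F S c - G S c) = EE F - EE G.
Proof. by rewrite /EE -ExB; apply: eq_Ex => S; rewrite ExB. Qed.

Lemma EEZl a F : EE (fun S c => a * F S c) = a * EE F.
Proof. by rewrite /EE -ExZl; apply: eq_Ex => S; rewrite ExZl. Qed.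

Definition adj (S : keys) (c : chans) (i j : 'I_n) : bool :=
  share_key (S i) (S j) && channel_on c i j.

Lemma adjC S c i j : adj S c i j = adj S c j i.
Proof. by rewrite /adj share_keyC channel_onC. Qed.

Lemma adj_irr S c i : adj S c i i = false.
Proof. by rewrite /adj channel_on_irr andbF. Qed.

Lemma Ex_chan i j (g : bool -> R) : i != j ->
  Ex cw (fun c => g (channel_on c i j)) = p * g true + (1 - p) * g false.
Proof.
move=> ij; rewrite (eq_Ex _ (G := fun c : chans => g (c (chan ij)))).
  by rewrite (Ex_coord cw1) big_bool.
by move=> c; rewrite channel_onE.
Qed.

Lemma Ex_adj S i j (g : bool -> R) : i != j ->
  Ex cw (fun c => g (adj S c i j)) =
  p * (share_key (S i) (S j))%:R * g true + (1 - p * (share_key (S i) (S j))%:R) * g false.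
Proof.
move=> ij; rewrite (Ex_chan (fun b => g (share_key (S i) (S j) && b))) //.
by case: share_key => /=; rewrite ?mulr1 // !mulr0 subr0 mul0r; ring.
Qed.

Section Pattern.
Variable T : {set 'I_n}.

(** Edges inside [T] are left out: they read the channels of [inside], which are disjoint from those
    read here. *)
Definition pattern (S : keys) (c : chans) : {ffun 'I_n -> {set 'I_n}} :=
  [ffun v => if v \in T then set0 else [set j in T | adj S c v j]].

Definition conn_prob (S : keys) (s : key_set K P) (j : 'I_n) : R :=
  if j \in T then p * (share_key s (S j))%:R else 0.

(** The key set of the outside node is averaged out, so this law involves only the keys of [T] and
    is common to all outside nodes. *)
Definition pat_law (S : keys) (B : {set 'I_n}) : R :=
  key_ex (fun s => bern (conn_prob S s) B).

Definition pat_weight (S : keys) : 'I_n -> {set 'I_n} -> R :=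
  ext_weight T (pat_law S).

Lemma conn_prob01 S s j : 0 <= conn_prob S s j <= 1.
Proof.
case/andP: p01 => p0 p1; rewrite /conn_prob; case: ifP; rewrite ?lexx ?ler01 //.
by case: share_key; rewrite ?mulr1 ?mulr0 ?p0 ?lexx ?ler01.
Qed.

(** [pat_weight] before averaging: the law of one entry once the key set [s] of its own node is
    known too. *)
Let kappa (S : keys) (v : 'I_n) (s : key_set K P) (B : {set 'I_n}) : R :=
  if v \in T then (B == set0)%:R else bern (conn_prob S s) B.

Lemma Ex_pattern1 S v B : v \notin T ->
  Ex cw (fun c => ([set j in T | adj S c v j] == B)%:R) = bern (conn_prob S (S v)) B.
Proof.
move=> vT.
rewrite (eq_Ex _ (G := fun c => \prod_j (if j \in B then ((j \in T) && adj S c v j)%:R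
   else 1 - ((j \in T) && adj S c v j)%:R))); last first.
  move=> c; rewrite eq_set_prod; apply: eq_bigr => j _.
  by rewrite !inE.
rewrite (@Ex_indep_prod _ _ _ _ cw1 _ _ (fun j => if j \in T then chan_set v j else set0)
  (fun j c => if j \in B then ((j \in T) && adj S c v j)%:R
   else 1 - ((j \in T) && adj S c v j)%:R)) ?index_enum_uniq //; last 2 first.
- move=> j _ c c' cc'; case: ifPn cc' => //= jT cc'.
  by rewrite /adj (channel_on_dep cc').
- move=> i j _ _ ij; rewrite -setI_eq0; case: ifPn => iT; rewrite ?set0I //.
  case: ifPn => jT; rewrite ?setI0 //; apply/eqP/setP => e; rewrite !inE; apply/negP.
  case/andP=> /eqP -> /eqP/setP/(_ i); rewrite !inE eqxx orbT (negPf ij) orbF.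
  by move/esym/eqP=> iv; move: vT; rewrite -iv iT.
apply: eq_bigr => j _; rewrite /conn_prob; case: ifPn => jB; case: ifPn => jT /=.
- rewrite (Ex_adj S (fun b => b%:R)); last by apply: contraNneq vT => ->.
  by rewrite mulr1 mulr0 addr0.
- by rewrite Ex_cst //; exact: cw1.
- rewrite (Ex_adj S (fun b => 1 - b%:R)); last by apply: contraNneq vT => ->.
  by rewrite subrr mulr0 subr0 mulr1 add0r.
- by rewrite Ex_cst //; exact: cw1.
Qed.

Definition inside : {set node_pair n} := [set e : node_pair n | val e \subset T].
Let across (v : 'I_n) : {set node_pair n} :=
  if v \in T then set0 else \bigcup_(j in T) chan_set v j.

Lemma pattern_dep S v : depends_on (across v) (fun c => pattern S c v).
Proof.
move=> c c' cc'; rewrite !ffunE; move: cc'; rewrite /across; case: ifPn => // vT cc'.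
apply/setP => j; rewrite !inE; case: (boolP (j \in T)) => //= jT.
rewrite /adj (channel_on_dep (g := c')) // => e ej; apply: cc'.
by apply/bigcupP; exists j.
Qed.

Lemma across_disj u v : u != v -> [disjoint across u & across v].
Proof.
move=> uv; rewrite -setI_eq0 /across; case: ifPn => uT; rewrite ?set0I //.
case: ifPn => vT; rewrite ?setI0 //; apply/eqP/setP => e; rewrite !inE.
apply/negP => /andP[/bigcupP[i iT]]; rewrite inE => /eqP ei.
case/bigcupP=> j jT; rewrite inE ei => /eqP/setP/(_ u).
rewrite !inE eqxx (negPf uv) /= => /esym/eqP uj.
by move: uT; rewrite uj jT.
Qed.

Lemma across_inside v : [disjoint across v & inside].
Proof.
rewrite -setI_eq0 /across; case: ifPn => vT; rewrite ?set0I //.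
apply/eqP/setP => e; rewrite !inE; apply/negP => /andP[/bigcupP[i iT]].
rewrite inE => /eqP ->; rewrite subUset sub1set => /andP[vT' _].
by rewrite vT' in vT.
Qed.

(** With all keys fixed only channels are random, and the channels from distinct outside nodes to
    [T] and those inside [T] form disjoint families. *)
Lemma Ex_kappa S (h : chans -> R) (b : {ffun 'I_n -> {set 'I_n}}) :
  depends_on inside h ->
  Ex cw (fun c => h c * (pattern S c == b)%:R) =
  Ex cw h * \prod_v kappa S v (S v) (b v).
Proof.
move=> dh.
have patE c : (pattern S c == b)%:R = \prod_v (pattern S c v == b v)%:R :> R.
  case: eqP => [->|/eqP ne].
    by rewrite big1 // => v _; rewrite eqxx.
  have [v vne] : exists v, pattern S c v != b v.
    apply/existsP; apply: contraNT ne; rewrite negb_exists => /forallP h'.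
    by apply/eqP/ffunP => v; apply/eqP/negPn.
  by rewrite (bigD1 v) //= (negPf vne) mul0r.
rewrite (Ex_indep cw1 (A := inside)) //; last first.
  move=> c c' cc'; rewrite !patE; apply: eq_bigr => v _.
  have -> // : pattern S c v = pattern S c' v.
  apply: pattern_dep => e ev; apply: cc'; rewrite inE.
  by have := across_inside v; rewrite disjoint_subset => /subsetP/(_ e ev).
congr (_ * _); rewrite (eq_Ex _ patE).
rewrite (@Ex_indep_prod _ _ _ _ cw1 _ _ across
   (fun v c => (pattern S c v == b v)%:R)) ?index_enum_uniq //; last 2 first.
- by move=> v _ c c' cc'; rewrite (pattern_dep S cc').
- by move=> u v _ _; apply: across_disj.
apply: eq_bigr => v _; rewrite /kappa; case: ifPn => vT.
  rewrite (eq_Ex _ (G := fun=> (b v == set0)%:R)) ?Ex_cst //; first exact: cw1.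
  by move=> c; rewrite ffunE vT eq_sym.
rewrite -Ex_pattern1 //; apply: eq_Ex => c.
by rewrite ffunE (negPf vT).
Qed.

Lemma sum_eq_ffun (b : {ffun 'I_n -> {set 'I_n}}) (Phi : {ffun 'I_n -> {set 'I_n}} -> R) :
  Phi b = \sum_a (b == a)%:R * Phi a.
Proof.
rewrite (bigD1 b) //= eqxx mul1r big1 ?addr0 // => a /negPf.
by rewrite eq_sym => ->; rewrite mul0r.
Qed.

(* Conditionally on the keys and channels of [T], the nodes outside [T] attach to [T] independently. *)
Lemma EE_pattern (h : keys -> chans -> R) (Phi : {ffun 'I_n -> {set 'I_n}} -> R) :
  (forall S, depends_on inside (h S)) ->
  (forall c, depends_on T (h^~ c)) ->
  EE (fun S c => h S c * Phi (pattern S c)) =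
  Ex kw (fun S => Ex cw (h S) * Ex (pat_weight S) Phi).
Proof.
move=> hc hS.
transitivity (\sum_b Phi b * EE (fun S c => h S c * (pattern S c == b)%:R)).
  rewrite -[LHS](_ : EE (fun S c => \sum_b Phi b * (h S c * (pattern S c == b)%:R)) = _).
    by rewrite EE_sum; apply: eq_bigr => b _; rewrite EEZl.
  apply: eq_EE => S c; rewrite [in RHS](sum_eq_ffun (pattern S c)) mulr_sumr.
  by apply: eq_bigr => b _; ring.
rewrite (eq_Ex _ (G := fun S => \sum_b Phi b *
    (Ex cw (h S) * \prod_v pat_weight S v (b v)))); last first.
  by move=> S; rewrite /Ex mulr_sumr; apply: eq_bigr => b _; ring.
rewrite Ex_sum; apply: eq_bigr => b _; rewrite ExZl; congr (_ * _).
rewrite /EE (eq_Ex _ (fun S => Ex_kappa S b (hc S))).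
(* Resampling the keys outside [T] changes neither [h] nor [conn_prob]; it only averages each
   [kappa] over the key set of its node, which gives [pat_law]. *)
rewrite (Ex_mix kw1 T); apply: eq_Ex => S.
have hmix S' : Ex cw (h (mix T S S')) = Ex cw (h S).
  apply: eq_Ex => c; apply: (hS c) => i iT; by rewrite ffunE iT.
have cmix S' s : conn_prob (mix T S S') s =1 conn_prob S s.
  by move=> j; rewrite /conn_prob ffunE; case: (j \in T).
rewrite (eq_Ex _ (G := fun S' : keys => Ex cw (h S) * \prod_v kappa S v (S' v) (b v))); last first.
  move=> S'; rewrite hmix; congr (_ * _); apply: eq_bigr => v _.
  rewrite /kappa ffunE; case: ifP => // vT.
  by rewrite vT; apply: eq_bigr => j _; rewrite cmix.
rewrite ExZl (Ex_prod _ (fun v s => kappa S v s (b v))); congr (_ * _).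
apply: eq_bigr => v _; rewrite /kappa /pat_weight /ext_weight; case: ifP => // _.
by rewrite -mulr_suml kw1 mul1r.
Qed.

Lemma pat_law_ge0 S B : 0 <= pat_law S B.
Proof. by apply: key_ex_ge0 => // s; apply: bern_ge0 => j; apply: conn_prob01. Qed.

Lemma pat_law_supset S (C : {set 'I_n}) :
  \sum_(B : {set 'I_n} | C \subset B) pat_law S B =
  key_ex (fun s => \prod_(j in C) conn_prob S s j).
Proof.
by rewrite /pat_law -key_ex_sum; apply: eq_key_ex => s; rewrite sum_bern_supset.
Qed.

Lemma pat_law1 S : \sum_B pat_law S B = 1.
Proof.
rewrite /pat_law -key_ex_sum -[RHS](key_ex1 R KP); apply: eq_key_ex => s.
exact: sum_bern.
Qed.

Lemma pat_law_out S (B : {set 'I_n}) : ~~ (B \subset T) -> pat_law S B = 0.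
Proof.
case/subsetPn => j jB jT; rewrite -[RHS](key_ex_cst KP); apply: eq_key_ex => s.
by rewrite /bern (bigD1 j) //= jB /conn_prob (negPf jT) mul0r.
Qed.

Lemma pat_law_marg S i : i \in T ->
  \sum_(B : {set 'I_n} | i \in B) pat_law S B = edge_prob K P p.
Proof.
move=> iT; rewrite -(eq_bigl _ _ (fun B : {set 'I_n} => sub1set B i)) pat_law_supset.
rewrite /edge_prob -(key_ex_shareE R KP (S i)) -key_exZl.
by apply: eq_key_ex => s; rewrite big_set1 /conn_prob iT.
Qed.

Definition both (S : keys) i j : R :=
  key_ex (fun s => (share_key s (S i))%:R * (share_key s (S j))%:R).

Lemma pat_law_marg2 S i j : i \in T -> j \in T -> i != j ->
  \sum_(B : {set 'I_n} | (i \in B) && (j \in B)) pat_law S B = p ^+ 2 * both S i j.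
Proof.
move=> iT jT ij.
rewrite (eq_bigl (fun B : {set 'I_n} => [set i; j] \subset B)); last first.
  by move=> B; rewrite subUset !sub1set.
rewrite pat_law_supset /both -key_exZl; apply: eq_key_ex => s.
rewrite (big_setU1 _ _) ?inE //= big_set1 /conn_prob iT jT; ring.
Qed.

Lemma pat_law0 S : pat_law S set0 = key_ex (fun s => \prod_(j in T) (1 - p * (share_key s (S j))%:R)).
Proof.
apply: eq_key_ex => s; rewrite bern0 [RHS]big_mkcond; apply: eq_bigr => j _.
by rewrite /conn_prob; case: ifP; rewrite ?subr0.
Qed.

End Pattern.

(** For a fixed third key set the two sharing events concern independent key sets, and their
    probability does not depend on that third set. Hence on average over the keys of [T] two
    attachments are uncorrelated. *)
Lemma Ex_both i j : i != j ->
  Ex kw (fun S => both S i j) = key_share_prob R K P ^+ 2.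
Proof.
move=> ij; rewrite /both /key_ex Ex_sum -[RHS](key_ex_cst KP); apply: eq_bigr => s _.
rewrite ExZl; congr (_ * _).
rewrite (Ex_indep kw1 (A := [set i])) ?expr2.
- have sh k : Ex kw (fun S => (share_key s (S k))%:R) = key_share_prob R K P.
    rewrite (Ex_coord kw1 k (fun x => (share_key s x)%:R)) -(key_ex_shareE R KP s).
    by apply: eq_bigr => x _; rewrite share_keyC.
  by rewrite !sh.
- by move=> f g fg; rewrite fg ?inE.
- by move=> f g fg; rewrite fg // !inE eq_sym.
Qed.

End Model.

(** * Patterns with independent entries of a common law *)

Section PatternLaws.
Variables (R : realFieldType) (V : finType) (T : {set V}) (k : nat).
Implicit Types (a : {set V} -> R) (b : {ffun V -> {set V}}).

(** Only neighbours outside [T] are counted; [low_set_pattern] and [pattern_low_set] relate this to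
    true degrees. *)
Definition low_pattern b : bool :=
  [forall v, b v \subset T] && [forall i in T, #|[set v | i \in b v]| < k]%N.

Definition simple_pattern b : bool := [forall v, #|b v| <= 1]%N.

Definition touched b : {set V} := [set v | b v != set0].

Definition pr_low a : R := Ex (ext_weight T a) (fun b => (low_pattern b)%:R).
(** On simple patterns only the values of [a] at [set0] and at singletons matter, so two laws can be
    compared through these alone. *)
Definition pr_low1 a : R :=
  Ex (ext_weight T a) (fun b => (low_pattern b && simple_pattern b)%:R).

Definition is_law a : Prop := (forall B, 0 <= a B) /\ \sum_B a B = 1.

Lemma ext_weight_ge0 a v B : is_law a -> 0 <= ext_weight T a v B.
Proof. by case=> a0 _; rewrite /ext_weight; case: ifP. Qed.

Lemma ext_weight1 a v : is_law a -> \sum_B ext_weight T a v B = 1.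
Proof.
case=> _ a1; rewrite /ext_weight; case: (v \in T) => //.
by rewrite (bigD1 set0) //= eqxx big1 ?addr0 // => B /negPf ->.
Qed.

Lemma law_le1 a B : is_law a -> a B <= 1.
Proof.
by case=> a0 <-; rewrite (bigD1 B) //= lerDl sumr_ge0.
Qed.

Lemma card_touched b : low_pattern b -> (#|touched b| <= #|T| * k)%N.
Proof.
case/andP=> /forallP bT /forall_inP bk.
have sub : touched b \subset \bigcup_(i in T) [set v | i \in b v].
  apply/subsetP => v; rewrite inE => /set0Pn[i ib]; apply/bigcupP; exists i.
    by apply: (subsetP (bT v)).
  by rewrite inE.
apply: leq_trans (subset_leq_card sub) _; rewrite -sum_nat_const.
apply: (big_ind2 (fun (A : {set V}) m => #|A| <= m)%N); first by rewrite cards0.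
  by move=> A m B m' h h'; apply: leq_trans (leq_card_setU A B).1 (leq_add h h').
by move=> i iT; apply: ltnW (bk i iT).
Qed.

Definition reset (v : V) b : {ffun V -> {set V}} :=
  [ffun u => if u == v then set0 else b u].

Lemma low_reset v b : low_pattern b -> low_pattern (reset v b).
Proof.
case/andP=> /forallP bT /forall_inP bk; apply/andP; split.
  by apply/forallP => u; rewrite ffunE; case: ifP => _; rewrite ?sub0set.
apply/forall_inP => i iT; apply: leq_ltn_trans (bk i iT); apply: subset_leq_card.
by apply/subsetP => u; rewrite !inE ffunE; case: ifP; rewrite ?inE.
Qed.

(* Several nodes of [T] sharing a neighbour is rare, even conditionally on low degrees:
   the offending pattern entry may be reset to [set0]. *)
Lemma pr_low_split a : is_law a ->
  a set0 * (pr_low a - pr_low1 a) <=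
  #|V|%:R * (\sum_(B : {set V} | (1 < #|B|)%N) a B) * pr_low a.
Proof.
move=> la; case: (la) => a0 a1; set d2 := \sum_(B | _) _.
have w0 := fun v B => @ext_weight_ge0 a v B la.
have w1 := fun v => @ext_weight1 a v la.
have d20 : 0 <= d2 by apply: sumr_ge0.
pose w := ext_weight T a.
have coord v : Ex w (fun b => (1 < #|b v|)%N%:R) <= d2.
  rewrite (Ex_coord w1 v (fun B : {set V} => (1 < #|B|)%N%:R)) /d2 /w /ext_weight.
  case: (v \in T).
    rewrite big1 // => B _; case: eqP => [->|_]; last by rewrite mul0r.
    by rewrite cards0 mulr0.
  rewrite [X in _ <= X]big_mkcond; apply: ler_sum => B _.
  by case: ifP; rewrite ?mulr1 ?mulr0.
(* The entry at [v] is independent of the reset pattern, and if that entry is already [set0] the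
   reset does nothing. *)
have step v : a set0 * Ex w (fun b => (low_pattern (reset v b))%:R) <= pr_low a.
  apply: le_trans (_ : Ex w (fun b => (b v == set0)%:R) *
      Ex w (fun b => (low_pattern (reset v b))%:R) <= _).
    apply: ler_wpM2r; first by apply: (Ex_ge0 w1 w0) => b.
    rewrite (Ex_coord w1 v (fun B : {set V} => (B == set0)%:R)) (bigD1 set0) //= eqxx mulr1.
    rewrite big1 ?addr0; last by move=> B /negPf ->; rewrite mulr0.
    by rewrite /w /ext_weight eqxx; case: ifP => // _; apply: law_le1.
  rewrite -(Ex_indep w1 (A := [set v])); last 2 first.
  - by move=> f g fg; rewrite fg ?inE.
  - move=> f g fg; congr ((low_pattern _)%:R); apply/ffunP => u; rewrite !ffunE.
    by case: ifPn => // uv; apply: fg; rewrite !inE.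
  apply: (Ex_le w0) => b; case: eqP => [bv|_]; last by rewrite mul0r.
  rewrite mul1r (_ : reset v b = b) //; apply/ffunP => u; rewrite ffunE.
  by case: eqP => // ->.
have diff : pr_low a - pr_low1 a <=
    \sum_v Ex w (fun b => (low_pattern (reset v b))%:R) * d2.
  rewrite /pr_low /pr_low1 -ExB.
  apply: le_trans (_ : Ex w (fun b => \sum_v
       ((low_pattern (reset v b))%:R * (1 < #|b v|)%N%:R)) <= _).
    apply: (Ex_le w0) => b; case: (boolP (low_pattern b)) => lb /=; last first.
      by rewrite subrr; apply: sumr_ge0 => v _; rewrite mulr_ge0.
    case: (boolP (simple_pattern b)) => sb /=.
      by rewrite subrr; apply: sumr_ge0 => v _; rewrite mulr_ge0.
    move: sb; rewrite negb_forall => /existsP[v]; rewrite -ltnNge => bv.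
    rewrite subr0 (bigD1 v) //= bv low_reset // mulr1 lerDl.
    by apply: sumr_ge0 => u _; rewrite mulr_ge0.
  rewrite Ex_sum; apply: ler_sum => v _; rewrite (Ex_indep w1 (A := ~: [set v])).
  - by apply: ler_wpM2l (coord v); apply: (Ex_ge0 w1 w0) => b.
  - move=> f g fg; congr ((low_pattern _)%:R); apply/ffunP => u; rewrite !ffunE.
    by case: ifPn => // uv; apply: fg; rewrite !inE.
  - by move=> f g fg; rewrite fg // setCK inE.
apply: le_trans (ler_wpM2l (a0 set0) diff) _.
rewrite mulr_sumr -mulrA -[X in X%:R * _]cardsT mulr_natl -sumr_const big_mkcond /=.
rewrite [X in _ <= X]big_mkcond; apply: ler_sum => v _; rewrite in_setT.
by rewrite mulrA [d2 * _]mulrC; apply: ler_wpM2r.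
Qed.

(** Pointwise comparison of product weights: every entry costs at most [c0], and the at most
    [#|T| * k] nonempty ones cost a further [c1]. So [c0] must be [1] up to [o(1 / #|V|)], while
    [c1] need only tend to [1]. *)
Lemma pr_low1_le a a' c0 c1 : is_law a -> is_law a' -> 1 <= c0 -> 1 <= c1 ->
  a set0 <= c0 * a' set0 -> (forall i, i \in T -> a [set i] <= c1 * a' [set i]) ->
  pr_low1 a <= c0 ^+ #|V| * c1 ^+ (#|T| * k) * pr_low1 a'.
Proof.
move=> la la' c01 c11 h0 h1; rewrite -ExZl; apply: ler_sum => b _.
case: (boolP (low_pattern b)) => lb /=; last by rewrite !mulr0.
case: (boolP (simple_pattern b)) => sb /=; last by rewrite !mulr0.
rewrite !mulr1; have c00 : 0 <= c0 by apply: le_trans c01.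
have c10 : 0 <= c1 by apply: le_trans c11.
apply: le_trans (_ : \prod_v (c0 * (if b v == set0 then 1 else c1)) *
   \prod_v ext_weight T a' v (b v) <= _).
  rewrite -big_split /=; apply: ler_prod => v _; rewrite ext_weight_ge0 //=.
  rewrite /ext_weight; case: ifP => vT.
    by case: eqP => _ /=; rewrite ?mulr0 // !mulr1.
  case: eqP => [->|/eqP bv]; first by rewrite mulr1.
  have : #|b v| == 1%N.
    by move: bv (forallP sb v); rewrite -card_gt0 eqn_leq => -> ->.
  case/cards1P => i bi; rewrite bi; apply: le_trans (h1 i _) _.
    by case/andP: lb => /forallP/(_ v); rewrite bi sub1set.
  rewrite -mulrA ler_peMl // mulr_ge0 //; by case: la'.
rewrite [X in _ <= X]mulrC; apply: ler_wpM2r.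
  by apply: prodr_ge0 => v _; apply: ext_weight_ge0.
have -> : \prod_v (c0 * (if b v == set0 then 1 else c1)) = c0 ^+ #|V| * c1 ^+ #|touched b|.
  rewrite big_split /= prodr_const; congr (_ * _).
  by rewrite -prodr_const [RHS]big_mkcond; apply: eq_bigr => v _; rewrite inE; case: eqP.
apply: ler_wpM2l; first exact: exprn_ge0.
by rewrite ler_weXn2l // card_touched.
Qed.

Lemma low_touched a l : is_law a -> (#|T| * k <= l)%N ->
  pr_low a <= Ex (ext_weight T a) (fun b => (#|touched b| <= l)%N%:R).
Proof.
move=> la kl; apply: Ex_le => [v B|b]; first exact: ext_weight_ge0.
case: (boolP (low_pattern b)) => // /card_touched h.
by rewrite (leq_trans h kl).
Qed.

(** Sum over the exact set [A] of touched nodes: each node of [A] contributes [1 - a set0], and at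
    least [#|~: T| - l] others contribute [a set0]. *)
Lemma tail_sum a l : is_law a ->
  Ex (ext_weight T a) (fun b => (#|touched b| <= l)%N%:R) <=
  \sum_(A : {set V} | (#|A| <= l)%N) (1 - a set0) ^+ #|A| * a set0 ^+ (#|~: T| - l).
Proof.
move=> la; case: (la) => a0 a1; set phi := a set0.
have phi1 : phi <= 1 by apply: law_le1.
have phi0 : 0 <= phi by apply: a0.
have w0 := fun v B => @ext_weight_ge0 a v B la.
rewrite (eq_Ex _ (G := fun b => \sum_(A : {set V} | (#|A| <= l)%N)
    \prod_v (if v \in A then (b v != set0)%:R else 1 - (b v != set0)%:R))); last first.
  move=> b; rewrite (eq_bigr (fun A => (touched b == A)%:R)); last first.
    by move=> A _; rewrite eq_set_prod; apply: eq_bigr => v _; rewrite inE.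
  case: (leqP #|touched b| l) => h.
    rewrite (bigD1 (touched b)) //= eqxx big1 ?addr0 // => A /andP[_].
    by rewrite eq_sym => /negPf ->.
  by rewrite big1 // => A Al; case: eqP => // AE; move: h; rewrite AE ltnNge Al.
rewrite Ex_sum; apply: ler_sum => A Al.
rewrite (Ex_prod _ (fun v (B : {set V}) => if v \in A then (B != set0)%:R
   else 1 - (B != set0)%:R)).
case: (boolP (A \subset ~: T)) => [AT|/subsetPn[v vA]]; last first.
  rewrite inE negbK => vT; rewrite (bigD1 v) //= vA big1 ?mul0r.
    by rewrite mulr_ge0 ?exprn_ge0 ?subr_ge0.
  by move=> B _; rewrite /ext_weight vT; case: eqP; rewrite ?mulr0 ?mul0r.
have E v : \sum_B ext_weight T a v B * (if v \in A then (B != set0)%:R else 1 - (B != set0)%:R)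
   = if v \in A then 1 - phi else if v \in T then 1 else phi.
  case: ifPn => vA.
    have vT : v \notin T by have := subsetP AT v vA; rewrite inE.
    rewrite (eq_bigr (fun B => a B - (if B == set0 then phi else 0))).
      by rewrite sumrB a1 -big_mkcond /= big_pred1_eq.
    move=> B _; rewrite /ext_weight (negPf vT).
    by case: eqP => [->|_]; rewrite ?mulr0 ?mulr1 ?subrr ?subr0.
  rewrite (bigD1 set0) //= eqxx subr0 mulr1 big1 ?addr0.
    by rewrite /ext_weight eqxx.
  by move=> B ->; rewrite subrr mulr0.
rewrite (eq_bigr _ (fun v _ => E v)) (bigID (mem A)) /=.
rewrite (eq_bigr (fun=> 1 - phi)); last by move=> v ->.
rewrite prodr_const; apply: ler_wpM2l; first by rewrite exprn_ge0 ?subr_ge0.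
rewrite (eq_bigr (fun v => if v \in T then 1 else phi)); last by move=> v /negPf ->.
rewrite (bigID (mem T)) /= big1 ?mul1r; last by move=> v /andP[_ ->].
rewrite (eq_bigr (fun=> phi)); last by move=> v /andP[_ /negPf ->].
have -> : \prod_(v | (v \notin A) && (v \notin T)) phi = phi ^+ #|~: T :\: A|.
  by rewrite -prodr_const; apply: eq_bigl => v; rewrite !inE.
rewrite cardsD (setIidPr AT); apply: ler_wiXn2l => //.
by apply: leq_sub2l.
Qed.

(** All sets [A] are counted and their touched factors bounded by 1; enough when [a set0] is below a
    small constant. *)
Lemma tail_le_exp a l : is_law a ->
  Ex (ext_weight T a) (fun b => (#|touched b| <= l)%N%:R) <=
  2 ^+ #|V| * a set0 ^+ (#|~: T| - l).
Proof.
move=> la; apply: le_trans (tail_sum l la) _; case: (la) => a0 a1.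
apply: le_trans (_ : \sum_(A : {set V}) a set0 ^+ (#|~: T| - l) <= _).
  rewrite big_mkcond; apply: ler_sum => A _; case: ifP => _; last by rewrite exprn_ge0.
  rewrite ler_piMl ?exprn_ge0 // exprn_ile1 ?subr_ge0 ?law_le1 //.
  by rewrite gerBl.
rewrite (eq_bigl (mem (powerset [set: V]))) => [|A]; last by rewrite !inE subsetT.
by rewrite sumr_const card_powerset cardsT -[X in X <= _]mulr_natl natrX.
Qed.

(** There are at most [#|V| ^ d] sets of size [d], and each such power is matched by a factor
    [1 - a set0]: here [z] bounds the expected number of touched nodes. *)
Lemma tail_le_pow a l z : is_law a -> 1 <= z -> #|V|%:R * (1 - a set0) <= z ->
  Ex (ext_weight T a) (fun b => (#|touched b| <= l)%N%:R) <=
  l.+1%:R * z ^+ l * a set0 ^+ (#|~: T| - l).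
Proof.
move=> la z1 hz; apply: le_trans (tail_sum l la) _; case: (la) => a0 a1.
have psi0 : 0 <= 1 - a set0 by rewrite subr_ge0 law_le1.
rewrite -mulr_suml; apply: ler_wpM2r; first by rewrite exprn_ge0.
rewrite (partition_big (fun A : {set V} => inord #|A| : 'I_l.+1) predT) //=.
have -> : l.+1%:R * z ^+ l = \sum_(d < l.+1) z ^+ l by rewrite sumr_const card_ord mulr_natl.
apply: ler_sum => d _.
apply: le_trans (_ : \sum_(A : {set V} | #|A| == d) (1 - a set0) ^+ d <= _).
  rewrite big_mkcond [X in _ <= X]big_mkcond; apply: ler_sum => A _.
  case: ifPn => [/andP[Al /eqP <-]|_]; last by case: ifP => // _; rewrite exprn_ge0.
  by rewrite inordK // eqxx.
rewrite sumr_const.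
have -> : #|(fun A : {set V} => #|A| == d)| = 'C(#|V|, d).
  by rewrite -card_draws cardsE.
rewrite -mulr_natl; apply: le_trans (_ : (#|V|%:R * (1 - a set0)) ^+ d <= _).
  rewrite exprMn -natrX; apply: ler_wpM2r; first exact: exprn_ge0.
  rewrite ler_nat; apply: leq_trans (_ : #|V| ^_ d <= _)%N.
    by rewrite -bin_ffact leq_pmulr ?fact_gt0.
  elim: (val d) => [|m IH]; first by rewrite ffactn0 expn0.
  by rewrite ffactnSr expnSr leq_mul // leq_subr.
apply: le_trans (_ : z ^+ d <= _).
  by apply: lerXn2r; rewrite ?nnegrE ?mulr_ge0 //; apply: le_trans ler01 z1.
by rewrite ler_weXn2l // -ltnS.
Qed.

End PatternLaws.

(** * Patterns with independent Bernoulli incidences *)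

Section BernoulliPatterns.
Variables (R : realFieldType) (V : finType) (T : {set V}) (k : nat) (q : R).

(** The probability that a binomial variable with parameters [N] and [q] is less than [k]. *)
Definition bin_low (N : nat) : R := \sum_(d < k) 'C(N, d)%:R * q ^+ d * (1 - q) ^+ (N - d).

Lemma bern_card (U : {set V}) :
  \sum_(B : {set V} | (#|B| < k)%N) bern (fun j => if j \in U then q else 0) B = bin_low #|U|.
Proof.
rewrite /bin_low; case: k => [|k']; first by rewrite big_ord0 big1.
rewrite (partition_big (fun A : {set V} => inord #|A| : 'I_k'.+1) predT) //=.
apply: eq_bigr => d _; rewrite (bigID (fun B : {set V} => B \subset U)) /=.
rewrite [X in _ + X]big1 ?addr0; last first.
  move=> B /andP[_ /subsetPn[j jB jU]].
  by rewrite /bern (bigD1 j) //= jB (negPf jU) mul0r.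
rewrite -cards_draws -mulrA mulr_natl -sumr_const; apply: eq_big => B.
  rewrite !inE; case: (B \subset U); rewrite ?andbF ?andbT //=.
  case: (ltnP #|B| k'.+1) => Bk /=; first by rewrite -val_eqE /= inordK.
  by apply/esym/negP => /eqP Bd; move: Bk; rewrite Bd leqNgt ltn_ord.
case/andP=> /andP[Bk /eqP <-] BU; rewrite inordK // /bern (bigID (mem B)) /=.
congr (_ * _).
  by rewrite -prodr_const; apply: eq_bigr => j jB; rewrite jB (subsetP BU).
rewrite (bigID (mem U)) /= [X in _ * X]big1 ?mulr1; last first.
  by move=> j /andP[/negPf -> /negPf ->]; rewrite subr0.
have -> : (#|U| - #|B|)%N = #|U :\: B| by rewrite cardsD (setIidPr BU).
rewrite -prodr_const; apply: eq_big => j; rewrite ?inE //.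
by case/andP=> /negPf -> ->.
Qed.

Definition bern_T : {set V} -> R := bern (fun j => if j \in T then q else 0).

Lemma bern_T_law : 0 <= q <= 1 -> is_law bern_T.
Proof.
move=> q01; split=> [B|]; last exact: sum_bern.
by apply: bern_ge0 => j; case: ifP; rewrite ?lexx ?ler01.
Qed.

(** All incidences are independent here, so the matrix may be transposed ([tr]): the columns, one
    for each node of [T], are independent random subsets of [~: T], and their sizes are the
    degrees. *)
Lemma pr_low_bern : pr_low T k bern_T = bin_low #|~: T| ^+ #|T|.
Proof.
pose y (v j : V) : R := if (v \notin T) && (j \in T) then q else 0.
have wE v B : ext_weight T bern_T v B = bern (y v) B.
  rewrite /ext_weight /y; case: ifP => vT /=.
    rewrite eq_sym eq_set_prod; apply: eq_bigr => j _.
    by rewrite inE; case: (j \in B); rewrite ?subr0.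
  by apply: eq_bigr => j _.
pose tr (b : {ffun V -> {set V}}) := [ffun i => [set v | i \in b v]] : {ffun V -> {set V}}.
have trK : involutive tr.
  by move=> b; apply/ffunP => v; apply/setP => i; rewrite ffunE inE ffunE inE.
pose g i (B : {set V}) : R := if i \in T then (#|B| < k)%N%:R else (B == set0)%:R.
rewrite /pr_low /Ex (reindex_inj (inv_inj trK)) /=.
transitivity (\sum_(b : {ffun V -> {set V}}) \prod_i (bern (y^~ i) (b i) * g i (b i))).
  apply: eq_bigr => b _; rewrite big_split /=; congr (_ * _).
    rewrite (eq_bigr _ (fun v _ => wE v _)) /bern exchange_big /=.
    by apply: eq_bigr => i _; apply: eq_bigr => v _; rewrite ffunE inE.
  rewrite /low_pattern; case: (boolP [forall v, _]) => bT /=; last first.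
    move: bT; rewrite negb_forall => /existsP[v /subsetPn[i]].
    rewrite ffunE inE => vi iT; rewrite (bigD1 i) //= /g (negPf iT).
    by case: eqP vi => [->|_]; rewrite ?inE ?mul0r.
  have b0 i : i \notin T -> b i = set0.
    move=> iT; apply/setP => v; rewrite inE; apply/negP => vi.
    by have := subsetP (forallP bT v) i; rewrite ffunE inE vi (negPf iT) => /(_ isT).
  have trE i : [set v | i \in tr b v] = b i.
    by apply/setP => v; rewrite inE ffunE inE.
  case: (boolP [forall i in T, _]) => bk.
    rewrite big1 // => i _; rewrite /g; case: ifPn => iT.
      by have := forall_inP bk i iT; rewrite trE => ->.
    by rewrite b0 ?eqxx.
  move: bk; rewrite negb_forall => /existsP[i]; rewrite negb_imply trE => /andP[iT /negPf h].
  by rewrite (bigD1 i) //= /g iT h mul0r.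
rewrite -(bigA_distr_bigA (fun i B => bern (y^~ i) B * g i B)) (bigID (mem T)) /=.
rewrite [X in _ * X]big1 ?mulr1; last first.
  move=> i iT; rewrite (bigD1 set0) //= big1 ?addr0 => [|B /negPf B0].
    rewrite /g (negPf iT) eqxx mulr1 bern0 big1 // => v _.
    by rewrite /y (negPf iT) andbF subr0.
  by rewrite /g (negPf iT) B0 mulr0.
rewrite -prodr_const; apply: eq_bigr => i iT; rewrite -bern_card [RHS]big_mkcond /=.
apply: eq_bigr => B _; rewrite /g iT; case: ifP; rewrite ?mulr0 ?mulr1 // => _.
by apply: eq_bigr => v _; rewrite /y iT andbT inE.
Qed.

End BernoulliPatterns.

Lemma intermediate_set (T : finType) (A C : {set T}) (m : nat) :
  A \subset C -> (#|A| <= m)%N -> (m <= #|C|)%N ->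
  exists B : {set T}, [/\ A \subset B, B \subset C & #|B| = m].
Proof.
move=> AC Am mC.
have : (m - #|A| <= #|C :\: A|)%N by rewrite cardsD (setIidPr AC) leq_sub2r.
rewrite -bin_gt0 -cards_draws card_gt0 => /set0Pn[D]; rewrite inE => /andP[DC /eqP Dm].
exists (A :|: D); split.
- exact: subsetUl.
- by rewrite subUset AC (subset_trans DC) ?subsetDl.
- rewrite cardsU Dm (_ : A :&: D = set0) ?cards0 ?subn0 ?subnKC //.
  apply/eqP; rewrite setIC setI_eq0 disjoints_subset; apply: subset_trans DC _.
  by apply/subsetP => x; rewrite !inE => /andP[].
Qed.

(** * Low degrees, connectivity and small cuts *)

Section Connectivity.
Variables (T : finType) (e : rel T) (k : nat).
Hypothesis esym : symmetric e.
Hypothesis eirr : irreflexive e.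
Hypothesis k_ge1 : (1 <= k)%N.

(** Fewer than [k] neighbours of [x] extend to a set of exactly [k - 1] nodes avoiding [x]. Deleting
    it isolates [x], and [k < #|T|] leaves another node to be cut off from. *)
Lemma k_connected_degree x : (k < #|T|)%N -> k_connected k e -> (k <= #|[set y | e x y]|)%N.
Proof.
move=> kT /forallP kc; rewrite leqNgt; apply/negP => dx.
have [|||A [NA Ax Ak]] := @intermediate_set _ [set y | e x y] [set~ x] k.-1.
- by apply/subsetP => y; rewrite !inE; apply: contraTneq => ->; rewrite eirr.
- lia.
- rewrite cardsC1; lia.
have /implyP/(_ _) := kc A; rewrite Ak eqxx => /(_ isT).
have xA : x \notin A by apply/negP => /(subsetP Ax); rewrite !inE eqxx.
have [y] : exists y, y \in ~: (x |: A).
  apply/set0Pn; rewrite -card_gt0 cardsCs setCK cardsU1 xA Ak; lia.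
rewrite !inE negb_or => /andP[yx yA] /forallP/(_ x)/forallP/(_ y).
rewrite xA yA /= => /connectP[[|z s] /= ] => [_ xy|/andP[/and3P[_ zA exz] _] _].
  by rewrite xy eqxx in yx.
by move: zA; rewrite (subsetP NA) // inE.
Qed.

Definition small_cut (X : {set T}) : bool :=
  [&& (1 < #|X|)%N, (2 * #|X| <= #|T|)%N, [forall v in X, exists u in X, e v u] &
      (#|[set v | (v \notin X) && [exists j in X, e v j]]| < k)%N].

(** Deleting [A] leaves two disjoint components, the smaller of which has at most half of the nodes.
    Its outer neighbours lie in [A], and since [#|A| < k] every node keeps a neighbour outside [A],
    hence in its own component. *)
Lemma not_k_connected_cut : (forall x, k <= #|[set y | e x y]|)%N ->
  ~~ k_connected k e -> exists X, small_cut X.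
Proof.
move=> deg; rewrite negb_forall => /existsP[A]; rewrite negb_imply => /andP[/eqP Ak].
rewrite negb_forall => /existsP[x]; rewrite negb_forall => /existsP[y].
rewrite !negb_imply => /and3P[xA yA]; set e' := [rel u v | _] => nxy.
have e'sym : connect_sym e'.
  by apply: sym_connect_sym => u v /=; rewrite esym andbCA.
pose C z := [set u | connect e' z u].
have CA z u : z \notin A -> u \in C z -> u \notin A.
  move=> zA; rewrite inE => /connectP[s]; case/lastP: s => [_ -> //|s w].
  by rewrite rcons_path last_rcons => /andP[_ /and3P[_ wA _]] ->.
have good z : z \notin A -> (2 * #|C z| <= #|T|)%N -> small_cut (C z).
  move=> zA half.
  have nb v : v \in C z -> exists2 u, u \in C z & e v u.
    move=> vC; have vA := CA z v zA vC.
    have : ~~ ([set u | e v u] \subset A).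
      by apply/negP => /subset_leq_card; rewrite Ak; have := deg v; lia.
    case/subsetPn => u; rewrite inE => vu uA; exists u => //.
    move: vC; rewrite !inE => zv; apply: connect_trans zv (connect1 _).
    by rewrite /= vA uA vu.
  have zC : z \in C z by rewrite inE connect0.
  apply/and4P; split => //.
  - have [u uC zu] := nb z zC; rewrite (cardD1 z) zC (cardD1 u) inE /= uC andbT.
    by rewrite (_ : u != z) //; apply: contraTneq zu => ->; rewrite eirr.
  - by apply/forall_inP => v /nb[u uC vu]; apply/exists_inP; exists u.
  - have : [set v | (v \notin C z) && [exists j in C z, e v j]] \subset A.
      apply/subsetP => v; rewrite inE => /andP[vC /exists_inP[j jC vj]].
      apply: contraR vC => vA; move: (jC); rewrite !inE => zj.
      apply: connect_trans zj (connect1 _).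
      by rewrite /= (CA z j) // vA esym vj.
    by move/subset_leq_card; rewrite Ak; lia.
have disj : [disjoint C x & C y].
  rewrite -setI_eq0; apply/eqP/setP => u; rewrite !inE; apply/negP => /andP[xu yu].
  by case/negP: nxy; apply: connect_trans xu _; rewrite e'sym.
have : (#|C x| + #|C y| <= #|T|)%N.
  rewrite -(_ : #|C x :|: C y| = #|C x| + #|C y|)%N ?max_card //.
  by rewrite cardsU (_ : C x :&: C y = set0) ?cards0 ?subn0 //; apply/eqP; rewrite setI_eq0.
case: (leqP #|C x| #|C y|) => h hs; [exists (C x)|exists (C y)]; apply: good => //; lia.
Qed.

End Connectivity.

(** * Bonferroni inequalities *)

Section Bonferroni.
Variable R : realFieldType.

(** Pascal's rule makes the sum telescope. The sign of what remains is the parity of [l], whence an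
    upper bound after even and a lower bound after odd [l]. *)
Lemma alt_binomial_sum (x l : nat) :
  \sum_(j < l.+1) (-1) ^+ j * 'C(x.+1, j)%:R = (-1) ^+ l * 'C(x, l)%:R :> R.
Proof.
elim: l => [|l IH]; first by rewrite big_ord_recl big_ord0 !bin0 addr0.
by rewrite big_ord_recr /= IH binS natrD exprS; ring.
Qed.

Lemma alt_binomial_sum0 (l : nat) :
  \sum_(j < l.+1) (-1) ^+ j * 'C(0, j)%:R = 1 :> R.
Proof.
rewrite big_ord_recl /= bin0 mulr1 expr0 big1 ?addr0 // => j _.
by rewrite bin0n mulr0.
Qed.

Lemma bonferroni_up (x l : nat) :
  (x == 0%N)%:R <= \sum_(j < (l.*2).+1) (-1) ^+ j * 'C(x, j)%:R :> R.
Proof.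
case: x => [|x]; first by rewrite alt_binomial_sum0.
by rewrite alt_binomial_sum -signr_odd odd_double expr0 mul1r.
Qed.

Lemma bonferroni_low (x l : nat) :
  \sum_(j < (l.*2).+2) (-1) ^+ j * 'C(x, j)%:R <= (x == 0%N)%:R :> R.
Proof.
case: x => [|x]; first by rewrite alt_binomial_sum0.
by rewrite alt_binomial_sum -signr_odd /= odd_double expr1 mulN1r oppr_le0.
Qed.

Lemma binomial_card_subsets (T : finType) (A : {set T}) (j : nat) :
  'C(#|A|, j)%:R = \sum_(X : {set T} | #|X| == j) (X \subset A)%:R :> R.
Proof.
rewrite -cards_draws -sum1_card natr_sum big_mkcond [RHS]big_mkcond /=.
by apply: eq_bigr => X _; rewrite inE andbC; case: eqP; case: (X \subset A).
Qed.

End Bonferroni.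

(** * Edges directed by a rank, and sets without isolated nodes *)

Section Forest.
Variables (R : realFieldType) (n K P : nat) (p : R).
Hypothesis KP : (K <= P)%N.
Hypothesis p01 : 0 <= p <= 1.
Local Notation keys := {ffun 'I_n -> key_set K P}.
Local Notation chans := {ffun node_pair n -> bool}.
Local Notation kw := (@kw R n K P).
Local Notation cw := (@cw R n p).
Local Notation q := (edge_prob K P p).

Lemma edge_prob_ge0 : 0 <= q.
Proof. by rewrite mulr_ge0 ?key_share_ge0 //; case/andP: p01. Qed.

Lemma edge_prob_le1 : q <= 1.
Proof.
by rewrite mulr_ile1 ?key_share_ge0 ?key_share_le1 //; case/andP: p01.
Qed.

(* Exposing the nodes of [W] in decreasing order, each one meets the key sets of
   the nodes below it independently of everything exposed later. *)
Lemma forest_keys (rho : 'I_n -> nat) (T W : {set 'I_n}) :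
  Ex kw (fun S => \prod_(v in W) \sum_(u in T | (rho u < rho v)%N)
    p * (share_key (S v) (S u))%:R) <= (#|T|%:R * q) ^+ #|W|.
Proof.
have kw1 := @kw1 R n K P KP; have kw0 := @kw0 R n K P.
have [p0 p1] := andP p01.
elim: {W}_.+1 {-2}W (ltnSn #|W|) => // m IH W; rewrite ltnS => Wm.
have [->|[w wW]] := set_0Vmem W.
  rewrite cards0 expr0 (eq_Ex _ (G := fun=> 1)) ?Ex_cst // => S.
  by rewrite big_set0.
case: (arg_maxnP rho wW) => v vW0 vmax; have vW : v \in W := vW0.
have vW' : #|W| = #|W :\ v|.+1 by rewrite (cardsD1 v) vW.
set F := fun (W : {set 'I_n}) (S : keys) => \prod_(v in W) \sum_(u in T | (rho u < rho v)%N)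
    p * (share_key (S v) (S u))%:R.
have F0 X S : 0 <= F X S.
  by apply: prodr_ge0 => ? _; apply: sumr_ge0 => ? _; rewrite mulr_ge0.
have := IH (W :\ v); rewrite -/(F _) vW' exprSr => IHW.
apply: le_trans (ler_wpM2r _ (IHW _)); last 2 first.
- by rewrite mulr_ge0 // edge_prob_ge0.
- by move: Wm; rewrite vW'.
rewrite -ExZr (Ex_mix kw1 (~: [set v])); apply: (Ex_le kw0) => S.
have FE S' : F W (mix (~: [set v]) S S') =
    F (W :\ v) S * \sum_(u in T | (rho u < rho v)%N) p * (share_key (S' v) (S u))%:R.
  rewrite /F (big_setD1 v) //= mulrC; congr (_ * _).
    apply: eq_bigr => u; rewrite !inE => /andP[uv uW]; apply: eq_bigr => t /andP[_ tu].
    rewrite !ffunE !inE uv ifT //; apply: contraTneq tu => ->.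
    by rewrite -leqNgt; apply: vmax.
  apply: eq_bigr => u /andP[_ uv]; rewrite !ffunE !inE eqxx /= ifT //.
  by apply: contraTneq uv => ->; rewrite ltnn.
rewrite (eq_Ex _ FE) ExZl; apply: ler_wpM2l; first exact: F0.
rewrite Ex_sum; apply: le_trans (_ : \sum_(u in T) q <= _); last first.
  by rewrite sumr_const mulr_natl.
rewrite big_mkcondr; apply: ler_sum => u _; case: ifP => _; last exact: edge_prob_ge0.
rewrite ExZl (Ex_coord kw1 v (fun s => (share_key s (S u))%:R)).
by rewrite /edge_prob -(key_ex_shareE R KP (S u)).
Qed.

(** Each channel is charged to its endpoint of larger rank, so given the keys the factors read
    disjoint channels and are independent. Existence of a neighbour is bounded by the number of
    neighbours, which reduces to [forest_keys]. *)
Lemma forest_bound (rho : 'I_n -> nat) (T W : {set 'I_n}) :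
  EE p (fun (S : keys) c => \prod_(v in W)
     ([exists u in T, (rho u < rho v)%N && adj S c v u])%:R) <= (#|T|%:R * q) ^+ #|W|.
Proof.
apply: le_trans (forest_keys rho T W); have cw1 := @cw1 R n p.
have cw0 := @cw0 R n p p01; apply: (Ex_le (@kw0 R n K P)) => S.
apply: le_trans (_ : Ex cw (fun c => \prod_(v <- enum W)
   \sum_(u in T | (rho u < rho v)%N) (adj S c v u)%:R) <= _).
  apply: (Ex_le cw0) => c; rewrite big_enum /=; apply: ler_prod => v vW.
  rewrite ler0n /=; case: existsP => [[u /and3P[uT uv vu]]|_].
    rewrite (bigD1 u) /= ?uT ?uv // vu lerDl; apply: sumr_ge0 => // t _.
  by apply: sumr_ge0.
pose D v := \bigcup_(u | (rho u < rho v)%N) chan_set v u.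
rewrite (@Ex_indep_prod _ _ _ _ cw1 _ _ D
   (fun v c => \sum_(u in T | (rho u < rho v)%N) (adj S c v u)%:R)) ?enum_uniq //; last 2 first.
- move=> v _ c c' cc'; apply: eq_bigr => u /andP[_ uv].
  rewrite /adj (_ : channel_on c v u = channel_on c' v u) //.
  by apply: channel_on_dep => e ev; apply: cc'; apply/bigcupP; exists u.
- move=> v w _ _ vw; rewrite -setI_eq0; apply/eqP/setP => e; rewrite !inE.
  apply/negP => /andP[/bigcupP[u uv]]; rewrite inE => /eqP eu.
  case/bigcupP=> t tw; rewrite inE eu => /eqP/setP vt.
  have := vt v; rewrite !inE eqxx (negPf vw) /= => /esym/eqP tv.
  have := vt w; rewrite !inE eqxx eq_sym (negPf vw) /= => /eqP wu.
  by move: uv tw; rewrite -wu -tv => h /(ltn_trans h); rewrite ltnn.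
rewrite big_enum /=; apply: ler_prod => v _; apply/andP; split.
  by apply: (Ex_ge0 cw1 cw0) => c; apply: sumr_ge0.
rewrite Ex_sum; apply: ler_sum => u /andP[_ uv].
have vu : v != u by apply: contraTneq uv => ->; rewrite ltnn.
by rewrite (Ex_adj p S (fun b => b%:R)) // mulr1 mulr0 addr0.
Qed.

Definition no_isolated (T : {set 'I_n}) (S : keys) (c : chans) : bool :=
  [forall v in T, exists u in T, adj S c v u].

(* Every node has a smaller or a larger neighbour in [T], so one of the two kinds makes up half of [T]. *)
Lemma no_isolated_bound (T : {set 'I_n}) (t c0 : R) :
  0 <= t -> t ^+ 2 = #|T|%:R * q -> 1 <= c0 -> t <= c0 ->
  EE p (fun (S : keys) c => (no_isolated T S c)%:R) <= 2 * (2 * c0 * t) ^+ #|T|.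
Proof.
move=> t0 tE c01 tc0.
pose f rho (S : keys) c (W : {set 'I_n}) : R := \prod_(v in W)
     ([exists u in T, ((rho u : nat) < rho v)%N && adj S c v u])%:R.
pose r1 (i : 'I_n) : nat := i; pose r2 (i : 'I_n) : nat := (n - i)%N.
have f0 rho S c W : 0 <= f rho S c W by apply: prodr_ge0.
apply: le_trans (_ : EE p (fun (S : keys) c => \sum_(W in powerset T | (#|T| <= 2 * #|W|)%N)
    (f r1 S c W + f r2 S c W)) <= _).
  apply: (EE_le p01) => S c; case: (boolP (no_isolated T S c)) => h; last first.
    by apply: sumr_ge0 => W _; rewrite addr_ge0.
  pose W rho := [set v in T | [exists u in T, ((rho u : nat) < rho v)%N && adj S c v u]].
  have WT rho : W rho \subset T by apply/subsetP => v; rewrite inE => /andP[].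
  have fW rho : f rho S c (W rho) = 1.
    by rewrite /f big1 // => v; rewrite inE => /andP[_ ->].
  have : T \subset W r1 :|: W r2.
    apply/subsetP => v vT; have /forall_inP/(_ v vT)/exists_inP[u uT vu] := h.
    rewrite !inE vT /=; case: (ltngtP u v) => uv.
    - by apply/orP; left; apply/exists_inP; exists u; rewrite ?uv.
    - apply/orP; right; apply/exists_inP; exists u; rewrite ?vu ?andbT // /r2.
      by have := ltn_ord u; lia.
    - by move: vu; rewrite (val_inj uv) adj_irr.
  move/subset_leq_card/leq_trans/(_ (leq_card_setU _ _).1) => TW.
  have [h1|h2] := leqP #|T| (2 * #|W r1|)%N.
    rewrite (bigD1 (W r1)) ?inE ?WT ?h1 //= fW -addrA lerDl addr_ge0 //.
    by apply: sumr_ge0 => X _; rewrite addr_ge0.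
  have h3 : (#|T| <= 2 * #|W r2|)%N.
    by move: TW h2; set a1 := #|W r1|; set a2 := #|W r2|; lia.
  rewrite (bigD1 (W r2)) /=; last by rewrite inE WT.
  rewrite fW addrAC lerDr addr_ge0 //.
  by apply: sumr_ge0 => X _; rewrite addr_ge0.
(* The factor [2 ^ #|T|] counts the choices of [W], the other 2 the two orders. *)
rewrite EE_sum; apply: le_trans (_ : \sum_(W in powerset T) 2 * (c0 * t) ^+ #|T| <= _); last first.
  rewrite sumr_const card_powerset -[X in X <= _]mulr_natl natrX.
  by rewrite -[2 * c0 * t]mulrA [(2 * (c0 * t)) ^+ _]exprMn mulrCA.
have q0 := edge_prob_ge0.
have ct0 : 0 <= (c0 * t) ^+ #|T|.
  by rewrite exprn_ge0 // mulr_ge0 //; apply: le_trans c01.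
rewrite big_mkcondr; apply: ler_sum => W; rewrite inE => WT.
case: ifPn => [hW|_]; last by rewrite mulr_ge0.
rewrite EED mulr2n mulrDl mul1r; apply: lerD.
all: apply: le_trans (forest_bound _ T W) _; rewrite -tE -exprM.
all: have WT' := subset_leq_card WT.
(* [t] may exceed 1, so the surplus [t ^ (2 #|W| - #|T|)] is bounded by powers of [c0]. *)
all: rewrite -(subnKC hW) exprD mulrC exprMn; apply: ler_wpM2r; first exact: exprn_ge0.
all: apply: le_trans (_ : c0 ^+ (2 * #|W| - #|T|) <= _).
all: try by apply: lerXn2r; rewrite ?nnegrE //; apply: le_trans c01.
all: by rewrite ler_weXn2l //; lia.
Qed.

(** * The chance of missing a set, through its pool of keys *)

Section Expansion.
Variable S : keys.

Definition pool (X : {set 'I_n}) : {set 'I_P} := \bigcup_(i in X) val (S i).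

(** Exposing channels first: [J] is the set of nodes of [T] with an open channel to the outside
    node, which misses [T] exactly when its keys avoid the pool of [J]. *)
Lemma pat_law0_expand (T : {set 'I_n}) :
  pat_law p T S set0 = \sum_(J : {set 'I_n}) bern (fun j => if j \in T then p else 0) J *
    key_ex (fun s : key_set K P => (val s :&: pool J == set0)%:R).
Proof.
rewrite pat_law0.
rewrite (eq_bigr (fun J : {set 'I_n} => key_ex (fun s : key_set K P =>
   \prod_j (if j \in J then (if j \in T then p * (1 - (share_key s (S j))%:R) else 0)
      else (if j \in T then 1 - p else 1))))); last first.
  move=> J _; rewrite -key_exZl; apply: eq_key_ex => s.
  have -> : (val s :&: pool J == set0)%:R =
      \prod_j (if j \in J then 1 - (share_key s (S j))%:R else 1) :> R.
    case: (boolP (val s :&: pool J == set0)) => [/eqP h|/set0Pn[x]].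
      rewrite big1 // => j _; case: ifP => // jJ; rewrite /share_key.
      rewrite (_ : val s :&: val (S j) = set0) ?eqxx ?subr0 //.
      apply/setP => x; rewrite !inE; apply/negP => /andP[xs xj].
      have : x \in val s :&: pool J.
        by rewrite inE xs /=; apply/bigcupP; exists j.
      by rewrite h inE.
    rewrite inE => /andP[xs /bigcupP[j jJ xj]].
    rewrite (bigD1 j) //= jJ (_ : share_key s (S j)) ?subrr ?mul0r //.
    by apply/set0Pn; exists x; rewrite inE xs.
  rewrite /bern -big_split /=; apply: eq_bigr => j _.
  by case: (j \in J); case: (j \in T); rewrite ?mul0r ?mulr1 ?subr0.
rewrite -key_ex_sum; apply: eq_key_ex => s.
rewrite -bigA_distr [LHS]big_mkcond; apply: eq_bigr => j _ /=.
case: (j \in T) => /=; last by rewrite [RHS]add0r.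
rewrite -[RHS]/(p * (1 - (share_key s (S j))%:R) + (1 - p)); ring.
Qed.

(** A second factorial moment: it counts ordered pairs of distinct elements of [J], each pair inside
    [T] being present with probability [p ^ 2]. *)
Lemma sum_bern_pairs (T : {set 'I_n}) :
  \sum_(J : {set 'I_n}) bern (fun j => if j \in T then p else 0) J * (#|J| * #|J|.-1)%N%:R
  <= (#|T|%:R * p) ^+ 2.
Proof.
have [p0 p1] := andP p01.
pose x j : R := if j \in T then p else 0; rewrite -/x.
have pairs (J : {set 'I_n}) : (#|J| * #|J|.-1)%N%:R =
    \sum_(i : 'I_n) \sum_(j | j != i) ([set i; j] \subset J)%:R :> R.
  rewrite (eq_bigr (fun i => if i \in J then #|J|.-1%:R else 0 : R)).
    by rewrite -big_mkcond /= sumr_const -[RHS]mulr_natl natrM.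
  move=> i _; case: ifPn => iJ; last first.
    by rewrite big1 // => j _; rewrite subUset sub1set (negPf iJ).
  have -> : #|J|.-1 = #|J :\ i| by rewrite (cardsD1 i) iJ.
  rewrite -sum1_card natr_sum [RHS]big_mkcond [LHS]big_mkcond /=; apply: eq_bigr => j _.
  by rewrite !inE subUset !sub1set iJ /=; case: (j != i); case: (j \in J).
rewrite (eq_bigr (fun J : {set 'I_n} => \sum_(i : 'I_n) \sum_(j | j != i)
   bern x J * ([set i; j] \subset J)%:R)); last first.
  by move=> J _; rewrite pairs mulr_sumr; apply: eq_bigr => i _; rewrite mulr_sumr.
rewrite exchange_big /=.
have -> : (#|T|%:R * p) ^+ 2 = \sum_i \sum_j x i * x j.
  under eq_bigr do rewrite -mulr_sumr.
  by rewrite -mulr_suml /x -big_mkcond /= sumr_const expr2 mulr_natl.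
apply: ler_sum => i _; rewrite exchange_big /= big_mkcond; apply: ler_sum => j _.
have x0 l : 0 <= x l by rewrite /x; case: ifP.
case: ifPn => ij; last by rewrite mulr_ge0.
rewrite (eq_bigr (fun J : {set 'I_n} => if [set i; j] \subset J then bern x J else 0)); last first.
  by move=> J _; case: ifP; rewrite ?mulr1 ?mulr0.
rewrite -big_mkcond /= sum_bern_supset (big_setU1 _ _) ?inE 1?eq_sym //= big_set1.
by [].
Qed.

(** Up to [M] open channels the hypothesis applies and the sum over [J] is a generating function.
    Beyond, [#|J| (#|J| - 1) >= M ^ 2], so the second factorial moment controls the rest. *)
Lemma pat_law0_le (T : {set 'I_n}) (M : nat) (g : R) : (0 < M)%N -> 0 <= g ->
  (forall J : {set 'I_n}, J \subset T -> (#|J| <= M)%N ->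
     key_ex (fun s : key_set K P => (val s :&: pool J == set0)%:R) <= g ^+ #|J|) ->
  pat_law p T S set0 <= (1 - p * (1 - g)) ^+ #|T| + (#|T|%:R * p / M%:R) ^+ 2.
Proof.
move=> M0 g0 hg; have [p0 p1] := andP p01; set x := fun j => if j \in T then p else 0.
have M0' : 0 < M%:R :> R by rewrite ltr0n.
have x01 j : 0 <= x j <= 1 by rewrite /x; case: ifP; rewrite ?p0 ?lexx ?ler01.
rewrite pat_law0_expand.
apply: le_trans (_ : \sum_(J : {set 'I_n}) bern x J *
   (g ^+ #|J| + (#|J| * #|J|.-1)%N%:R / M%:R ^+ 2) <= _).
  apply: ler_sum => J _; case: (boolP (J \subset T)) => [JT|/subsetPn[j jJ jT]]; last first.
    by rewrite /bern (bigD1 j) //= jJ (negPf jT) !mul0r.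
  apply: ler_wpM2l; first exact: bern_ge0.
  have [JM|JM] := leqP #|J| M.
    by apply: le_trans (hg J JT JM) _; rewrite lerDl divr_ge0 // exprn_ge0 // ltW.
  apply: le_trans (_ : 1 <= _).
    rewrite -[X in _ <= X](key_ex1 R KP); apply: key_ex_le => s.
    by rewrite lern1 leq_b1.
  apply: ler_wpDl; first exact: exprn_ge0.
  rewrite ler_pdivlMr ?exprn_gt0 // mul1r -natrX ler_nat expnS expn1.
  by apply: leq_mul; lia.
under eq_bigr do rewrite mulrDr mulrA.
rewrite big_split /=; apply: lerD.
  rewrite (eq_bigr (fun J : {set 'I_n} => \prod_j (if j \in J then x j * g else 1 - x j))).
    rewrite -bigA_distr -prodr_const [X in _ <= X]big_mkcond le_eqVlt; apply/orP; left.
    apply/eqP; apply: eq_bigr => j _; rewrite /x.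
    case: (j \in T) => /=; last by rewrite -[LHS]/(0 * g + (1 - 0)) mul0r add0r subr0.
    rewrite -[LHS]/(p * g + (1 - p)); ring.
  move=> J _; rewrite /bern -prodr_const [X in _ * X]big_mkcond -big_split /=.
  by apply: eq_bigr => j _; case: ifP; rewrite ?mulr1.
rewrite -mulr_suml expr_div_n; apply: ler_wpM2r; first by rewrite invr_ge0 exprn_ge0 // ltW.
exact: sum_bern_pairs.
Qed.

Lemma pat_law0_mono (T T' : {set 'I_n}) : T' \subset T ->
  pat_law p T S set0 <= pat_law p T' S set0.
Proof.
move=> TT; rewrite !pat_law0; apply: key_ex_le => s.
rewrite big_mkcond [X in _ <= X]big_mkcond; apply: ler_prod => j _.
have [p0 p1] := andP p01.
have h : 0 <= 1 - p * (share_key s (S j))%:R <= 1.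
  by case: share_key; rewrite ?mulr1 ?mulr0 ?subr_ge0 ?p1 ?gerBl ?p0 ?subr0 ?ler01 ?lexx.
case: (boolP (j \in T')) => [/(subsetP TT) ->|_]; first by case/andP: h => -> /=.
by case: ifP => _; rewrite ?h ?ler01 ?lexx.
Qed.

End Expansion.

(** A pool of at most [x] keys lies in some set of exactly [x] keys; union bound over these sets,
    the key sets of [X] being independent. *)
Lemma pool_small_prob (X : {set 'I_n}) (x : nat) : (0 < P)%N -> (x <= P)%N ->
  Ex kw (fun S => (#|pool S X| <= x)%N%:R) <=
  'C(P, x)%:R * ((x%:R / P%:R) ^+ K) ^+ #|X|.
Proof.
move=> P0 xP; have kw0 := @kw0 R n K P.
apply: le_trans (_ : Ex kw (fun S => \sum_(Y : {set 'I_P} | #|Y| == x)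
   \prod_i (if i \in X then (val (S i) \subset Y)%:R else 1)) <= _).
  apply: (Ex_le kw0) => S; case: (leqP #|pool S X| x) => h; last first.
    by apply: sumr_ge0 => Y _; apply: prodr_ge0 => i _; case: ifP.
  have [|Y [SY _ Yx]] := @intermediate_set _ (pool S X) [set: 'I_P] x (subsetT _) h.
    by rewrite cardsT card_ord.
  rewrite (bigD1 Y) ?Yx //= big1 ?lerDl.
    by apply: sumr_ge0 => Z _; apply: prodr_ge0 => i _; case: ifP.
  move=> i _; case: ifP => // iX; rewrite (subset_trans _ SY) //.
  exact: (bigcup_sup i).
rewrite Ex_sum -[P in 'C(P, _)]card_ord -card_draws mulr_natl -sumr_const.
rewrite [X in _ <= X](eq_bigl (fun Y : {set 'I_P} => #|Y| == x)) => [|Y]; last by rewrite inE.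
apply: ler_sum => Y /eqP Yx.
rewrite (Ex_prod _ (fun i (s : key_set K P) => if i \in X then (val s \subset Y)%:R else 1)).
rewrite -prodr_const [X in _ <= X]big_mkcond; apply: ler_prod => i _.
apply/andP; split; first by apply: sumr_ge0 => s _; rewrite mulr_ge0 ?kw0 //; case: ifP.
case: ifP => _; first by rewrite -Yx; apply: key_ex_sub_le.
by under eq_bigr do rewrite mulr1; rewrite kw1.
Qed.

End Forest.

(** * Comparing an attachment law with the Bernoulli law *)

Section LawComparison.
Variables (R : realFieldType) (V : finType) (T : {set V}) (k : nat) (q : R).
Hypothesis q01 : 0 <= q <= 1.
Implicit Types a : {set V} -> R.

(** The second factorial moment of [#|B :&: T|]. With fixed marginals it controls both the mass on
    larger sets and the values at [set0] and at singletons. *)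
Definition overlap (a : {set V} -> R) : R :=
  \sum_(i in T) \sum_(j in T | j != i) \sum_(B : {set V} | (i \in B) && (j \in B)) a B.

Definition has_marginals (a : {set V} -> R) : Prop :=
  [/\ is_law a, forall B : {set V}, ~~ (B \subset T) -> a B = 0 &
      forall i, i \in T -> \sum_(B : {set V} | i \in B) a B = q].

Section OneLaw.
Variable a : {set V} -> R.
Hypothesis ha : has_marginals a.

Let a0 B : 0 <= a B. Proof. by case: ha => [[]]. Qed.
Let a1 : \sum_B a B = 1. Proof. by case: ha => [[]]. Qed.

Lemma overlapE :
  overlap a = \sum_B a B * (#|B :&: T| * #|B :&: T|.-1)%N%:R.
Proof.
rewrite /overlap.
rewrite (eq_bigr (fun i => \sum_B a B * (\sum_(j in T | j != i) ((i \in B) && (j \in B))%:R))).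
  rewrite exchange_big /=; apply: eq_bigr => B _; rewrite -mulr_sumr; congr (_ * _).
  rewrite (eq_bigr (fun i => if i \in B then #|B :&: T|.-1%:R else 0 : R)).
    rewrite -big_mkcondr /= (eq_bigl (fun i => i \in B :&: T)) => [|i]; last by rewrite inE andbC.
    by rewrite sumr_const natrM mulr_natl.
  move=> i iT; case: ifPn => iB; last by rewrite big1.
  have -> : #|B :&: T|.-1 = #|(B :&: T) :\ i| by rewrite (cardsD1 i (B :&: T)) inE iB iT.
  rewrite -sum1_card natr_sum [RHS]big_mkcond [LHS]big_mkcond /=.
  by apply: eq_bigr => j _; rewrite !inE; case: (j \in T); case: (j != i); case: (j \in B).
move=> i _; under [RHS]eq_bigr do rewrite mulr_sumr.
rewrite [RHS]exchange_big /=; apply: eq_bigr => j _; rewrite big_mkcond /=.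
by apply: eq_bigr => B _; case: ifP; rewrite ?mulr1 ?mulr0.
Qed.

Lemma marginal_sum : \sum_B a B * #|B :&: T|%:R = #|T|%:R * q.
Proof.
case: ha => _ _ hm.
rewrite (eq_bigr (fun B : {set V} => \sum_(i in T) a B * (i \in B)%:R)).
  rewrite exchange_big /= mulr_natl -sumr_const; apply: eq_bigr => i iT.
  by rewrite -(hm i iT) [RHS]big_mkcond; apply: eq_bigr => B _; case: ifP; rewrite ?mulr1 ?mulr0.
move=> B _; rewrite -mulr_sumr; congr (_ * _).
rewrite -sum1_card natr_sum [LHS]big_mkcond [RHS]big_mkcond /=.
by apply: eq_bigr => i _; rewrite inE; case: (i \in B); case: (i \in T).
Qed.

Let aT B : a B != 0 -> B :&: T = B.
Proof. by case: ha => _ h _ aB; apply/setIidPl; apply: contraNT aB => /h ->. Qed.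

Lemma multi_le : \sum_(B : {set V} | (1 < #|B|)%N) a B <= overlap a.
Proof.
rewrite overlapE big_mkcond; apply: ler_sum => B _.
case: ifPn => B1; last by rewrite mulr_ge0.
have [->|aB] := eqVneq (a B) 0; first by rewrite mul0r.
by rewrite (aT aB) ler_peMr // (ler_nat R 1); case: #|B| B1 => [|[|m]] // _; rewrite mulnS.
Qed.

Lemma none_ge : 1 - #|T|%:R * q <= a set0.
Proof.
rewrite lerBlDr -marginal_sum -[X in X <= _]a1 (bigD1 set0) //=.
rewrite [X in _ <= _ + X](bigD1 set0) //= set0I cards0 mulr0 add0r lerD2l.
apply: ler_sum => B B0.
have [->|aB] := eqVneq (a B) 0; first by rewrite mul0r.
by rewrite (aT aB) ler_peMr // (ler_nat R 1) card_gt0.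
Qed.

(** For [#|B :&: T| = j >= 1] the integrand [1 - j + j (j - 1)] is the square of [j - 1]. *)
Lemma none_le : a set0 <= 1 - #|T|%:R * q + overlap a.
Proof.
rewrite -marginal_sum -[X in _ <= X - _ + _]a1 overlapE (bigD1 set0) //=.
rewrite [X in _ - X](bigD1 set0) //= [X in _ + X](bigD1 set0) //= set0I cards0 !mulr0 !add0r.
rewrite -!addrA lerDl addrA -sumrB -big_split /=; apply: sumr_ge0 => B B0.
rewrite -{1}[a B]mulr1 -mulrBr -mulrDr mulr_ge0 //.
case: #|B :&: T| => [|m]; first by rewrite mul0n subr0 addr0.
by rewrite /= natrM -natr1; have : 0 <= m%:R :> R by []; nra.
Qed.

Lemma one_le i : i \in T -> a [set i] <= q.
Proof.
case: ha => _ _ hm /hm <-; rewrite (bigD1 [set i]) ?inE //= lerDl.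
exact: sumr_ge0.
Qed.

Lemma one_ge i : i \in T -> q - overlap a <= a [set i].
Proof.
case: ha => _ _ hm /hm <-; rewrite (bigD1 [set i]) ?inE //= -addrA gerDl subr_le0.
apply: le_trans multi_le; rewrite big_mkcond [X in _ <= X]big_mkcond.
apply: ler_sum => B _; case: ifPn => [/andP[iB Bi]|_]; last by case: ifP.
rewrite ifT // ltnNge; apply: contraNN Bi => B1.
by rewrite eq_sym eqEcard sub1set iB cards1.
Qed.

End OneLaw.

Local Notation nu := (bern_T T q).
Local Notation m := #|T|.

Lemma nu_marginals : has_marginals nu.
Proof.
split; first exact: bern_T_law.
  move=> B /subsetPn[j jB jT].
  by rewrite /bern_T /bern (bigD1 j) //= jB (negPf jT) mul0r.
move=> i iT; rewrite -(eq_bigl _ _ (fun B : {set V} => sub1set B i)) sum_bern_supset.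
by rewrite big_set1 iT.
Qed.

Lemma nu_overlap : overlap nu <= m%:R ^+ 2 * q ^+ 2.
Proof.
have [q0 q1] := andP q01.
apply: le_trans (_ : \sum_(i in T) \sum_(j in T) q ^+ 2 <= _); last first.
  by rewrite !sumr_const -mulrnA -[X in X <= _]mulr_natl natrM expr2.
apply: ler_sum => i iT; rewrite big_mkcondr; apply: ler_sum => j jT.
case: ifPn => ji; last exact: sqr_ge0.
rewrite (eq_bigl (fun B : {set V} => [set i; j] \subset B)); last first.
  by move=> B; rewrite subUset !sub1set.
by rewrite sum_bern_supset (big_setU1 _ _) ?inE 1?eq_sym //= big_set1 iT jT.
Qed.

Lemma nu0E : nu set0 = (1 - q) ^+ m.
Proof.
rewrite /bern_T bern0 -prodr_const [RHS]big_mkcond; apply: eq_bigr => j _.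
by case: ifP; rewrite ?subr0.
Qed.

Lemma nu_one i : i \in T -> nu [set i] = q * (1 - q) ^+ m.-1.
Proof.
move=> iT; rewrite /bern_T /bern (bigD1 i) //= inE eqxx iT; congr (_ * _).
have -> : m.-1 = #|T :\ i| by rewrite (cardsD1 i) iT.
rewrite -prodr_const big_mkcond [RHS]big_mkcond; apply: eq_bigr => j _.
by rewrite !inE; case: eqP; case: (j \in T); rewrite ?subr0.
Qed.

Hypothesis mq : 2 * (m%:R * q) <= 1.

Let q0 : 0 <= q. Proof. by case/andP: q01. Qed.
Let q1 : q <= 1. Proof. by case/andP: q01. Qed.

Lemma pr_low_ge0 a : is_law a -> 0 <= pr_low T k a.
Proof.
move=> la; apply: Ex_ge0 => [i|i B|b //]; first exact: ext_weight1.
exact: ext_weight_ge0.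
Qed.

Lemma pr_low1_le_low a : is_law a -> pr_low1 T k a <= pr_low T k a.
Proof.
move=> la; apply: Ex_le => [v B|b]; first exact: ext_weight_ge0.
by case: (low_pattern _ _ b) => //=; case: simple_pattern.
Qed.

(** [pr_low_split] with [a set0 >= 1/2] restricts to simple patterns at the price [1 - 2 eta]; then
    [pr_low1_le] compares [a] with the Bernoulli law. The constants come from [none_le], and from
    [q (1 - q) ^ (m - 1) >= q (1 - m q)] at singletons. *)
Lemma pr_low_upper a eta : (0 < #|V|)%N -> has_marginals a -> #|V|%:R * overlap a <= eta ->
  (1 - 2 * eta) * pr_low T k a <=
  (1 + 2 * eta / #|V|%:R) ^+ #|V| * (1 - m%:R * q)^-1 ^+ (m * k) * bin_low k q #|~: T| ^+ m.
Proof.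
move=> V0 ha hD; have [la _ _] := ha; have [ln _ _] := nu_marginals.
have V0' : 0 < #|V|%:R :> R by rewrite ltr0n.
have D0 : 0 <= overlap a by apply: le_trans (multi_le ha); apply: sumr_ge0 => B _; case: la.
have D2 : overlap a <= eta / #|V|%:R by rewrite ler_pdivlMr // mulrC.
have [x xE] : {x | x = m%:R * q} by exists (m%:R * q).
have x0 : 0 <= x by rewrite xE mulr_ge0.
have x2 : 2 * x <= 1 by rewrite xE.
have age := none_ge ha; have ale := none_le ha.
have bern_ineq : 1 - m%:R * q <= (1 - q) ^+ m by rewrite -nu0E; apply: none_ge nu_marginals.
rewrite -xE in age ale bern_ineq *.
have phi2 : 1 <= 2 * a set0 by lra.
have [e eE] : {e | e = eta / #|V|%:R} by exists (eta / #|V|%:R).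
rewrite -[2 * eta / #|V|%:R]mulrA -eE in D2 *.
have Q0 := pr_low_ge0 la.
have step : (1 - 2 * eta) * pr_low T k a <= pr_low1 T k a.
  have := pr_low_split T k la.
  have : #|V|%:R * (\sum_(B : {set V} | (1 < #|B|)%N) a B) * pr_low T k a <= eta * pr_low T k a.
    apply: ler_wpM2r => //; apply: le_trans hD; apply: ler_wpM2l; first exact: ltW.
    exact: multi_le.
  have := pr_low1_le_low la.
  set Q := pr_low T k a; set Q1 := pr_low1 T k a => h1 h2 h3; nra.
apply: le_trans step _; rewrite -pr_low_bern.
apply: le_trans (_ : (1 + 2 * e) ^+ #|V| * (1 - x)^-1 ^+ (m * k) * pr_low1 T k nu <= _); last first.
  apply: ler_wpM2l; last exact: pr_low1_le_low.
  by apply: mulr_ge0; apply: exprn_ge0; rewrite ?invr_ge0; lra.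
apply: pr_low1_le => //.
- by lra.
- by rewrite invf_ge1; lra.
- apply: le_trans ale _; rewrite nu0E.
  apply: le_trans (_ : (1 + 2 * e) * (1 - x) <= _); last first.
    by apply: ler_wpM2l => //; lra.
  by move: D2 D0; set D := overlap a => D2 D0; nra.
- move=> i iT; apply: le_trans (one_le ha iT) _; rewrite nu_one // mulrCA ler_peMr //.
  rewrite mulrC ler_pdivlMr; last by lra.
  rewrite mul1r; apply: le_trans bern_ineq _.
  by apply: ler_wiXn2l; rewrite ?subr_ge0 ?gerBl // leq_pred.
Qed.

(** The same comparison with the roles exchanged. The singletons now need [a [set i] >= (1 - zeta)
    q], which is why the overlap has to be small relative to [q]. *)
Lemma pr_low_lower a zeta : has_marginals a -> overlap a <= zeta * q -> 0 <= zeta -> zeta < 1 ->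
  (1 - 2 * #|V|%:R * m%:R ^+ 2 * q ^+ 2) * bin_low k q #|~: T| ^+ m <=
  (1 + 2 * m%:R ^+ 2 * q ^+ 2) ^+ #|V| * (1 - zeta)^-1 ^+ (m * k) * pr_low T k a.
Proof.
move=> ha hD z0 z1; have [la _ _] := ha; have [ln _ _] := nu_marginals.
have nD := nu_overlap; have nge := none_ge nu_marginals; have nle := none_le nu_marginals.
have age := none_ge ha.
have [x xE] : {x | x = m%:R * q} by exists (m%:R * q).
have x0 : 0 <= x by rewrite xE mulr_ge0.
have x2 : 2 * x <= 1 by rewrite xE.
have xx : m%:R ^+ 2 * q ^+ 2 = x ^+ 2 by rewrite xE exprMn.
have g1 : 2 * #|V|%:R * m%:R ^+ 2 * q ^+ 2 = 2 * (#|V|%:R * x ^+ 2) by rewrite -xx; ring.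
have g2 : 2 * m%:R ^+ 2 * q ^+ 2 = 2 * x ^+ 2 by rewrite -xx mulrA.
rewrite g1 g2; rewrite xx in nD; rewrite -xE in nge nle age.
have nphi2 : 1 <= 2 * nu set0 by lra.
have Q0 := pr_low_ge0 ln.
have step : (1 - 2 * (#|V|%:R * x ^+ 2)) * pr_low T k nu <= pr_low1 T k nu.
  have := pr_low_split T k ln.
  have : #|V|%:R * (\sum_(B : {set V} | (1 < #|B|)%N) nu B) * pr_low T k nu <=
      #|V|%:R * x ^+ 2 * pr_low T k nu.
    apply: ler_wpM2r => //; apply: ler_wpM2l => //; apply: le_trans nD.
    exact: multi_le nu_marginals.
  have := pr_low1_le_low ln.
  set Q := pr_low T k nu; set Q1 := pr_low1 T k nu; set e := #|V|%:R * _ => h1 h2 h3; nra.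
rewrite -pr_low_bern; apply: le_trans step _.
have xx0 : 0 <= x ^+ 2 by apply: sqr_ge0.
apply: le_trans (_ : (1 + 2 * x ^+ 2) ^+ #|V| * (1 - zeta)^-1 ^+ (m * k) *
   pr_low1 T k a <= _); last first.
  apply: ler_wpM2l; last exact: pr_low1_le_low.
  by apply: mulr_ge0; apply: exprn_ge0; rewrite ?invr_ge0; lra.
apply: pr_low1_le => //.
- by lra.
- by rewrite invf_ge1; lra.
- apply: le_trans nle _; apply: le_trans (_ : (1 + 2 * x ^+ 2) * (1 - x) <= _).
    by move: nD xx0; set D := overlap nu; set e := x ^+ 2 => nD xx0; nra.
  by apply: ler_wpM2l => //; lra.
- move=> i iT; apply: le_trans (one_le nu_marginals iT) _.
  rewrite mulrC ler_pdivlMr; last by lra.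
  rewrite mulrBr mulr1 [q * zeta]mulrC.
  by have := one_ge ha iT; move: hD; move: (zeta * q) => zq hD; lra.
Qed.

End LawComparison.

(** * Low-degree sets and cuts at a fixed size *)

Section Events.
Variables (R : realFieldType) (n K P : nat) (p : R) (k : nat).
Hypothesis KP : (K <= P)%N.
Hypothesis p01 : 0 <= p <= 1.
Local Notation keys := {ffun 'I_n -> key_set K P}.
Local Notation chans := {ffun node_pair n -> bool}.
Local Notation kw := (@kw R n K P).
Local Notation cw := (@cw R n p).
Local Notation q := (edge_prob K P p).
Implicit Types (T : {set 'I_n}) (S : keys) (c : chans).

Definition low_set (S : keys) (c : chans) : {set 'I_n} :=
  [set i | (#|[set j | adj S c i j]| < k)%N].

Lemma pat_marginals T S : has_marginals T q (pat_law p T S).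
Proof.
split; first by split; [move=> B; apply: pat_law_ge0 | apply: pat_law1].
  by move=> B; apply: pat_law_out.
by move=> i; apply: pat_law_marg.
Qed.

Lemma pat_is_law T S : is_law (pat_law p T S).
Proof. by case: (pat_marginals T S). Qed.

Lemma Ex_overlap (T : {set 'I_n}) :
  Ex kw (fun S => overlap T (pat_law p T S)) <= #|T|%:R ^+ 2 * q ^+ 2.
Proof.
rewrite Ex_sum; apply: le_trans (_ : \sum_(i in T) \sum_(j in T) q ^+ 2 <= _); last first.
  by rewrite !sumr_const -mulrnA -[X in X <= _]mulr_natl natrM expr2.
apply: ler_sum => i iT; rewrite Ex_sum big_mkcondr; apply: ler_sum => j jT.
case: ifPn => ji; last exact: sqr_ge0.
rewrite (eq_Ex _ (G := fun S => p ^+ 2 * both R S i j)); last first.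
  by move=> S; rewrite pat_law_marg2 // eq_sym.
by rewrite ExZl Ex_both // 1?eq_sym // /edge_prob exprMn.
Qed.

Lemma touched_pattern T S c :
  touched (pattern T S c) = [set v | (v \notin T) && [exists j in T, adj S c v j]].
Proof.
apply/setP => v; rewrite !inE ffunE; case: ifP => vT /=; first by rewrite eqxx.
apply/set0Pn/exists_inP => [[j]|[j jT vj]]; last by exists j; rewrite inE jT.
by rewrite inE => /andP[jT vj]; exists j.
Qed.

Lemma low_set_pattern T S c : T \subset low_set S c -> low_pattern T k (pattern T S c).
Proof.
move=> Tl; apply/andP; split.
  apply/forallP => v; rewrite ffunE; case: ifP; rewrite ?sub0set // => _.
  by apply/subsetP => j; rewrite inE => /andP[].
apply/forall_inP => i iT; have := subsetP Tl i iT; rewrite inE; apply: leq_ltn_trans.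
apply: subset_leq_card; apply/subsetP => v; rewrite !inE ffunE.
by case: ifP; rewrite !inE // => _ /andP[_]; rewrite adjC.
Qed.

Definition independent_set (T : {set 'I_n}) (S : keys) (c : chans) : bool :=
  [forall i in T, forall j in T, ~~ adj S c i j].

(** A partial converse of [low_set_pattern]: the pattern does not see edges inside [T], so there
    must be none. *)
Lemma pattern_low_set T S c :
  independent_set T S c -> low_pattern T k (pattern T S c) -> T \subset low_set S c.
Proof.
move=> /forall_inP ind /andP[_ /forall_inP lowk]; apply/subsetP => i iT; rewrite inE.
apply: leq_ltn_trans (lowk i iT); apply: subset_leq_card; apply/subsetP => j.
rewrite !inE ffunE => ij; have jT : j \notin T.
  by apply: contraL ij => jT; have /forall_inP/(_ j jT) := ind i iT.
by rewrite (negPf jT) inE iT adjC.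
Qed.

Lemma adj_inside_dep T S (i j : 'I_n) : i \in T -> j \in T ->
  depends_on (inside T) (fun c : chans => adj S c i j).
Proof.
move=> iT jT c c' cc'; rewrite /adj (_ : channel_on c i j = channel_on c' i j) //.
apply: channel_on_dep => e; rewrite inE => /eqP ve; apply: cc'; rewrite inE.
by rewrite ve subUset !sub1set iT.
Qed.

Lemma independent_set_dep T S : depends_on (inside T) (independent_set T S).
Proof.
move=> c c' cc'; apply: eq_forallb => i; case: (boolP (i \in T)) => //= iT.
apply: eq_forallb => j; case: (boolP (j \in T)) => //= jT.
by rewrite (adj_inside_dep S iT jT cc').
Qed.

Lemma no_isolated_dep T S : depends_on (inside T) (no_isolated T S).
Proof.
move=> c c' cc'; apply: eq_forallb => i; case: (boolP (i \in T)) => //= iT.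
apply: eq_existsb => j; case: (boolP (j \in T)) => //= jT.
by rewrite (adj_inside_dep S iT jT cc').
Qed.

Lemma adj_keys_dep T (S S' : keys) c (i j : 'I_n) : (forall l, l \in T -> S l = S' l) ->
  i \in T -> j \in T -> adj S c i j = adj S' c i j.
Proof. by move=> SS iT jT; rewrite /adj !SS. Qed.

Section Moments.
Variable T : {set 'I_n}.
Local Notation m := #|T|.
Local Notation F := (bin_low k q (n - m)).
Hypothesis n0 : (0 < n)%N.
Hypothesis mq : 2 * (m%:R * q) <= 1.

Let q01 : 0 <= q <= 1. Proof. by rewrite edge_prob_ge0 ?edge_prob_le1. Qed.

Let cT : #|~: T| = (n - m)%N. Proof. by rewrite cardsCs setCK card_ord. Qed.

Let kw0 := @kw0 R n K P.
Let kw1 := @kw1 R n K P KP.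
Let cw0 := @cw0 R n p p01.
Let cw1 := @cw1 R n p.

Let mq1 : 0 < 1 - m%:R * q.
Proof.
by move: mq; move: (m%:R * q) => x; lra.
Qed.

Let F0 : 0 <= F.
Proof.
apply: sumr_ge0 => d _; case/andP: q01 => ? ?.
by rewrite !mulr_ge0 ?exprn_ge0 ?subr_ge0.
Qed.

(** The factor [n] is there because the comparison error is raised to the power of the number of
    outside nodes. *)
Definition crowded (eta : R) (S : keys) : bool :=
  eta < n%:R * overlap T (pat_law p T S).

Lemma overlap_ge0 S : 0 <= overlap T (pat_law p T S).
Proof.
apply: le_trans (multi_le (pat_marginals T S)); apply: sumr_ge0 => B _.
exact: pat_law_ge0.
Qed.

Lemma crowded_prob eta : 0 < eta ->
  Ex kw (fun S => (crowded eta S)%:R) <= n%:R * m%:R ^+ 2 * q ^+ 2 / eta.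
Proof.
move=> e0; rewrite ler_pdivlMr // -ExZr.
apply: le_trans (_ : n%:R * Ex kw (fun S => overlap T (pat_law p T S)) <= _); last first.
  by rewrite -mulrA; apply: ler_wpM2l => //; apply: Ex_overlap.
rewrite -ExZl; apply: (Ex_le kw0) => S; rewrite /crowded.
case: ltP => h; first by rewrite mul1r ltW.
by rewrite mul0r mulr_ge0 // overlap_ge0.
Qed.

(** One summand for each kind of keys. Uncrowded: comparison with the Bernoulli law. Crowded but
    good: low degrees leave at most [m * k] touched nodes, so nearly all others miss [T], and this
    bound is multiplied by the probability of crowding. Not good: the trivial bound 1. *)
Lemma moment_upper (good : keys -> bool) (eta phi0 z : R) :
  0 < eta -> 2 * eta < 1 -> 0 <= phi0 -> 1 <= z -> n%:R * (m%:R * q) <= z ->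
  (forall S, good S -> pat_law p T S set0 <= phi0) ->
  EE p (fun (S : keys) c => (T \subset low_set S c)%:R) <=
  (1 - 2 * eta)^-1 * ((1 + 2 * eta / n%:R) ^+ n * (1 - m%:R * q)^-1 ^+ (m * k) * F ^+ m) +
  (m * k).+1%:R * z ^+ (m * k) * phi0 ^+ (n - m - m * k) * (n%:R * m%:R ^+ 2 * q ^+ 2 / eta) +
  Ex kw (fun S => (~~ good S)%:R).
Proof.
move=> e0 e1 f0 z1 hz hgood.
set U := (1 - 2 * eta)^-1 * _; set tau := _ * phi0 ^+ _.
have tau0 : 0 <= tau by rewrite !mulr_ge0 ?exprn_ge0 //; lra.
have U0 : 0 <= U.
  apply: mulr_ge0; first by rewrite invr_ge0; lra.
  apply: mulr_ge0; last exact: exprn_ge0.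
  apply: mulr_ge0; apply: exprn_ge0; last by rewrite invr_ge0 ltW.
  by rewrite addr_ge0 // divr_ge0 // mulr_ge0 // ltW.
apply: le_trans (_ : EE p (fun (S : keys) c => 1 * (low_pattern T k (pattern T S c))%:R) <= _).
  apply: (EE_le p01) => S c; rewrite mul1r; case: (boolP (T \subset _)) => // h.
  by rewrite low_set_pattern.
rewrite (@EE_pattern R n K P p KP T (fun _ _ => 1) (fun b => (low_pattern T k b)%:R)) //.
apply: le_trans (_ : Ex kw (fun S => U + tau * (crowded eta S)%:R + (~~ good S)%:R) <= _); last first.
  rewrite !ExD ExZl Ex_cst // lerD2r lerD2l; apply: ler_wpM2l => //.
  exact: crowded_prob.
apply: (Ex_le kw0) => S; rewrite Ex_cst // mul1r.
have la := pat_is_law T S.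
rewrite -[X in X <= _]/(pr_low T k (pat_law p T S)).
case: (boolP (crowded eta S)) => cr /=; last first.
  rewrite mulr0 addr0 -[X in X <= _]addr0; apply: lerD => //.
  rewrite /U mulrC ler_pdivlMr; last by lra.
  rewrite [X in X <= _]mulrC.
  have := @pr_low_upper R _ T k q q01 mq (pat_law p T S) eta.
  rewrite card_ord cT; apply => //; first exact: pat_marginals.
  by rewrite leNgt.
rewrite mulr1; case: (boolP (good S)) => gS /=; last first.
  apply: le_trans (_ : 1 <= _); last by rewrite lerDr addr_ge0.
  apply: Ex_le_cst => [v|v B|b]; [exact: ext_weight1|exact: ext_weight_ge0|].
  by case: low_pattern.
rewrite addr0; apply: ler_wpDl => //.
apply: le_trans (low_touched la (leqnn _)) _.
apply: le_trans (tail_le_pow T (m * k) la z1 _) _.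
  rewrite card_ord; apply: le_trans hz; apply: ler_wpM2l => //.
  by rewrite lerBlDr addrC -lerBlDr; apply: none_ge (pat_marginals T S).
rewrite /tau cT; apply: ler_wpM2l; first by rewrite mulr_ge0 ?exprn_ge0 //; lra.
by apply: lerXn2r; rewrite ?nnegrE ?pat_law_ge0 // hgood.
Qed.

(** Restrict to [T] independent and keys uncrowded; the two failures cost [m ^ 2 q] and the Markov
    bound. The relation between [eta] and [zeta] turns uncrowdedness into [overlap <= zeta q]. *)
Lemma moment_lower (eta zeta : R) : 0 < eta -> eta = zeta * (n%:R * q) -> 0 <= zeta -> zeta < 1 ->
  1 - m%:R ^+ 2 * q - n%:R * m%:R ^+ 2 * q ^+ 2 / eta >= 0 ->
  2 * n%:R * m%:R ^+ 2 * q ^+ 2 <= 1 ->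
  (1 - m%:R ^+ 2 * q - n%:R * m%:R ^+ 2 * q ^+ 2 / eta) *
  ((1 - 2 * n%:R * m%:R ^+ 2 * q ^+ 2) * F ^+ m) <=
  (1 + 2 * m%:R ^+ 2 * q ^+ 2) ^+ n * (1 - zeta)^-1 ^+ (m * k) *
  EE p (fun (S : keys) c => (T \subset low_set S c)%:R).
Proof.
move=> e0 ez z0 z1 h0 h1; set A := 1 - _ - _; set B := (1 - 2 * _ * _ * _) * _.
set C := (1 + _) ^+ n * _.
have C0 : 0 <= C.
  rewrite mulr_ge0 ?exprn_ge0 ?invr_ge0 //; last by lra.
  by rewrite addr_ge0 // mulr_ge0 ?sqr_ge0 // mulr_ge0 ?sqr_ge0.
have B0 : 0 <= B.
  by rewrite mulr_ge0 ?subr_ge0 // exprn_ge0.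
apply: le_trans (_ : C * EE p (fun (S : keys) c => (independent_set T S c)%:R *
   (low_pattern T k (pattern T S c))%:R) <= _); last first.
  apply: ler_wpM2l => //; apply: (EE_le p01) => S c.
  case: (boolP (independent_set T S c)) => ind; last by rewrite mul0r.
  case: (boolP (low_pattern _ _ _)) => lp; last by rewrite mulr0.
  by rewrite pattern_low_set // mulr1.
rewrite (@EE_pattern R n K P p KP T (fun S c => (independent_set T S c)%:R)
   (fun b => (low_pattern T k b)%:R)); last 2 first.
- by move=> S c c' /independent_set_dep ->.
- move=> c S S' SS; congr (nat_of_bool _)%:R; apply: eq_forallb => i.
  case: (boolP (i \in T)) => //= iT; apply: eq_forallb => j; case: (boolP (j \in T)) => //= jT.
  by rewrite (adj_keys_dep c SS).
set I := fun S : keys => Ex cw (fun c => (independent_set T S c)%:R).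
have I0 S : 0 <= I S by apply: (Ex_ge0 cw1 cw0).
have I1 S : I S <= 1 by apply: (Ex_le_cst cw1 cw0) => c; case: independent_set.
have IA : A <= Ex kw I - Ex kw (fun S => (crowded eta S)%:R).
  rewrite /A; apply: lerB; last exact: crowded_prob.
  have -> : Ex kw I = EE p (fun (S : keys) c => (independent_set T S c)%:R) by [].
  apply: le_trans (_ : EE p (fun (S : keys) c => 1 - \sum_(i in T) \sum_(j in T) (adj S c i j)%:R) <= _).
    rewrite EEB EE_sum (_ : EE p (fun _ _ => 1) = 1); last by rewrite /EE (eq_Ex _ (G := fun=> 1)) ?Ex_cst // => S; rewrite Ex_cst.
    rewrite lerD2l lerN2; apply: le_trans (_ : \sum_(i in T) \sum_(j in T) q <= _); last first.
      by rewrite !sumr_const -mulrnA -[X in X <= _]mulr_natl natrM expr2.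
    apply: ler_sum => i iT; rewrite EE_sum; apply: ler_sum => j jT.
    have [->|ij] := eqVneq i j.
      rewrite (@eq_EE _ _ _ _ _ _ (fun _ _ => 0)); last by move=> S c; rewrite adj_irr.
      by rewrite /EE (eq_Ex _ (G := fun=> 0)) ?Ex_cst //; case/andP: q01.
    (* Ranking [i] above all other nodes reduces [forest_bound] to a single edge, of probability at
       most [q]. *)
    have := forest_bound KP p01 (fun l => (l == i)%N : nat) [set j] [set i].
    rewrite !cards1 expr1 mul1r; apply: le_trans; apply: (EE_le p01) => S c.
    rewrite big_set1; case: (boolP (adj S c i j)) => aij //.
    suff -> : [exists u in [set j], ((u == i) < (i == i))%N && adj S c i u] by [].
    by apply/exists_inP; exists j; rewrite ?inE // eqxx eq_sym (negPf ij).
  apply: (EE_le p01) => S c; case: (boolP (independent_set T S c)) => ind.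
    by rewrite gerBl; apply: sumr_ge0 => i _; apply: sumr_ge0.
  move: ind; rewrite negb_forall => /existsP[i]; rewrite negb_imply => /andP[iT].
  rewrite negb_forall => /existsP[j]; rewrite negb_imply negbK => /andP[jT ij].
  rewrite subr_le0 (bigD1 i) //= (bigD1 j) //= ij -addrA lerDl addr_ge0 //.
    exact: sumr_ge0.
  by apply: sumr_ge0 => l _; apply: sumr_ge0.
apply: le_trans (ler_wpM2r B0 IA) _; rewrite -ExB -ExZr -ExZl.
apply: (Ex_le kw0) => S; rewrite -/(I S) -/(pr_low T k (pat_law p T S)).
have la := pat_is_law T S; have Q0 := pr_low_ge0 T k la.
case: (boolP (crowded eta S)) => cr.
  apply: le_trans (_ : 0 <= _); last exact: mulr_ge0 C0 (mulr_ge0 (I0 S) Q0).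
  by rewrite mulr_le0_ge0 // subr_le0.
rewrite subr0 [X in _ <= X]mulrCA; apply: ler_wpM2l; first exact: I0.
have := @pr_low_lower R _ T k q q01 mq (pat_law p T S) zeta (pat_marginals T S).
rewrite card_ord cT; apply => //.
move: cr; rewrite /crowded -leNgt ez; have n0' : 0 < n%:R :> R by rewrite ltr0n.
by rewrite mulrCA ler_pM2l.
Qed.

End Moments.

Section Cuts.

(** Given the keys of [T], the inside of [T] and the attachment of the other nodes are independent,
    so the probability of [no_isolated] survives as a factor. *)
Lemma cut_term_small (T : {set 'I_n}) (good : keys -> bool) (phi0 z : R) l :
  depends_on T good -> 0 <= phi0 -> 1 <= z -> n%:R * (#|T|%:R * q) <= z ->
  (forall S, good S -> pat_law p T S set0 <= phi0) ->
  EE p (fun (S : keys) c => (good S && no_isolated T S c)%:R *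
     (#|touched (pattern T S c)| <= l)%N%:R) <=
  l.+1%:R * z ^+ l * phi0 ^+ (n - #|T| - l) * EE p (fun (S : keys) c => (no_isolated T S c)%:R).
Proof.
move=> dg f0 z1 hz hgood; have cw0 := @cw0 R n p p01; have cw1 := @cw1 R n p.
rewrite (@EE_pattern R n K P p KP T (fun S c => (good S && no_isolated T S c)%:R)
   (fun b => (#|touched b| <= l)%N%:R)); last 2 first.
- by move=> S c c' /no_isolated_dep ->.
- move=> c S S' SS; rewrite (dg _ _ SS); congr (nat_of_bool (_ && _))%:R.
  apply: eq_forallb => i; case: (boolP (i \in T)) => //= iT.
  apply: eq_existsb => j; case: (boolP (j \in T)) => //= jT.
  by rewrite (adj_keys_dep c SS).
rewrite /EE -ExZl; apply: (Ex_le (@kw0 R n K P)) => S.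
have N0 : 0 <= Ex cw (fun c => (no_isolated T S c)%:R) by apply: (Ex_ge0 cw1 cw0).
case: (boolP (good S)) => gS /=; last first.
  rewrite Ex_cst // mul0r; apply: mulr_ge0 => //; rewrite !mulr_ge0 ?exprn_ge0 //; lra.
rewrite mulrC; apply: ler_wpM2r => //; have la := pat_is_law T S.
apply: le_trans (tail_le_pow T l la z1 _) _.
  rewrite card_ord; apply: le_trans hz; apply: ler_wpM2l => //.
  by rewrite lerBlDr addrC -lerBlDr; apply: none_ge (pat_marginals T S).
rewrite (cardsCs (~: T)) setCK card_ord; apply: ler_wpM2l; first by rewrite mulr_ge0 ?exprn_ge0 //; lra.
by apply: lerXn2r; rewrite ?nnegrE ?pat_law_ge0 // hgood.
Qed.

(** For large [T] the few touched nodes already suffice, and the event inside [T] is dropped. *)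
Lemma cut_term_large (T : {set 'I_n}) (good : keys -> bool) (phi0 : R) l :
  depends_on T good -> 0 <= phi0 ->
  (forall S, good S -> pat_law p T S set0 <= phi0) ->
  EE p (fun (S : keys) c => (good S && no_isolated T S c)%:R *
     (#|touched (pattern T S c)| <= l)%N%:R) <=
  2 ^+ n * phi0 ^+ (n - #|T| - l).
Proof.
move=> dg f0 hgood; have cw0 := @cw0 R n p p01; have cw1 := @cw1 R n p.
apply: le_trans (_ : EE p (fun (S : keys) c => (good S)%:R *
     (#|touched (pattern T S c)| <= l)%N%:R) <= _).
  apply: (EE_le p01) => S c; apply: ler_wpM2r => //.
  by case: (good S) => //=; case: no_isolated.
rewrite (@EE_pattern R n K P p KP T (fun S c => (good S)%:R)
   (fun b => (#|touched b| <= l)%N%:R)) //; last by move=> c S S' SS; rewrite (dg _ _ SS).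
have t0 : 0 <= 2 ^+ n * phi0 ^+ (n - #|T| - l) by rewrite mulr_ge0 ?exprn_ge0.
apply: (Ex_le_cst (@kw1 R n K P KP) (@kw0 R n K P)) => S; rewrite Ex_cst //.
case: (boolP (good S)) => gS; last by rewrite mul0r.
rewrite mul1r; apply: le_trans (tail_le_exp T l (pat_is_law T S)) _.
rewrite (cardsCs (~: T)) setCK card_ord; apply: ler_wpM2l; first by rewrite exprn_ge0.
by apply: lerXn2r; rewrite ?nnegrE ?pat_law_ge0 // hgood.
Qed.

Hypothesis k1 : (1 <= k)%N.
Hypothesis kn : (k < n)%N.

Lemma Pr_k_connected_le :
  Pr_k_connected k n K P p <= EE p (fun (S : keys) c => (#|low_set S c| == 0)%N%:R).
Proof.
rewrite /Pr_k_connected PrE; apply: (EE_le p01) => S c.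
case: (boolP (k_connected _ _)) => // kc; rewrite cards_eq0.
suff -> : low_set S c = set0 by rewrite eqxx.
apply/setP => i; rewrite !inE; apply/negbTE; rewrite -leqNgt.
apply: (@k_connected_degree _ (adjacent (S, c)) k) => //; last by rewrite card_ord.
by move=> j; apply: adj_irr.
Qed.

(** The global good event is paid once. It passes to each [T], where only a version reading the keys
    of [T] is kept, so that every term of the union bound over cuts can be conditioned. *)
Lemma Pr_k_connected_ge (good : {set 'I_n} -> keys -> bool) :
  (forall T S, good setT S -> good T S) ->
  EE p (fun (S : keys) c => (#|low_set S c| == 0)%N%:R) <=
  Pr_k_connected k n K P p + Ex kw (fun S => (~~ good setT S)%:R) +
  \sum_(T : {set 'I_n} | (1 < #|T|)%N && (2 * #|T| <= n)%N)
    EE p (fun (S : keys) c => (good T S && no_isolated T S c)%:R *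
     (#|touched (pattern T S c)| <= k.-1)%N%:R).
Proof.
move=> gT; rewrite /Pr_k_connected PrE -EE_sum.
have -> : Ex kw (fun S => (~~ good setT S)%:R) = EE p (fun S c => (~~ good setT S)%:R).
  by apply: eq_Ex => S; rewrite Ex_cst //; apply: cw1.
rewrite -!EED; apply: (EE_le p01) => S c.
set sum := \sum_(T | _) _.
have s0 : 0 <= sum by apply: sumr_ge0 => T _; rewrite mulr_ge0.
case: eqP => [l0|_]; last by rewrite !addr_ge0.
case: (boolP (k_connected _ _)) => kc /=; first by rewrite -addrA lerDl addr_ge0.
case: (boolP (good setT S)) => gS /=; last by rewrite add0r lerDl.
have [|||X] := @not_k_connected_cut _ (adjacent (S, c)) k _ _ k1 _ kc.
- by move=> i j; apply: adjC.
- by move=> i; apply: adj_irr.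
- move=> i; rewrite leqNgt; apply/negP => h.
  by have : i \in low_set S c; [rewrite inE | rewrite (cards0_eq l0) inE].
case/and4P=> X1 X2 X3 X4; rewrite !add0r /sum (bigD1 X) /=; last first.
  by rewrite X1 /= -[X in (_ <= X)%N]card_ord.
rewrite gT // touched_pattern (_ : no_isolated X S c) //=.
have -> /= : (#|[set v | (v \notin X) && [exists j in X, adj S c v j]]| <= k.-1)%N.
  by rewrite -ltnS prednK.
by rewrite mulr1 lerDl; apply: sumr_ge0 => T _; rewrite mulr_ge0.
Qed.

End Cuts.

Lemma EE_binomial_low j :
  EE p (fun (S : keys) c => 'C(#|low_set S c|, j)%:R) =
  \sum_(T : {set 'I_n} | #|T| == j) EE p (fun (S : keys) c => (T \subset low_set S c)%:R).
Proof. by rewrite -EE_sum; apply: eq_EE => S c; rewrite binomial_card_subsets. Qed.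

End Events.

(* Imported only here because [classical_sets] reuses many names of [finset]; the
   second line gives those names back to [finset]. *)
From mathcomp Require Import all_classical all_reals all_analysis.
From mathcomp Require Import fintype finset zify ring lra.
Import numFieldNormedType.Exports.

(** * Exponential inequalities *)

Section ExpBounds.
Variable R : realType.
Implicit Types x y c : R.

(** Convexity of the exponential between [- y] and [0], obtained by averaging the tangent inequality
    at [- (c * y)] over the two endpoints. *)
Lemma expR_convex0 c y : 0 <= c <= 1 -> expR (- (c * y)) <= 1 - c * (1 - expR (- y)).
Proof.
case/andP=> c0 c1; set b := - (c * y).
have tangent a : expR b * (1 + (a - b)) <= expR a.
  by have := expR_ge1Dx (a - b); rewrite -(ler_pM2l (expR_gt0 b)) -expRD [b + _]addrC subrK.
have h0 := tangent 0; have h1 := tangent (- y); rewrite expR0 in h0.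
have := ler_wpM2l c0 h1; have : 0 <= 1 - c by lra.
move=> c1'; have := ler_wpM2l c1' h0.
have -> : (1 - c) * (expR b * (1 + (0 - b))) = expR b * (1 + c * y - c * (1 + c * y)) by rewrite /b; ring.
have -> : c * (expR b * (1 + (- y - b))) = expR b * (c * (1 + c * y) - c * y) by rewrite /b; ring.
move=> h2 h3; have := lerD h2 h3; rewrite -mulrDr.
have -> : 1 + c * y - c * (1 + c * y) + (c * (1 + c * y) - c * y) = 1 by ring.
rewrite mulr1 => h; apply: le_trans h _; rewrite le_eqVlt; apply/orP; left; apply/eqP; ring.
Qed.

Lemma onem_le_expR x : 1 - x <= expR (- x).
Proof. exact: expR_ge1Dx. Qed.

Lemma onem_pow_le x (n : nat) : x <= 1 -> (1 - x) ^+ n <= expR (- (n%:R * x)).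
Proof.
move=> x1; rewrite -mulrN expRM_natl; apply: lerXn2r; rewrite ?nnegrE ?expR_ge0 ?subr_ge0 //.
exact: onem_le_expR.
Qed.

Lemma onem_ge_expR x : x < 1 -> expR (- (x / (1 - x))) <= 1 - x.
Proof.
move=> x1; have x1' : 0 < 1 - x by rewrite subr_gt0.
rewrite expRN -[X in _ <= X]invrK lef_pV2 ?posrE ?expR_gt0 ?invr_gt0 //.
apply: le_trans (expR_ge1Dx _).
have -> : 1 + x / (1 - x) = (1 - x)^-1 by field; rewrite gt_eqF.
by [].
Qed.

Lemma expR_half_bound : expR (- 1 : R) <= 2^-1.
Proof.
rewrite expRN lef_pV2 ?posrE ?expR_gt0 //.
by apply: le_trans (expR_ge1Dx 1).
Qed.

Lemma onem_expR_ge y : 0 <= y -> Num.min 1 y / 2 <= 1 - expR (- y).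
Proof.
move=> y0; have e2 := expR_half_bound; case: (leP 1 y) => y1.
  have : expR (- y) <= expR (- 1) by rewrite ler_expR lerN2.
  by move: e2; lra.
have y01 : 0 <= y <= 1 by rewrite y0 ltW.
have h := expR_convex0 1 y01; rewrite mulr1 in h. rewrite lerBrDr -lerBrDl; apply: le_trans h _; rewrite lerD2l lerN2.
by apply: ler_wpM2l => //; move: e2; lra.
Qed.

Lemma pow_fact_le_expR (x : nat) : (x%:R ^+ x / x`!%:R : R) <= expR x%:R.
Proof.
case: x => [|x]; first by rewrite expr0 fact0 divr1 expR0.
by apply: le_trans (expR_ge1Dxn x _) => //; rewrite lerDr.
Qed.

Lemma bin_le_pow (P x : nat) : ('C(P, x)%:R * x`!%:R : R) <= P%:R ^+ x.
Proof.
rewrite -natrM bin_ffact -natrX ler_nat; elim: x => [|m IH]; first by rewrite ffactn0 expn0.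
by rewrite ffactnSr expnSr leq_mul // leq_subr.
Qed.

Lemma bin_pow_le_expR (P x : nat) : (0 < P)%N ->
  'C(P, x)%:R * (x%:R / P%:R) ^+ x <= expR x%:R :> R.
Proof.
move=> P0; have P0' : 0 < P%:R :> R by rewrite ltr0n.
apply: le_trans (pow_fact_le_expR x); rewrite expr_div_n ler_pdivlMr ?ltr0n ?fact_gt0 //.
rewrite mulrA mulrAC ler_pdivrMr ?exprn_gt0 // mulrAC mulrC.
by apply: ler_wpM2l; rewrite ?exprn_ge0 // bin_le_pow.
Qed.

Lemma bin_le_expR (n m : nat) : (0 < m)%N ->
  'C(n, m)%:R <= expR m%:R * (n%:R / m%:R) ^+ m :> R.
Proof.
move=> m0; have m0' : 0 < m%:R :> R by rewrite ltr0n.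
rewrite expr_div_n mulrA ler_pdivlMr ?exprn_gt0 //.
have h := pow_fact_le_expR m; rewrite ler_pdivrMr ?ltr0n ?fact_gt0 // in h.
apply: le_trans (_ : 'C(n, m)%:R * (expR m%:R * m`!%:R) <= _); first exact: ler_wpM2l.
by rewrite mulrCA; apply: ler_wpM2l; rewrite ?expR_ge0 // bin_le_pow.
Qed.

(** The Taylor term of degree [D + 1], one more than the power to be beaten, leaves the decaying
    factor [1 / x]. *)
Lemma pow_expR_le (D : nat) (a x : R) : 0 < a -> 0 < x ->
  x ^+ D * expR (- (a * x)) <= D.+1`!%:R / a ^+ D.+1 / x.
Proof.
move=> a0 x0; have ax : 0 <= a * x by rewrite mulr_ge0 // ltW.
have h : (a * x) ^+ D.+1 / D.+1`!%:R <= expR (a * x).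
  by apply: le_trans (expR_ge1Dxn D ax); rewrite lerDr.
rewrite expRN ler_pdivrMr ?expR_gt0 // mulrC mulrA ler_pdivlMr //.
rewrite -exprSr mulrA ler_pdivlMr ?exprn_gt0 // -exprMn [x * a]mulrC.
by move: h; rewrite ler_pdivrMr ?ltr0n ?fact_gt0.
Qed.

Lemma geometric_le (d : R) (N : nat) : 0 <= d -> 2 * d <= 1 ->
  \sum_(i < N) d ^+ i.+1 <= 2 * d.
Proof.
move=> d0 d1; have : \sum_(i < N) d ^+ i.+1 <= 2 * d - 2 * d ^+ N.+1.
  elim: N => [|N IH]; first by rewrite big_ord0 expr1 subrr.
  rewrite big_ord_recr /=; apply: le_trans (lerD IH (lexx _)) _.
  rewrite [d ^+ N.+2]exprS; have : 0 <= d ^+ N.+1 by apply: exprn_ge0.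
  set e := d ^+ N.+1 => e0; nra.
by move=> h; apply: le_trans h _; rewrite gerBl mulr_ge0 // exprn_ge0.
Qed.

End ExpBounds.

(** * The share probability against [1 - expR (- K^2 / P)] *)

Section ShareBounds.
Variables (R : realType) (K P : nat).
Hypothesis K0 : (0 < K)%N.
Hypothesis KP2 : (2 * K < P)%N.
Local Notation s := (key_share_prob R K P).
Local Notation y := (K%:R ^+ 2 / P%:R : R).

Let KP : (K <= P)%N. Proof. by lia. Qed.
Let P0 : (0 < P)%N. Proof. by lia. Qed.
Let P0' : 0 < P%:R :> R. Proof. by rewrite ltr0n. Qed.
Let K0' : 0 < K%:R :> R. Proof. by rewrite ltr0n. Qed.

Lemma share_ge_expR : 1 - expR (- y) <= s.
Proof.
apply: le_trans (key_share_ge R KP P0); rewrite lerD2l lerN2.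
apply: le_trans (onem_pow_le _ _) _; last by rewrite expr2 mulrA.
by rewrite ler_pdivrMr // mul1r ler_nat.
Qed.

(** The elementary bounds give [s <= 1 - expR (- y / c)] with [c = 1 - 2 K / P], and convexity
    trades the division in the exponent for a factor [c] in front. The loss is relative, hence
    uniform over small and large [y]. *)
Lemma share_le_expR : (1 - 2 * K%:R / P%:R) * s <= 1 - expR (- y).
Proof.
have PK2 : 0 < P%:R - 2 * K%:R :> R.
  by rewrite subr_gt0 -natrM ltr_nat.
have PK : 0 < P%:R - K%:R :> R by rewrite subr_gt0 ltr_nat; lia.
set c := 1 - 2 * K%:R / P%:R.
have cE : c = (P%:R - 2 * K%:R) / P%:R by rewrite /c mulrBl divff ?gt_eqF.
have c0 : 0 < c by rewrite cE divr_gt0.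
have c1 : c <= 1 by rewrite /c gerBl !mulr_ge0 ?invr_ge0 // ltW.
pose t : R := K%:R / (P%:R - K%:R).
have t1 : t < 1 by rewrite /t ltr_pdivrMr // mul1r; lra.
have tE : t / (1 - t) = K%:R / (P%:R - 2 * K%:R).
  by rewrite /t; field; rewrite !gt_eqF //=.
have sE : s <= 1 - expR (- (y / c)).
  apply: le_trans (key_share_le R KP KP2) _; rewrite lerD2l lerN2.
  have -> : - (y / c) = K%:R * - (t / (1 - t)).
    rewrite tE cE; field; rewrite !gt_eqF //=.
  rewrite expRM_natl; apply: lerXn2r; rewrite ?nnegrE ?expR_ge0 //.
    by rewrite subr_ge0 ltW.
  exact: onem_ge_expR.
have c01 : 0 <= c <= 1 by rewrite c1 ltW.
have := expR_convex0 (y / c) c01; rewrite mulrCA divff ?gt_eqF // mulr1 => h.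
apply: le_trans (ler_wpM2l (ltW c0) sE) _.
by rewrite lerBrDr -lerBrDl; apply: le_trans h _; rewrite lexx.
Qed.

Lemma share_le_twice : (4 * K <= P)%N -> s <= 2 * y.
Proof.
move=> KP4; have c2 : 2^-1 <= 1 - 2 * K%:R / P%:R :> R.
  rewrite lerBrDr -lerBrDl ler_pdivrMr // (_ : 1 - 2^-1 = 2^-1 :> R); last by lra.
  by rewrite [2^-1 * _]mulrC ler_pdivlMr // -!natrM ler_nat; lia.
have s0 := key_share_ge0 R K P.
have h1 := ler_wpM2r s0 c2; have h2 := share_le_expR; have h3 := onem_le_expR y.
have h4 : 2^-1 * s <= y by apply: le_trans h1 _; apply: le_trans h2 _; rewrite lerBlDr -lerBlDl.
by rewrite mulrC -ler_pdivrMr // mulrC.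
Qed.

Lemma share_gt0 : 0 < s.
Proof.
apply: lt_le_trans share_ge_expR; rewrite subr_gt0 expR_lt1 oppr_lt0 divr_gt0 //.
by rewrite exprn_gt0.
Qed.

End ShareBounds.

(** * Expanding keys and the chance of missing a set *)

Section Attach.
Variables (R : realType) (n K P : nat) (p : R) (d M : nat).
Hypothesis K0 : (0 < K)%N.
Hypothesis p01 : 0 <= p <= 1.
Hypothesis d0 : (0 < d)%N.
Local Notation keys := {ffun 'I_n -> key_set K P}.
Local Notation q := (edge_prob K P p).
Local Notation s := (key_share_prob R K P).

(** The pool of [X] keeps a fraction [1 - 1/d] of the [#|X| * K] keys it would have if all key sets
    were disjoint. *)
Definition expanding (T : {set 'I_n}) (S : keys) : bool :=
  [forall X : {set 'I_n}, (X \subset T) && (#|X| <= M)%N ==>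
     (d.-1 * (#|X| * K) <= d * #|pool S X|)%N].

Lemma expandingS (T : {set 'I_n}) S : expanding setT S -> expanding T S.
Proof.
move=> /forallP h; apply/forallP => X; apply/implyP => /andP[_ XM].
by have := h X; rewrite subsetT XM.
Qed.

Lemma expanding_mono (T T' : {set 'I_n}) S : T' \subset T -> expanding T S -> expanding T' S.
Proof.
move=> TT /forallP h; apply/forallP => X; apply/implyP => /andP[XT XM].
by have := h X; rewrite (subset_trans XT TT) XM.
Qed.

Lemma expanding_dep T : depends_on T (expanding T).
Proof.
move=> S S' SS; apply: eq_forallb => X; case: (boolP (X \subset T)) => //= XT.
rewrite (_ : pool S X = pool S' X) //; apply: eq_bigr => i iX.
by rewrite SS // (subsetP XT).
Qed.

(* A node attaches to [T] when it shares a key with the random subset [J] of [T]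
   formed by the open channels; as long as [J] has at most [M] elements, its key
   sets are almost disjoint. *)
Lemma attach_bound (T : {set 'I_n}) S :
  (2 * d * K < P)%N -> (0 < M)%N -> 9 * d%:R * expR 9 <= (s * M%:R) ^+ 2 ->
  #|T|%:R * q <= 9 -> expanding T S ->
  pat_law p T S set0 <= expR (- ((1 - 3 / d%:R) * (#|T|%:R * q))).
Proof.
move=> dKP M0 sM Tq exS; have [p0 p1] := andP p01.
have KP2 : (2 * K < P)%N by apply: leq_ltn_trans dKP; nia.
have KP : (K <= P)%N by lia.
have P0 : (0 < P)%N by lia.
have P0' : 0 < P%:R :> R by rewrite ltr0n.
have d0' : 0 < d%:R :> R by rewrite ltr0n.
have M0' : 0 < M%:R :> R by rewrite ltr0n.
have s0 := share_gt0 R K0 KP2.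
set y := K%:R ^+ 2 / P%:R : R; set c := 1 - d%:R^-1 : R.
have c01 : 0 <= c <= 1.
  by rewrite /c subr_ge0 gerBl invr_ge0 (ltW d0') invf_le1 // ler1n d0.
have cd : c * d%:R = d.-1%:R by rewrite /c mulrBl mul1r mulVf ?gt_eqF // -{1}(prednK d0) -natr1 addrK.
set g := expR (- (c * y)).
have := @pat_law0_le R n K P p KP p01 S T M g M0 (expR_ge0 _).
have hg : forall J : {set 'I_n}, J \subset T -> (#|J| <= M)%N ->
   key_ex (fun s : key_set K P => (val s :&: pool S J == set0)%:R) <= g ^+ #|J|.
  move=> J JT JM; apply: le_trans (key_ex_avoid_le R KP (pool S J) P0) _.
  have pP : (#|pool S J| <= P)%N by rewrite -[X in (_ <= X)%N]card_ord max_card.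
  apply: le_trans (onem_pow_le _ _) _; first by rewrite ler_pdivrMr // mul1r ler_nat.
  rewrite /g -expRM_natl ler_expR mulrN lerN2 /y expr2.
  have := forallP exS J; rewrite JT JM /= -(ler_nat R) !natrM -cd => h.
  rewrite !mulrA ler_pM2r ?invr_gt0 // mulrC -!mulrA.
  rewrite -(ler_pM2l d0'); apply: le_trans (_ : K%:R * (c * d%:R * (#|J|%:R * K%:R)) <= _).
    by rewrite le_eqVlt; apply/orP; left; apply/eqP; ring.
  by rewrite [X in _ <= X]mulrCA; apply: ler_wpM2l.
move=> /(_ hg) h; apply: le_trans h _.
set x := #|T|%:R * q; have x0 : 0 <= x by rewrite mulr_ge0 // edge_prob_ge0.
have g1 : 1 - g <= 1 by rewrite gerBl expR_ge0.
(* Two of the three losses [1/d]: one from expansion, one from [share_le_expR], where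
   [2 K / P <= 1/d]. *)
have gs : (1 - 2 / d%:R) * s <= 1 - g.
  apply: le_trans (_ : c * ((1 - 2 * K%:R / P%:R) * s) <= _); last first.
    apply: le_trans (_ : c * (1 - expR (- y)) <= _).
      by apply: ler_wpM2l (share_le_expR R K0 KP2); case/andP: c01.
    by have := expR_convex0 y c01; rewrite -/g; lra.
  rewrite mulrA; apply: ler_wpM2r; first exact: ltW.
  have : 2 * K%:R / P%:R <= d%:R^-1 :> R.
    rewrite ler_pdivrMr // [d%:R^-1 * _]mulrC ler_pdivlMr // -!natrM ler_nat.
    by rewrite mulnAC ltnW.
  have i0 : 0 < d%:R^-1 :> R by rewrite invr_gt0.
  move: i0 c01; rewrite /c; set i := d%:R^-1; set e := 2 * K%:R / P%:R => i0 /andP[c0 c1] ei.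
  have e0 : 0 <= e by rewrite /e !mulr_ge0 ?invr_ge0.
  nra.
have t1 : (1 - p * (1 - g)) ^+ #|T| <= expR (- ((1 - 2 / d%:R) * x)).
  apply: le_trans (onem_pow_le _ _) _.
    by rewrite mulr_ile1 // subr_ge0 expR_le1 oppr_le0 mulr_ge0 ?divr_ge0 ?exprn_ge0 //; case/andP: c01.
  rewrite ler_expR lerN2 /x /edge_prob mulrCA; apply: ler_wpM2l => //.
  by rewrite mulrCA; apply: ler_wpM2l.
(* The third loss is the truncation at [M]: the quantity squared is [x / (s M)]. As [x <= 9], the
   assumption on [s M] makes its square at most [x expR (- 9) / d], which the exponential then
   absorbs since [a x <= 9]. *)
have t2 : (#|T|%:R * p / M%:R) ^+ 2 <= x * (expR (- 9) / d%:R).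
  have -> : #|T|%:R * p / M%:R = x / (s * M%:R).
    by rewrite /x /edge_prob; field; rewrite !gt_eqF.
  rewrite expr_div_n ler_pdivrMr ?exprn_gt0 ?mulr_gt0 // expr2 -mulrA.
  apply: ler_wpM2l => //; apply: le_trans Tq _.
  rewrite -mulrA mulrC -ler_pdivrMr ?expR_gt0 //.
  by rewrite [d%:R^-1 * _]mulrC ler_pdivlMr // expRN invrK mulrAC.
apply: le_trans (lerD t1 t2) _.
have -> : 1 - 3 / d%:R = (1 - 2 / d%:R) - d%:R^-1 :> R by field; rewrite gt_eqF.
set a := 1 - 2 / d%:R.
have ax : a * x <= 9.
  apply: le_trans Tq; rewrite ler_piMl // /a gerBl divr_ge0 // ltW.
have -> : - ((a - d%:R^-1) * x) = - (a * x) + x / d%:R by ring.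
have xd0 : 0 <= x / d%:R by rewrite divr_ge0 // ltW.
rewrite expRD; apply: le_trans (ler_wpM2l (expR_ge0 _) (expR_ge1Dx (x / d%:R))).
rewrite mulrDr mulr1 lerD2l mulrCA; apply: ler_wpM2r => //.
by rewrite ler_expR lerN2.
Qed.

End Attach.

(** * Keys are expanding with high probability *)

Section ExpansionProbability.
Variables (R : realType) (n K P : nat) (d : nat).
Hypothesis K0 : (0 < K)%N.
Hypothesis KP : (K <= P)%N.
Hypothesis d0 : (0 < d)%N.
Local Notation kw := (@kw R n K P).
Local Notation eta := (expR (- (6 * d%:R)) : R).

Let P0 : (0 < P)%N. Proof. exact: leq_trans K0 KP. Qed.
Let P0' : 0 < P%:R :> R. Proof. by rewrite ltr0n. Qed.
Let K0' : 0 < K%:R :> R. Proof. by rewrite ltr0n. Qed.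
Let d0' : 0 < d%:R :> R. Proof. by rewrite ltr0n. Qed.

(** In [pool_small_prob], [x] of the [#|X| * K] factors [x / P] cancel the binomial up to [expR x];
    the others, at least a fraction [1/d] of the total, are at most [u]. *)
Lemma pool_bound (X : {set 'I_n}) : (0 < #|X|)%N -> #|X|%:R * K%:R / P%:R <= eta ->
  Ex kw (fun S => (d * #|pool S X| < d.-1 * (#|X| * K))%N%:R) <=
  expR (#|X|%:R * (K%:R / (2 * d%:R) * ln (#|X|%:R * K%:R / P%:R))).
Proof.
move=> X0 hu; set m := #|X|; set u := m%:R * K%:R / P%:R.
have m0' : 0 < m%:R :> R by rewrite ltr0n.
have u0 : 0 < u by rewrite divr_gt0 // mulr_gt0.
have lu : ln u <= - (6 * d%:R).
  by rewrite -[X in _ <= X]expRK ler_ln ?posrE ?expR_gt0.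
have u1 : u <= 1 by apply: le_trans hu _; rewrite expR_le1 oppr_le0 mulr_ge0 // ltW.
have mKP : (m * K <= P)%N.
  by move: u1; rewrite ler_pdivrMr // mul1r -natrM ler_nat.
set x := ((d.-1 * (m * K)) %/ d)%N.
have xd : (x * d <= d.-1 * (m * K))%N by apply: leq_trunc_div.
have xmK : (x <= m * K)%N by rewrite -(leq_pmul2r d0); apply: leq_trans xd _; nia.
have xP : (x <= P)%N by apply: leq_trans mKP.
apply: le_trans (_ : Ex kw (fun S => (#|pool S X| <= x)%N%:R) <= _).
  apply: (Ex_le (@kw0 R n K P)) => S; case: (ltnP _ _) => // h.
  by rewrite /x leq_divRL // mulnC ltnW.
apply: le_trans (pool_small_prob R KP X P0 xP) _; rewrite -exprM -/m.
rewrite (_ : (K * m = x + (m * K - x))%N); last by rewrite subnKC // mulnC.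
rewrite exprD mulrA.
apply: le_trans (_ : expR x%:R * u ^+ (m * K - x) <= _).
  apply: ler_pM; rewrite ?mulr_ge0 ?exprn_ge0 ?divr_ge0 //.
    exact: bin_pow_le_expR.
  apply: lerXn2r; rewrite ?nnegrE ?divr_ge0 // ?(ltW u0) //.
  by rewrite /u ler_pM2r ?invr_gt0 // -natrM ler_nat.
rewrite -[X in X ^+ _](@lnK R u) ?posrE // -expRM_natl -expRD ler_expR.
have xr : x%:R <= m%:R * K%:R :> R by rewrite -natrM ler_nat.
have yr : m%:R * K%:R / d%:R <= (m * K - x)%:R :> R.
  by rewrite ler_pdivrMr // -!natrM ler_nat; nia.
have -> : m%:R * (K%:R / (2 * d%:R) * ln u) = (m%:R * K%:R / d%:R) * (ln u / 2).
  by field; rewrite gt_eqF.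
(* Half of the exponent pays for [expR x], since [ln u <= - 6 d]; the other half is the result. *)
have h : m%:R * K%:R <= (m%:R * K%:R / d%:R) * - (ln u / 2).
  rewrite -mulrA ler_peMr ?mulr_ge0 //.
  rewrite mulrC ler_pdivlMr // mul1r.
  by move: lu d0'; move: (ln u) (d%:R : R) => l dd; lra.
have z0 : 0 <= m%:R * K%:R / d%:R :> R by apply: divr_ge0; [exact: mulr_ge0 | exact: ltW].
move: xr yr h z0; set A := m%:R * K%:R; set B := A / d%:R; set C := (m * K - x)%:R.
have d1 : 1 <= d%:R :> R by rewrite ler1n.
set l := ln u in lu *; have l0 : l <= 0 by lra.
by move=> xr yr h z0; nra.
Qed.

(** [N] bounds the sizes that occur: it is [#|T|] for a fixed [T], which may be far below [M], and
    [M] itself for the whole node set. *)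
Lemma not_expanding_le (M : nat) (T : {set 'I_n}) (N : nat) :
  N%:R * K%:R / P%:R <= eta -> (forall X : {set 'I_n}, X \subset T -> (#|X| <= M)%N -> (#|X| <= N)%N) ->
  Ex kw (fun S => (~~ expanding d M T S)%:R) <=
  \sum_(X : {set 'I_n} | (X \subset T) && (0 < #|X| <= M)%N)
    expR (#|X|%:R * (K%:R / (2 * d%:R) * ln (#|X|%:R * K%:R / P%:R))).
Proof.
move=> hN XN.
apply: le_trans (_ : Ex kw (fun S => \sum_(X : {set 'I_n} | (X \subset T) && (0 < #|X| <= M)%N)
   (d * #|pool S X| < d.-1 * (#|X| * K))%N%:R) <= _).
  apply: (Ex_le (@kw0 R n K P)) => S; case: (boolP (expanding _ _ _ _)) => h /=.
    exact: sumr_ge0.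
  move: h; rewrite negb_forall => /existsP[X]; rewrite negb_imply -ltnNge => /andP[/andP[XT XM] h].
  rewrite (bigD1 X) /=; first by rewrite h lerDl; apply: sumr_ge0.
  rewrite XT XM andbT /= lt0n; apply: contraTneq h => ->; by rewrite mul0n muln0.
rewrite Ex_sum; apply: ler_sum => X /andP[XT /andP[X0 XM]]; apply: pool_bound => //.
apply: le_trans hN; rewrite ler_pM2r ?invr_gt0 // ler_pM2r // ler_nat.
exact: XN.
Qed.

(** The logarithms are negative, so each summand is largest with prefactor 1 and [#|T|] inside the
    logarithm. *)
Lemma not_expanding_fixed (M : nat) (T : {set 'I_n}) : (0 < #|T|)%N -> #|T|%:R * K%:R / P%:R <= eta ->
  Ex kw (fun S => (~~ expanding d M T S)%:R) <=
  2 ^+ #|T| * expR (K%:R / (2 * d%:R) * ln (#|T|%:R * K%:R / P%:R)).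
Proof.
move=> T0 hT; have T0' : 0 < #|T|%:R :> R by rewrite ltr0n.
apply: le_trans (not_expanding_le (M := M) hT _) _ => [X XT _|]; first exact: subset_leq_card.
set b := expR _; have b0 : 0 <= b by apply: expR_ge0.
apply: le_trans (_ : \sum_(X in powerset T) b <= _); last first.
  by rewrite sumr_const card_powerset -[X in X <= _]mulr_natl natrX.
rewrite (eq_bigl (fun X : {set 'I_n} => (X \in powerset T) && (0 < #|X| <= M)%N)); last first.
  by move=> X; rewrite inE.
rewrite big_mkcondr; apply: ler_sum => X; rewrite inE => XT; case: ifP => // /andP[X0 _].
rewrite /b ler_expR; have X0' : 1 <= #|X|%:R :> R by rewrite ler1n.
have kd : 0 <= K%:R / (2 * d%:R) :> R by rewrite divr_ge0 ?mulr_ge0 ?ltW.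
have XT' : #|X|%:R <= #|T|%:R :> R by rewrite ler_nat subset_leq_card.
have lX : ln (#|X|%:R * K%:R / P%:R) <= ln (#|T|%:R * K%:R / P%:R) :> R.
  rewrite ler_ln ?posrE ?divr_gt0 ?mulr_gt0 //; last by apply: lt_le_trans X0'.
  by rewrite ler_pM2r ?invr_gt0 // ler_pM2r.
have lT : ln (#|T|%:R * K%:R / P%:R) <= 0 :> R.
  apply: ln_le0; apply: le_trans hT _; by rewrite expR_le1 oppr_le0 mulr_ge0 // ltW.
apply: le_trans (ler_wpM2l kd lX).
have := mulr_ge0_le0 kd (le_trans lX lT); set z := _ / _ * ln _ => z0; nra.
Qed.

(** Sets of size [m] number at most [(e n / m) ^ m]; with [pool_bound] they contribute at most
    [delta ^ m], and the series is geometric. *)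
Lemma not_expanding_global (M : nat) (delta : R) : (4 * d <= K)%N ->
  M%:R * K%:R / P%:R <= eta -> expR 1 * (n%:R / P%:R) * expR (- (K%:R / 2)) <= delta ->
  2 * delta <= 1 ->
  Ex kw (fun S => (~~ expanding d M setT S)%:R) <= 2 * delta.
Proof.
move=> dK hM hdelta delta1.
have delta0 : 0 <= delta by apply: le_trans hdelta; rewrite !mulr_ge0 ?expR_ge0 ?invr_ge0 // ltW.
apply: le_trans (not_expanding_le (M := M) hM (fun X _ h => h)) _.
rewrite (partition_big (fun A : {set 'I_n} => inord #|A| : 'I_M.+1) predT) //=.
apply: le_trans (geometric_le M delta0 delta1).
rewrite big_ord_recl /= big1 ?add0r; last first.
  move=> X /andP[/andP[_ /andP[X0 XM]] /eqP/(congr1 val)] /=.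
  by rewrite inordK ?ltnS // => XE; move: X0; rewrite XE.
apply: ler_sum => i _.
set m := i.+1; have m0 : 0 < m%:R :> R by rewrite ltr0n.
have mM : (m <= M)%N by rewrite /m.
pose u : R := m%:R * K%:R / P%:R; have u0 : 0 < u by rewrite divr_gt0 // mulr_gt0.
have lu : ln u <= - (6 * d%:R).
  rewrite -[X in _ <= X]expRK ler_ln ?posrE ?expR_gt0 //; apply: le_trans hM.
  by rewrite ler_pM2r ?invr_gt0 // ler_pM2r // ler_nat.
apply: le_trans (_ : \sum_(X : {set 'I_n} | #|X| == m) expR (m%:R * (K%:R / (2 * d%:R) * ln u)) <= _).
  rewrite big_mkcond [X in _ <= X]big_mkcond; apply: ler_sum => X _.
  case: ifPn => [|_]; last by case: ifP => // _; apply: expR_ge0.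
  move=> /andP[/andP[_ /andP[X0 XM]] /eqP/(congr1 val)] /=.
  by rewrite inordK ?ltnS // /bump /= add1n => XE; rewrite XE eqxx.
rewrite sumr_const.
have -> : #|(fun X : {set 'I_n} => #|X| == m)| = 'C(n, m).
  by rewrite -[in RHS](card_ord n) -card_draws cardsE.
rewrite -[X in X <= _]mulr_natl; apply: le_trans (_ : (expR 1 * (n%:R / m%:R) * expR (K%:R / (2 * d%:R) * ln u)) ^+ m <= _).
  rewrite !exprMn -!expRM_natl mulr1 ler_pM2r ?expR_gt0 //.
  by rewrite -exprMn; apply: bin_le_expR.
apply: lerXn2r; rewrite ?nnegrE ?mulr_ge0 ?expR_ge0 ?divr_ge0 //.
apply: le_trans hdelta; rewrite -![expR 1 * _ * _]mulrA ler_pM2l ?expR_gt0 // -!(mulrA n%:R).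
apply: ler_wpM2l => //.
(* One factor [u] is kept, since its [m] cancels the [1 / m] above. The exponent [z = K / (2 d)] is
   at least 2, so [z - 1 >= z / 2], and [ln u <= - 6 d] yields [3 K / 2]; part of it later absorbs
   the [K] in [u]. *)
have step : expR (K%:R / (2 * d%:R) * ln u) <= u * expR (- (3 / 2 * K%:R)).
  rewrite -[X in _ <= X * _](@lnK R u) ?posrE // -expRD ler_expR.
  have kd : 2 <= K%:R / (2 * d%:R) :> R.
    by rewrite ler_pdivlMr ?mulr_gt0 // mulrA -natrM -natrM ler_nat.
  have kE : K%:R = K%:R / (2 * d%:R) * (2 * d%:R) :> R by rewrite divfK // gt_eqF ?mulr_gt0.
  rewrite [X in _ <= _ - _ * X]kE.
  set z := K%:R / (2 * d%:R) in kd *; set l := ln u in lu *.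
  have zd : 2 * d%:R <= z * d%:R by rewrite ler_pM2r.
  have e1 : (z - 1) * l <= (z - 1) * - (6 * d%:R) by apply: ler_wpM2l => //; lra.
  have -> : 3 / 2 * (z * (2 * d%:R)) = 3 * (z * d%:R) by field.
  move: e1; rewrite mulrBl mul1r mulrN mulrBl mul1r [z * (6 * _)]mulrCA.
  move: zd; set zd := z * d%:R; set zl := z * l => h1 h2; lra.
apply: le_trans (ler_wpM2l _ step) _; first by rewrite invr_ge0 ltW.
rewrite /u mulrA mulrA [m%:R^-1 * _]mulrA mulVf ?gt_eqF // mul1r -mulrA.
rewrite mulrCA ler_pM2l ?invr_gt0 //.
have -> : - (3 / 2 * K%:R) = - (K%:R / 2) + - K%:R :> R by field.
rewrite expRD mulrCA -[X in _ <= X]mulr1 ler_pM2l ?expR_gt0 //.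
rewrite expRN ler_pdivrMr ?expR_gt0 // mul1r.
by apply: le_trans (expR_ge1Dx K%:R); rewrite lerDr.
Qed.

End ExpansionProbability.

Local Open Scope classical_set_scope.
Local Open Scope ring_scope.

(** * Limits of sequences *)

Section Sequences.
Variable R : realType.

Lemma near_nat_ge (A : R) : \forall n \near \oo, A <= n%:R.
Proof. exact: (cvgry_ge cvgr_idn). Qed.

Lemma near_ln_ge (A : R) : \forall n \near \oo, A <= ln (n%:R : R).
Proof.
near=> n.
have h : expR A <= n%:R by near: n; apply: near_nat_ge.
rewrite -[A]expRK ler_ln ?posrE ?expR_gt0 //; apply: lt_le_trans h; exact: expR_gt0.
Unshelve. all: by end_near. Qed.

Lemma ln_nat_infty : (ln (n%:R : R)) @[n --> \oo] --> +oo.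
Proof. by apply/cvgryPge => A; apply: near_ln_ge. Qed.

Lemma infty_comp_ln (u : R^nat) : u n @[n --> \oo] --> +oo -> ln (u n) @[n --> \oo] --> +oo.
Proof.
move=> u_oo; apply/cvgryPge => A; near=> n.
have h : expR A <= u n by near: n; apply: (cvgry_ge u_oo).
rewrite -[A]expRK ler_ln ?posrE ?expR_gt0 //; apply: lt_le_trans h; exact: expR_gt0.
Unshelve. all: by end_near. Qed.

Lemma infty_inv_cvg0 (u : R^nat) : u n @[n --> \oo] --> +oo -> (u n)^-1 @[n --> \oo] --> 0.
Proof. by move=> u_oo; apply/gtr0_cvgV0 => //; apply: (cvgry_gt u_oo). Qed.

Lemma infty_pow_exp (u : R^nat) (C a eps : R) (D : nat) :
  u n @[n --> \oo] --> +oo -> 0 <= C -> 0 < a -> 0 < eps ->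
  \forall n \near \oo, C * u n ^+ D * expR (- (a * u n)) <= eps.
Proof.
move=> u_oo C0 a0 e0; set c := D.+1`!%:R / a ^+ D.+1.
have c0 : 0 < c by rewrite divr_gt0 ?exprn_gt0 // ltr0n fact_gt0.
near=> n.
have u1 : 1 <= u n by near: n; apply: (cvgry_ge u_oo).
have u2 : C * c / eps <= u n by near: n; apply: (cvgry_ge u_oo).
have u0 : 0 < u n by apply: lt_le_trans u1.
rewrite -mulrA; apply: le_trans (ler_wpM2l C0 (pow_expR_le D a0 u0)) _.
by rewrite -/c mulrA ler_pdivrMr // [eps * _]mulrC -ler_pdivrMr.
Unshelve. all: by end_near. Qed.

Lemma ln_over_id_cvg0 (u : R^nat) : u n @[n --> \oo] --> +oo ->
  (ln (u n) / u n) @[n --> \oo] --> 0.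
Proof.
move=> u_oo; have l_oo := infty_comp_ln u_oo.
apply/cvgr0Pnorm_le => eps e0; near=> n.
have u1 : 1 <= u n by near: n; apply: (cvgry_ge u_oo).
have u0 : 0 < u n by apply: lt_le_trans u1.
rewrite ger0_norm ?divr_ge0 ?ln_ge0 ?(ltW u0) //.
have -> : ln (u n) / u n = 1 * ln (u n) ^+ 1 * expR (- (1 * ln (u n))).
  by rewrite !mul1r expr1 expRN lnK.
by near: n; apply: infty_pow_exp.
Unshelve. all: by end_near. Qed.

Lemma cvg_pow (u : R^nat) (l : R) (m : nat) :
  u n @[n --> \oo] --> l -> (u n ^+ m) @[n --> \oo] --> l ^+ m.
Proof. by move=> ul; apply: (@cvg_comp _ _ _ u (fun x : R => x ^+ m) \oo (nbhs l) (nbhs (l ^+ m)) ul); apply: exprn_continuous. Qed.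

End Sequences.

Record regime (R : realType) (k : nat) (K P : nat -> nat) (p alpha : nat -> R) (a : R) : Prop :=
  Regime {
  regime_k : (1 <= k)%N;
  regime_K : forall n : nat, (1 <= n)%N -> (0 < K n)%N;
  regime_KP : forall n : nat, (1 <= n)%N -> (K n <= P n)%N;
  regime_p : forall n : nat, (1 <= n)%N -> 0 <= p n <= 1;
  regime_P : (fun n : nat => (P n)%:R : R) =Omega_\oo (fun n : nat => n%:R : R);
  regime_o : (fun n : nat => (K n)%:R / (P n)%:R : R) =o_\oo (fun _ : nat => 1 : R);
  regime_alpha : forall n : nat, (2 <= n)%N ->
    edge_prob (K n) (P n) (p n) =
    (ln (n%:R : R) + k.-1%:R * ln (ln (n%:R : R)) + alpha n) / n%:R;
  regime_cvg : alpha n @[n --> \oo] --> a }.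

(** * Consequences of the asymptotic assumptions *)

Section Regime.
Variables (R : realType) (k : nat) (K P : nat -> nat) (p alpha : nat -> R) (a : R).
Hypothesis H : regime k K P p alpha a.
Let K_gt0 := regime_K H.
Let K_le_P := regime_KP H.
Let p_prob := regime_p H.
Let P_Omega := regime_P H.
Let KP_o1 := regime_o H.
Let alpha_def := regime_alpha H.
Let alpha_cvg := regime_cvg H.

Definition edge_seq (n : nat) : R := edge_prob (K n) (P n) (p n).
Definition mean_degree (n : nat) : R := n%:R * edge_seq n.
Local Notation q := edge_seq.
Local Notation La := mean_degree.
Local Notation L n := (ln (n%:R : R)).
Local Notation s n := (key_share_prob R (K n) (P n)).

Lemma mean_degreeE : \forall n \near \oo, La n = L n + k.-1%:R * ln (L n) + alpha n.
Proof.
near=> n; have n2 : (2 <= n)%N by near: n; apply: nbhs_infty_ge.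
rewrite /La /q alpha_def // mulrCA divff ?mulr1 // pnatr_eq0; lia.
Unshelve. all: by end_near. Qed.

Lemma alpha_near : \forall n \near \oo, a - 1 <= alpha n <= a + 1.
Proof.
near=> n; apply/andP; split; near: n.
  by apply: (cvgr_ge _ alpha_cvg); lra.
by apply: (cvgr_le _ alpha_cvg); lra.
Unshelve. all: by end_near. Qed.

Lemma mean_degree_infty : La n @[n --> \oo] --> +oo.
Proof.
apply/cvgryPge => A; near=> n.
have -> : La n = L n + k.-1%:R * ln (L n) + alpha n by near: n; apply: mean_degreeE.
have /andP[al _] : a - 1 <= alpha n <= a + 1 by near: n; apply: alpha_near.
have L1 : 1 <= L n by near: n; apply: near_ln_ge.
have LA : A - a + 1 <= L n by near: n; apply: near_ln_ge.
have : 0 <= k.-1%:R * ln (L n) by rewrite mulr_ge0 // ln_ge0.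
by move: (k.-1%:R * ln (L n)) => z z0; lra.
Unshelve. all: by end_near. Qed.

Lemma mean_degree_ratio : (La n / L n) @[n --> \oo] --> (1 : R).
Proof.
have L_oo := @ln_nat_infty R.
have h : (1 + k.-1%:R * (ln (L n) / L n) + alpha n * (L n)^-1) @[n --> \oo] -->
   1 + k.-1%:R * 0 + a * 0.
  apply: cvgD; first apply: cvgD; first exact: cvg_cst.
    by apply: cvgMl_tmp; apply: ln_over_id_cvg0.
  by apply: cvgM => //; apply: infty_inv_cvg0.
rewrite !mulr0 !addr0 in h; apply: cvg_trans h; apply: near_eq_cvg; near=> n.
have -> : La n = L n + k.-1%:R * ln (L n) + alpha n by near: n; apply: mean_degreeE.
have L1 : 1 <= L n by near: n; apply: near_ln_ge.
have L0 : L n != 0 by rewrite gt_eqF //; lra.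
by rewrite !mulrDl divff // mulrA.
Unshelve. all: by end_near. Qed.

(** The exact link between [n] and [expR (La n)]. The term [(k - 1) ln ln n] of the edge probability
    becomes the power of [ln n], and the limit of the right-hand side is the source of
    [expR (- a)]. *)
Lemma exp_mean_degree :
  \forall n \near \oo, n%:R * expR (- La n) * L n ^+ k.-1 = expR (- alpha n).
Proof.
near=> n.
have -> : La n = L n + k.-1%:R * ln (L n) + alpha n by near: n; apply: mean_degreeE.
have L1 : 1 <= L n by near: n; apply: near_ln_ge.
have L0 : 0 < L n by lra.
have n0 : 0 < n%:R :> R by rewrite ltr0n; near: n; apply: nbhs_infty_gt.
rewrite !opprD !expRD [expR (- ln n%:R)]expRN lnK ?posrE // !mulrA divff ?gt_eqF // mul1r.
rewrite -mulrN expRM_natl [expR (- ln (ln _))]expRN lnK ?posrE // exprVn mulrAC mulVf ?mul1r //.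
by rewrite expf_neq0 // gt_eqF.
Unshelve. all: by end_near. Qed.

Lemma nat_le_exp : \forall n \near \oo, n%:R <= expR (1 - a) * expR (La n).
Proof.
near=> n.
have E : n%:R * expR (- La n) * L n ^+ k.-1 = expR (- alpha n) by near: n; apply: exp_mean_degree.
have /andP[al _] : a - 1 <= alpha n <= a + 1 by near: n; apply: alpha_near.
have L1 : 1 <= L n by near: n; apply: near_ln_ge.
rewrite -ler_pdivrMr ?expR_gt0 // -expRN; apply: le_trans (_ : expR (- alpha n) <= _).
  by rewrite -E ler_peMr ?mulr_ge0 ?expR_ge0 // exprn_ege1.
by rewrite ler_expR; lra.
Unshelve. all: by end_near. Qed.

Lemma L_le_twice : \forall n \near \oo, L n <= 2 * La n.
Proof.
near=> n.
have L1 : 1 <= L n by near: n; apply: near_ln_ge.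
have : 2^-1 <= La n / L n by near: n; apply: (cvgr_ge _ mean_degree_ratio); lra.
by rewrite ler_pdivlMr; [move=> h; lra|lra].
Unshelve. all: by end_near. Qed.

(** With [nat_le_exp], all powers of [n] can be traded for exponentials of [La n], so that each
    error becomes a polynomial times a decaying exponential in one variable. *)
Lemma inv_nat_le : \forall n \near \oo,
  n%:R^-1 <= expR (a + 1) * 2 ^+ k.-1 * La n ^+ k.-1 * expR (- La n).
Proof.
near=> n.
have E : n%:R * expR (- La n) * L n ^+ k.-1 = expR (- alpha n) by near: n; apply: exp_mean_degree.
have /andP[_ al] : a - 1 <= alpha n <= a + 1 by near: n; apply: alpha_near.
have L1 : 1 <= L n by near: n; apply: near_ln_ge.
have L2 : L n <= 2 * La n by near: n; apply: L_le_twice.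
have n0 : 0 < n%:R :> R by rewrite ltr0n; near: n; apply: nbhs_infty_gt.
have -> : n%:R^-1 = expR (alpha n) * L n ^+ k.-1 * expR (- La n).
  have : expR (alpha n) * (n%:R * expR (- La n) * L n ^+ k.-1) = 1.
    by rewrite E -expRD subrr expR0.
  have n0' : n%:R != 0 :> R by rewrite gt_eqF.
  by move=> h; apply: (mulfI n0'); rewrite divff // -[LHS]h; ring.
rewrite ler_pM2r ?expR_gt0 // -mulrA -exprMn; apply: ler_pM; rewrite ?expR_ge0 ?exprn_ge0 //.
- by lra.
- by rewrite ler_expR.
- by apply: lerXn2r; rewrite ?nnegrE //; lra.
Unshelve. all: by end_near. Qed.

Lemma small_over_nat (C eps : R) (D : nat) : 0 <= C -> 0 < eps ->
  \forall n \near \oo, C * La n ^+ D / n%:R <= eps.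
Proof.
move=> C0 e0; near=> n.
have i : n%:R^-1 <= expR (a + 1) * 2 ^+ k.-1 * La n ^+ k.-1 * expR (- La n).
  by near: n; apply: inv_nat_le.
have La1 : 1 <= La n by near: n; apply: (cvgry_ge mean_degree_infty).
have La0 : 0 <= La n by lra.
apply: le_trans (ler_wpM2l _ i) _; first by rewrite mulr_ge0 // exprn_ge0.
have -> : C * La n ^+ D * (expR (a + 1) * 2 ^+ k.-1 * La n ^+ k.-1 * expR (- La n)) =
   (C * (expR (a + 1) * 2 ^+ k.-1)) * La n ^+ (D + k.-1) * expR (- (1 * La n)).
  by rewrite exprD mul1r; ring.
near: n; apply: infty_pow_exp => //; first exact: mean_degree_infty.
by rewrite !mulr_ge0 ?expR_ge0 // exprn_ge0.
Unshelve. all: by end_near. Qed.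

Lemma small_edge (C eps : R) : 0 <= C -> 0 < eps -> \forall n \near \oo, C * q n <= eps.
Proof.
move=> C0 e0; near=> n.
have n0 : 0 < n%:R :> R by rewrite ltr0n; near: n; apply: nbhs_infty_gt.
have -> : C * q n = C * La n ^+ 1 / n%:R by rewrite expr1 /La; field; rewrite gt_eqF.
by near: n; apply: small_over_nat.
Unshelve. all: by end_near. Qed.

Lemma pool_linear : exists2 c : R, 0 < c & \forall n \near \oo, c * n%:R <= (P n)%:R.
Proof.
move: P_Omega; rewrite eqOmegaE qualifE => /asboolP[c c0 h]; exists c => //.
by apply: filterS h => n; rewrite !ger0_norm.
Qed.

Lemma key_ratio_small (eps : R) : 0 < eps -> \forall n \near \oo, (K n)%:R <= eps * (P n)%:R.
Proof.
move=> e0; have /eqoP/(_ _ e0) h := KP_o1; near=> n.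
have n1 : (1 <= n)%N by near: n; apply: nbhs_infty_ge.
have P0 : 0 < (P n)%:R :> R by rewrite ltr0n; apply: leq_trans (K_le_P n1); apply: K_gt0.
rewrite -ler_pdivrMr //.
have : `|(K n)%:R / (P n)%:R| <= eps * `|1 : R| by near: n.
by rewrite normr1 mulr1; apply: le_trans; apply: ler_norm.
Unshelve. all: by end_near. Qed.

Lemma key_ratio_nat (d : nat) : (0 < d)%N -> \forall n \near \oo, (d * K n < P n)%N.
Proof.
move=> d0; near=> n.
have n1 : (1 <= n)%N by near: n; apply: nbhs_infty_ge.
have K0 := K_gt0 n1.
have : (K n)%:R <= (2 * d%:R)^-1 * (P n)%:R :> R.
  by near: n; apply: key_ratio_small; rewrite invr_gt0 mulr_gt0 // ltr0n.
rewrite mulrC ler_pdivlMr ?mulr_gt0 ?ltr0n // -!natrM ler_nat; nia.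
Unshelve. all: by end_near. Qed.

(** From [c n <= P] and [q <= s <= 2 K^2 / P] follows [c La <= 2 K^2], and [La] diverges. *)
Lemma K_infty : ((K n)%:R : R) @[n --> \oo] --> +oo.
Proof.
have [c c0 hc] := pool_linear.
apply/cvgryPge => A0; set A := Num.max A0 1; near=> n.
have n1 : (1 <= n)%N by near: n; apply: nbhs_infty_ge.
have K0 := K_gt0 n1; have [p0 p1] := andP (p_prob n1).
have KP4 : (4 * K n < P n)%N by near: n; apply: key_ratio_nat.
have KP2 : (2 * K n < P n)%N by lia.
have P0 : 0 < (P n)%:R :> R by rewrite ltr0n; lia.
have cP : c * n%:R <= (P n)%:R by near: n.
have LaA : 2 * A ^+ 2 / c <= La n by near: n; apply: (cvgry_ge mean_degree_infty).
have A1 : 1 <= A by rewrite /A le_max lexx orbT.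
apply: le_trans (_ : A <= _); first by rewrite /A le_max lexx.
have sy := share_le_twice R K0 KP2 (ltnW KP4).
have qs : q n <= s n by rewrite /q /edge_prob ler_piMl // key_share_ge0.
rewrite -(@ler_pXn2r _ 2) ?nnegrE //; last by lra.
have h1 : 2 * A ^+ 2 <= c * La n by rewrite [c * _]mulrC -ler_pdivrMr.
have h2 : c * La n <= (P n)%:R * q n.
  by rewrite /La mulrA; apply: ler_wpM2r => //; apply: edge_prob_ge0; rewrite ?p0 ?p1 //; lia.
have h3 : (P n)%:R * q n <= (P n)%:R * (2 * ((K n)%:R ^+ 2 / (P n)%:R)).
  by rewrite ler_pM2l //; apply: le_trans qs sy.
have e : (P n)%:R * (2 * ((K n)%:R ^+ 2 / (P n)%:R)) = 2 * (K n)%:R ^+ 2 :> R by field; rewrite gt_eqF.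
by rewrite e in h3; have := le_trans h1 (le_trans h2 h3); rewrite ler_pM2l.
Unshelve. all: by end_near. Qed.

(** * Expansion at a fixed precision *)

Section FixedExpansion.
Variable d : nat.
Hypothesis d0 : (0 < d)%N.
Local Notation eta := (expR (- (6 * d%:R)) : R).

(** The largest size to which [pool_bound] applies. *)
Definition threshold (n : nat) : nat := Num.truncn (eta * (P n)%:R / (K n)%:R).
Local Notation M := threshold.

Lemma threshold_spec : \forall n \near \oo,
  [/\ (0 < M n)%N, (M n)%:R * (K n)%:R / (P n)%:R <= eta &
      eta * (P n)%:R / (K n)%:R <= 2 * (M n)%:R].
Proof.
near=> n.
have n1 : (1 <= n)%N by near: n; apply: nbhs_infty_ge.
have K0 : 0 < (K n)%:R :> R by rewrite ltr0n; apply: K_gt0.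
have P0 : 0 < (P n)%:R :> R by apply: lt_le_trans K0 _; rewrite ler_nat; apply: K_le_P.
set x := eta * (P n)%:R / (K n)%:R.
have x1 : 1 <= x.
  by rewrite ler_pdivlMr // mul1r; near: n; apply: key_ratio_small; apply: expR_gt0.
have x0 : 0 <= x by lra.
have /andP[lo up] := truncn_itv x0; rewrite -/(M n) in lo up.
have M0 : (0 < M n)%N by rewrite /M truncn_gt0.
split=> //.
  by rewrite ler_pdivrMr // -ler_pdivlMr.
have M1 : 1 <= (M n)%:R :> R by rewrite ler1n.
by move: up; rewrite -natr1 => up; lra.
Unshelve. all: by end_near. Qed.

(** Up to constants [s] is at least [min(1, y)] with [y = K^2 / P], and [M] is about [P / K]. The
    product is of order [P / K] when [y >= 1], and [K] otherwise; both diverge. *)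
Lemma share_threshold_infty (A : R) : \forall n \near \oo, A <= s n * (M n)%:R.
Proof.
near=> n.
have n1 : (1 <= n)%N by near: n; apply: nbhs_infty_ge.
have K0n := K_gt0 n1.
have K0 : 0 < (K n)%:R :> R by rewrite ltr0n.
have P0 : 0 < (P n)%:R :> R by apply: lt_le_trans K0 _; rewrite ler_nat; apply: K_le_P.
have KP2 : (2 * K n < P n)%N by near: n; apply: key_ratio_nat.
have [_ _ hM] : [/\ (0 < M n)%N, (M n)%:R * (K n)%:R / (P n)%:R <= eta &
      eta * (P n)%:R / (K n)%:R <= 2 * (M n)%:R] by near: n; apply: threshold_spec.
have KA : 4 * Num.max A 1 / eta <= (K n)%:R by near: n; apply: (cvgry_ge K_infty).
have PA : (K n)%:R <= eta / (4 * Num.max A 1) * (P n)%:R.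
  near: n; apply: key_ratio_small; rewrite divr_gt0 ?expR_gt0 // mulr_gt0 //.
  by rewrite lt_max ltr01 orbT.
set B := Num.max A 1 in KA PA *; have B1 : 1 <= B by rewrite /B le_max lexx orbT.
have B0 : 0 < B by lra.
have e0 : 0 < eta by apply: expR_gt0.
apply: le_trans (_ : B <= _); first by rewrite /B le_max lexx.
set y := (K n)%:R ^+ 2 / (P n)%:R : R.
have y0 : 0 <= y by rewrite divr_ge0 ?exprn_ge0 // ltW.
have sy : Num.min 1 y / 2 <= s n.
  by apply: le_trans (onem_expR_ge y0) (share_ge_expR R K0n KP2).
have x0 : 0 <= eta * (P n)%:R / (K n)%:R by rewrite divr_ge0 ?mulr_ge0 ?ltW.
have m0 : 0 <= Num.min 1 y / 2 by rewrite divr_ge0 // le_min ler01 y0.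
have : Num.min 1 y / 2 * (eta * (P n)%:R / (K n)%:R) <= s n * (2 * (M n)%:R) by apply: ler_pM.
suff : 2 * B <= Num.min 1 y / 2 * (eta * (P n)%:R / (K n)%:R).
  move=> h1 h2; have := le_trans h1 h2; rewrite mulrCA ler_pM2l //.
have [y1|y1] := leP 1 y.
  move: PA; rewrite mulrAC ler_pdivlMr ?mulr_gt0 // => h.
  rewrite !mulrA ler_pdivlMr //.
  have -> : 1 / 2 * eta * (P n)%:R = eta * (P n)%:R / 2 by ring.
  rewrite ler_pdivlMr //; apply: le_trans h.
  by rewrite le_eqVlt; apply/orP; left; apply/eqP; ring.
have -> : y / 2 * (eta * (P n)%:R / (K n)%:R) = eta * (K n)%:R / 2.
  by rewrite /y; field; rewrite !gt_eqF.
rewrite ler_pdivlMr //; move: KA; rewrite ler_pdivrMr // => h.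
by rewrite [X in _ <= X]mulrC; apply: le_trans h; rewrite le_eqVlt; apply/orP; left; apply/eqP; ring.
Unshelve. all: by end_near. Qed.

Lemma attach_near : \forall n \near \oo,
  forall (T : {set 'I_n}) (S : {ffun 'I_n -> key_set (K n) (P n)}),
  #|T|%:R * q n <= 9 -> expanding d (M n) T S ->
  pat_law (p n) T S finset.set0 <= expR (- ((1 - 3 / d%:R) * (#|T|%:R * q n))).
Proof.
near=> n => T S Tq eS.
have n1 : (1 <= n)%N by near: n; apply: nbhs_infty_ge.
have [M0 _ _] : [/\ (0 < M n)%N, (M n)%:R * (K n)%:R / (P n)%:R <= eta &
      eta * (P n)%:R / (K n)%:R <= 2 * (M n)%:R] by near: n; apply: threshold_spec.
apply: (@attach_bound R n (K n) (P n) (p n) d (M n)) => //.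
- exact: K_gt0.
- exact: p_prob.
- by near: n; apply: key_ratio_nat; rewrite muln_gt0.
- set B := 9 * _ * _.
  have B0 : 0 <= B by rewrite !mulr_ge0 ?expR_ge0.
  have h : Num.max B 1 <= s n * (M n)%:R by near: n; apply: share_threshold_infty.
  have h1 : 1 <= s n * (M n)%:R by apply: le_trans h; rewrite le_max lexx orbT.
  have h2 : B <= s n * (M n)%:R by apply: le_trans h; rewrite le_max lexx.
  by rewrite expr2; move: h1 h2; move: (s n * (M n)%:R) => z h1 h2; nra.
Unshelve. all: by end_near. Qed.

(** The power [m + 1] beats the factor [n ^ m] of the scaled moment. Large [K] gives it directly
    through [ln u <= - 6 d]; small [K] makes [u] itself a negative power of [n]. *)
Lemma not_expanding_fixed_near (m : nat) : (0 < m)%N -> \forall n \near \oo,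
  forall T : {set 'I_n}, #|T| = m ->
  Ex (@kw R n (K n) (P n)) (fun S => (~~ expanding d (M n) T S)%:R) <= n%:R^-1 ^+ m.+1.
Proof.
move=> m0; have [c c0 hc] := pool_linear.
near=> n => T Tm.
have n1 : (1 <= n)%N by near: n; apply: nbhs_infty_ge.
have K0n := K_gt0 n1.
have K0 : 0 < (K n)%:R :> R by rewrite ltr0n.
have P0 : 0 < (P n)%:R :> R by apply: lt_le_trans K0 _; rewrite ler_nat; apply: K_le_P.
have m0' : 0 < m%:R :> R by rewrite ltr0n.
have d0' : 0 < d%:R :> R by rewrite ltr0n.
have n0 : 0 < n%:R :> R by rewrite ltr0n.
have mK : m%:R * (K n)%:R / (P n)%:R <= eta.
  rewrite -mulrA mulrC -ler_pdivlMr // ler_pdivrMr //.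
  by near: n; apply: key_ratio_small; rewrite divr_gt0 ?expR_gt0 ?ltr0n.
apply: le_trans (@not_expanding_fixed R n (K n) (P n) d K0n (K_le_P n1) d0 (M n) T _ _) _; rewrite Tm //.
set u := m%:R * (K n)%:R / (P n)%:R : R; have u0 : 0 < u by rewrite divr_gt0 // mulr_gt0.
have lu : ln u <= - (6 * d%:R) by rewrite -[X in _ <= X]expRK ler_ln ?posrE ?expR_gt0.
have n2m : 2 ^+ m <= n%:R :> R by near: n; apply: near_nat_ge.
have L0 : 0 <= L n by rewrite ln_ge0 // ler1n.
(* One power more than needed: the extra [n] pays for [2 ^ m]. *)
suff h : (K n)%:R / (2 * d%:R) * ln u <= - (m.+2%:R * L n).
  apply: le_trans (_ : n%:R * expR (- (m.+2%:R * L n)) <= _).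
    by apply: ler_pM; rewrite ?exprn_ge0 ?expR_ge0 // ler_expR.
  by rewrite expRN expRM_natl lnK ?posrE // [n%:R ^+ _]exprS invfM mulrA divff ?gt_eqF // mul1r exprVn.
have [hK|hK] := leP (m.+2%:R * L n) (K n)%:R.
  apply: le_trans (_ : (K n)%:R / (2 * d%:R) * - (6 * d%:R) <= _).
    by apply: ler_wpM2l => //; rewrite divr_ge0 ?mulr_ge0 ?ltW.
  have -> : (K n)%:R / (2 * d%:R) * - (6 * d%:R) = - (3 * (K n)%:R) :> R by field; rewrite gt_eqF.
  by rewrite lerN2; apply: le_trans hK _; lra.
(* Here [K < (m + 2) ln n], so [u] is at most a constant times [ln n / n], below [n^(-1/2)]
   eventually. *)
have lu2 : ln u <= - (L n / 2).
  have L1 : 1 <= L n by near: n; apply: near_ln_ge.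
  have cP : c * n%:R <= (P n)%:R by near: n.
  rewrite -[X in _ <= X]expRK ler_ln ?posrE ?expR_gt0 // /u ler_pdivrMr //.
  have e1 : 1 * L n ^+ 1 * expR (- (2^-1 * L n)) <= c / (m%:R * m.+2%:R).
    near: n; apply: infty_pow_exp => //; first exact: ln_nat_infty.
    by rewrite divr_gt0 // mulr_gt0 // ltr0n.
  have e2 : expR (- (L n / 2)) * n%:R = expR (L n / 2).
    by rewrite -[X in _ * X](@lnK R n%:R) ?posrE // -expRD; congr expR; lra.
  have e3 : L n * (m%:R * m.+2%:R) <= c * expR (L n / 2).
    move: e1; rewrite mul1r expr1 expRN ler_pdivrMr ?expR_gt0 // mulrAC.
    by rewrite ler_pdivlMr ?mulr_gt0 ?ltr0n // [2^-1 * _]mulrC.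
  apply: le_trans (_ : expR (- (L n / 2)) * (c * n%:R) <= _); last first.
    by rewrite ler_pM2l ?expR_gt0.
  rewrite mulrCA e2.
  apply: le_trans e3; rewrite [X in _ <= X]mulrC -mulrA ler_pM2l //; exact: ltW.
have K4 : 4 * d%:R * m.+2%:R <= (K n)%:R :> R by near: n; apply: (cvgry_ge K_infty).
apply: le_trans (_ : (K n)%:R / (2 * d%:R) * - (L n / 2) <= _).
  by apply: ler_wpM2l => //; rewrite divr_ge0 ?mulr_ge0 ?ltW.
rewrite mulrN lerN2.
have -> : (K n)%:R / (2 * d%:R) * (L n / 2) = (K n)%:R / (4 * d%:R) * L n.
  by field; rewrite gt_eqF.
by apply: ler_wpM2r => //; rewrite ler_pdivlMr ?mulr_gt0 // mulrC.
Unshelve. all: by end_near. Qed.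

Lemma not_expanding_global_near (eps : R) : 0 < eps -> \forall n \near \oo,
  Ex (@kw R n (K n) (P n)) (fun S => (~~ expanding d (M n) finset.setT S)%:R) <= eps.
Proof.
move=> e0; have [c c0 hc] := pool_linear; set delta := Num.min eps 1 / 2.
have dl0 : 0 < delta by rewrite divr_gt0 // lt_min e0 ltr01.
near=> n.
have n1 : (1 <= n)%N by near: n; apply: nbhs_infty_ge.
have K0n := K_gt0 n1.
have K0 : 0 < (K n)%:R :> R by rewrite ltr0n.
have P0 : 0 < (P n)%:R :> R by apply: lt_le_trans K0 _; rewrite ler_nat; apply: K_le_P.
have n0 : 0 < n%:R :> R by rewrite ltr0n.
have [_ hM _] : [/\ (0 < M n)%N, (M n)%:R * (K n)%:R / (P n)%:R <= eta &
      eta * (P n)%:R / (K n)%:R <= 2 * (M n)%:R] by near: n; apply: threshold_spec.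
apply: le_trans (_ : 2 * delta <= _); last first.
  by rewrite /delta mulrC divfK // ge_min lexx.
apply: not_expanding_global => //.
- exact: K_le_P.
- have : (4 * d)%N%:R <= (K n)%:R :> R by near: n; apply: (cvgry_ge K_infty).
  by rewrite ler_nat.
- have cP : c * n%:R <= (P n)%:R by near: n.
  have h : expR 1 / c * (K n)%:R ^+ 0 * expR (- (2^-1 * (K n)%:R)) <= delta.
    near: n; apply: infty_pow_exp => //; first exact: K_infty.
    by rewrite divr_ge0 ?expR_ge0 // ltW.
  apply: le_trans h; rewrite expr0 mulr1 [2^-1 * _]mulrC ler_pM2r ?expR_gt0 //.
  rewrite ler_pM2l ?expR_gt0 // ler_pdivrMr // mulrC ler_pdivlMr // mulrC //.
- by rewrite /delta mulrC divfK // ge_min lexx orbT.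
Unshelve. all: by end_near. Qed.

End FixedExpansion.

End Regime.

(** * Asymptotics of binomial coefficients *)

Section BinomialRatios.
Variable R : realType.

Lemma expR_cvg1 (u : R^nat) : u n @[n --> \oo] --> (0 : R) -> expR (u n) @[n --> \oo] --> (1 : R).
Proof.
move=> u0; rewrite -(@expR0 R).
by apply: (@cvg_comp _ _ _ u expR \oo (nbhs 0) (nbhs (expR 0)) u0); apply: continuous_expR.
Qed.

Lemma cvg_mul (u v : R^nat) (x y : R) : u n @[n --> \oo] --> x -> v n @[n --> \oo] --> y ->
  (u n * v n) @[n --> \oo] --> x * y.
Proof. by move=> hu hv; apply: cvgM. Qed.

Lemma inv_nat_cvg0 : (n%:R^-1 : R) @[n --> \oo] --> (0 : R).
Proof. by apply: infty_inv_cvg0; exact: cvgr_idn. Qed.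

Lemma shift_ratio_cvg1 (j : nat) : ((n - j)%:R / n%:R : R) @[n --> \oo] --> (1 : R).
Proof.
have h : (1 - j%:R * n%:R^-1 : R) @[n --> \oo] --> 1 - j%:R * (0 : R).
  by apply: cvgB; [exact: cvg_cst | apply: cvgMl_tmp; apply: inv_nat_cvg0].
rewrite mulr0 subr0 in h; apply: cvg_trans h; apply: near_eq_cvg; near=> n.
have jn : (j <= n)%N by near: n; apply: nbhs_infty_ge.
have n0 : (0 < n)%N by near: n; apply: nbhs_infty_gt.
by rewrite natrB // mulrBl divff // pnatr_eq0 -lt0n.
Unshelve. all: by end_near. Qed.

Lemma ffact_ratio_cvg1 (m d : nat) : (((n - m) ^_ d)%:R / n%:R ^+ d : R) @[n --> \oo] --> (1 : R).
Proof.
elim: d => [|d IH].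
  apply: cvg_near_cst; near=> n; by rewrite ffactn0 expr0 divr1.
have h := cvg_mul IH (@shift_ratio_cvg1 (m + d)); rewrite mulr1 in h.
apply: cvg_trans h; apply: near_eq_cvg; near=> n => /=.
by rewrite ffactnSr exprSr natrM subnDA invfM mulrACA.
Unshelve. all: by end_near. Qed.

Lemma bin_ratio_cvg (m d : nat) :
  ('C(n - m, d)%:R / n%:R ^+ d : R) @[n --> \oo] --> (d`!%:R^-1 : R).
Proof.
have h : (((n - m) ^_ d)%:R / n%:R ^+ d * d`!%:R^-1 : R) @[n --> \oo] --> 1 * (d`!%:R^-1 : R).
  by apply: cvgMr_tmp; apply: ffact_ratio_cvg1.
rewrite mul1r in h; apply: cvg_trans h; apply: near_eq_cvg; near=> n => /=.
by rewrite -bin_ffact natrM mulrAC mulfK // pnatr_eq0 -lt0n fact_gt0.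
Unshelve. all: by end_near. Qed.

End BinomialRatios.

(** * Poisson limit of the binomial lower tail *)

Section Limits.
Variables (R : realType) (k : nat) (K P : nat -> nat) (p alpha : nat -> R) (a : R).
Hypothesis H : regime k K P p alpha a.
Let k_ge1 := regime_k H.
Let K_le_P := regime_KP H.
Let p_prob := regime_p H.

Local Notation q := (edge_seq K P p).
Local Notation La := (mean_degree K P p).
Local Notation L n := (ln (n%:R : R)).
Local Notation lam := (expR (- a) / (k.-1)`!%:R).

Let La_oo : La n @[n --> \oo] --> +oo := mean_degree_infty H.

Let q_ge0 n : (1 <= n)%N -> 0 <= q n.
Proof. by move=> n1; apply: edge_prob_ge0; apply: p_prob. Qed.

Lemma cvg_small_over_nat (C : R) (D : nat) : 0 <= C ->
  (C * La n ^+ D / n%:R) @[n --> \oo] --> (0 : R).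
Proof.
move=> C0; apply/cvgr0Pnorm_le => e e0; near=> n.
have La1 : 1 <= La n by near: n; apply: (cvgry_ge La_oo).
rewrite ger0_norm; last by rewrite divr_ge0 // mulr_ge0 // exprn_ge0 //; lra.
by near: n; apply: (small_over_nat H).
Unshelve. all: by end_near. Qed.

Lemma cvg_edge (C : R) : 0 <= C -> (C * q n) @[n --> \oo] --> (0 : R).
Proof.
move=> C0; apply/cvgr0Pnorm_le => e e0; near=> n.
have n1 : (1 <= n)%N by near: n; apply: nbhs_infty_ge.
rewrite ger0_norm; last by rewrite mulr_ge0 // q_ge0.
by near: n; apply: (small_edge H).
Unshelve. all: by end_near. Qed.

(** The exponent is [- La n] up to [n q ^ 2 = La ^ 2 / n] on one side and [j q] on the other, and
    both vanish. *)
Lemma pow_onem_ratio (j : nat) :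
  ((1 - q n) ^+ (n - j) * expR (La n)) @[n --> \oo] --> (1 : R).
Proof.
have up : expR (j%:R * q n) @[n --> \oo] --> (1 : R) by apply: expR_cvg1; apply: cvg_edge.
have lo : expR (- (2 * La n ^+ 2 / n%:R)) @[n --> \oo] --> (1 : R).
  apply: expR_cvg1; rewrite -[X in _ --> X]oppr0; apply: cvgN.
  by apply: cvg_small_over_nat.
apply: squeeze_cvgr lo up; near=> n.
have n1 : (1 <= n)%N by near: n; apply: nbhs_infty_ge.
have jn : (j <= n)%N by near: n; apply: nbhs_infty_ge.
have q0 : 0 <= q n by apply: q_ge0.
have q2 : 1 * q n <= 2^-1 by near: n; apply: (small_edge H) => //; lra.
rewrite mul1r in q2; have n0 : n%:R != 0 :> R by rewrite pnatr_eq0; lia.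
apply/andP; split.
  apply: le_trans (_ : (1 - q n) ^+ n * expR (La n) <= _); last first.
    rewrite ler_pM2r ?expR_gt0 //; apply: ler_wiXn2l; rewrite ?leq_subr //; lra.
  apply: le_trans (_ : expR (- (q n / (1 - q n))) ^+ n * expR (La n) <= _); last first.
    rewrite ler_pM2r ?expR_gt0 //; apply: lerXn2r; rewrite ?nnegrE ?expR_ge0 //; first by lra.
    by apply: onem_ge_expR; lra.
  rewrite -expRM_natl -expRD ler_expR /La.
  have -> : 2 * (n%:R * q n) ^+ 2 / n%:R = n%:R * (2 * q n ^+ 2) by field.
  have hq : q n / (1 - q n) <= q n + 2 * q n ^+ 2.
    rewrite ler_pdivrMr; last by lra.
    by rewrite expr2; move: q0 q2; move: (q n) => x q0 q2; nra.
  have := ler_wpM2l (ler0n R n) hq; rewrite mulrDr mulrN.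
  move: (n%:R * (q n / _)) (n%:R * q n) (n%:R * (2 * _)) => x y z; lra.
rewrite -[X in _ <= expR X](_ : - ((n - j)%:R * q n) + La n = _); last first.
  by rewrite natrB // /La; ring.
rewrite expRD ler_pM2r ?expR_gt0 //; apply: onem_pow_le; lra.
Unshelve. all: by end_near. Qed.

(** By [exp_mean_degree] the term carries [(ln n) ^ (d - (k - 1))] times convergent factors, so only
    [d = k - 1] survives. *)
Lemma bin_term_cvg (m d : nat) : (d < k)%N ->
  (n%:R * ('C(n - m, d)%:R * q n ^+ d * (1 - q n) ^+ (n - m - d))) @[n --> \oo] -->
  (if d == k.-1 then lam else 0 : R).
Proof.
move=> dk; have dk1 : (d <= k.-1)%N by lia.
have h1 := @bin_ratio_cvg R m d.
have h2 := @pow_onem_ratio (m + d).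
have h3 : expR (- alpha n) @[n --> \oo] --> expR (- a).
  apply: (@cvg_comp _ _ _ (fun n => - alpha n) expR \oo (nbhs (- a)) (nbhs (expR (- a)))).
    exact: cvgN (regime_cvg H).
  exact: continuous_expR.
have h4 := @cvg_pow R _ _ d (mean_degree_ratio H).
have h5 := @cvg_pow R _ _ (k.-1 - d) (infty_inv_cvg0 (@ln_nat_infty R)).
have h6 := cvg_mul (cvg_mul (cvg_mul h1 h2) h3) (cvg_mul h4 h5).
have -> : (if d == k.-1 then lam else 0) =
    (d`!%:R^-1 * 1 * expR (- a)) * (1 ^+ d * 0 ^+ (k.-1 - d)) :> R.
  rewrite mulr1 expr1n mul1r; case: eqP => [->|/eqP ne].
    by rewrite subnn expr0 mulr1 mulrC.
  by rewrite expr0n subn_eq0 leqNgt ltn_neqAle ne dk1 /= mulr0.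
apply: cvg_trans h6; apply: near_eq_cvg; near=> n => /=.
have E : n%:R * expR (- La n) * L n ^+ k.-1 = expR (- alpha n).
  by near: n; apply: (exp_mean_degree H).
have L1 : 1 <= L n by near: n; apply: near_ln_ge.
have n0 : 0 < n%:R :> R by rewrite ltr0n; near: n; apply: nbhs_infty_gt.
rewrite -E -subnDA -[X in L n ^+ X](subnKC dk1) exprD expr_div_n exprVn expRN.
rewrite [La n ^+ d]exprMn.
have e0 : expR (La n) != 0 by rewrite gt_eqF ?expR_gt0.
have A0 : L n ^+ d != 0 by rewrite expf_neq0 // gt_eqF //; lra.
have B0 : L n ^+ (k.-1 - d) != 0 by rewrite expf_neq0 // gt_eqF //; lra.
have N0 : n%:R ^+ d != 0 :> R by rewrite expf_neq0 // gt_eqF.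
move: e0 A0 B0 N0; move: (expR (La n)) (L n ^+ d) (L n ^+ (k.-1 - d)) (n%:R ^+ d : R).
move=> e A B N e0 A0 B0 N0; field; rewrite e0 A0 B0 N0; exact.
Unshelve. all: by end_near. Qed.

Lemma bin_low_cvg (m : nat) :
  (n%:R * bin_low k (q n) (n - m)) @[n --> \oo] --> (lam : R).
Proof.
have -> : lam = \sum_(d < k) (if d == k.-1 :> nat then lam else 0) :> R.
  have kk : (k.-1 < k)%N by lia.
  rewrite (bigD1 (Ordinal kk)) //= eqxx big1 ?addr0 // => d /negPf dk.
  by rewrite -[d == _ :> nat]/(d == Ordinal kk) dk.
have h : (\sum_(d < k) (n%:R * ('C(n - m, d)%:R * q n ^+ d * (1 - q n) ^+ (n - m - d))))
    @[n --> \oo] --> (\sum_(d < k) (if d == k.-1 :> nat then lam else 0) : R).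
  apply: cvg_big => [|d _]; last by apply: bin_term_cvg.
  exact: add_continuous.
apply: cvg_trans h; apply: near_eq_cvg; near=> n.
by rewrite /bin_low mulr_sumr.
Unshelve. all: by end_near. Qed.

End Limits.

(** * Binomial moments of the number of low-degree nodes *)

Section Moments.
Variables (R : realType) (k : nat) (K P : nat -> nat) (p alpha : nat -> R) (a : R).
Hypothesis H : regime k K P p alpha a.
Let k_ge1 := regime_k H.
Let K_le_P := regime_KP H.
Let p_prob := regime_p H.

Local Notation q := (edge_seq K P p).
Local Notation La := (mean_degree K P p).
Local Notation lam := (expR (- a) / (k.-1)`!%:R).

Let La_oo : La n @[n --> \oo] --> +oo := mean_degree_infty H.

Let q_ge0 n : (1 <= n)%N -> 0 <= q n.
Proof. by move=> n1; apply: edge_prob_ge0; apply: p_prob. Qed.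

Definition low_moment (n : nat) (T : {set 'I_n}) : R :=
  EE (p n) (fun (S : {ffun 'I_n -> key_set (K n) (P n)}) c => (T \subset low_set k S c)%:R).

(** The crowded term of [moment_upper] at [eta = 1 / La]. Up to powers of [La], the three factors
    are [expR (m La)], [expR (- (m - 1/2) La)] and [1/n], that is [expR (- La)]; what remains is
    [expR (- La / 2)]. *)
Lemma moment_tail_small (m : nat) (eps : R) : (0 < m)%N -> 0 < eps -> \forall n \near \oo,
  n%:R ^+ m * ((m * k).+1%:R * (m.+1%:R * La n) ^+ (m * k) *
   expR (- ((1 - 3 / (6 * m)%:R) * (m%:R * q n))) ^+ (n - m - m * k) *
   (n%:R * m%:R ^+ 2 * q n ^+ 2 / (La n)^-1)) <= eps.
Proof.
move=> m0 e0.
set C1 := expR (1 - a); set C2 := expR (a + 1) * 2 ^+ k.-1.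
set C := C1 ^+ m * ((m * k).+1%:R * m.+1%:R ^+ (m * k) * expR 1 * m%:R ^+ 2) * C2.
have C10 : 0 < C1 by apply: expR_gt0.
have C20 : 0 < C2 by rewrite mulr_gt0 ?expR_gt0 ?exprn_gt0.
near=> n.
have n1 : (1 <= n)%N by near: n; apply: nbhs_infty_ge.
have n0 : 0 < n%:R :> R by rewrite ltr0n.
have m0' : 0 < m%:R :> R by rewrite ltr0n.
have La1 : 1 <= La n by near: n; apply: (cvgry_ge La_oo).
have La0 : 0 < La n by lra.
have nn : (m + m * k <= n)%N by near: n; apply: nbhs_infty_ge.
have hn : n%:R <= C1 * expR (La n) by near: n; apply: (nat_le_exp H).
have hi : n%:R^-1 <= C2 * La n ^+ k.-1 * expR (- La n) by near: n; apply: (inv_nat_le H).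
have hq : (m%:R * (m + m * k)%:R) * q n <= 1.
  by near: n; apply: (small_edge H).
have q0 : 0 <= q n by apply: q_ge0.
set c := 1 - 3 / (6 * m)%:R.
(* The purpose of [d = 6 m]: over [m] nodes the loss [3 / d] adds up to exactly [1/2]. *)
have cm : c * m%:R = m%:R - 2^-1.
  by rewrite /c natrM; field; rewrite gt_eqF.
have c1 : c <= 1 by rewrite /c gerBl divr_ge0.
have hexp : expR (- (c * (m%:R * q n))) ^+ (n - m - m * k) <= expR 1 * expR (- ((m%:R - 2^-1) * La n)).
  rewrite -expRM_natl -expRD ler_expR -subnDA natrB //.
  have -> : (n%:R - (m + m * k)%:R) * - (c * (m%:R * q n)) =
     - ((c * m%:R) * (n%:R * q n)) + c * ((m%:R * (m + m * k)%:R) * q n) by ring.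
  rewrite cm addrC lerD2r; apply: le_trans hq; rewrite ler_piMl //.
  by apply: mulr_ge0 => //; apply: mulr_ge0.
have hpow : n%:R ^+ m <= C1 ^+ m * expR (m%:R * La n).
  by rewrite expRM_natl -exprMn; apply: lerXn2r; rewrite ?nnegrE // ?mulr_ge0 ?expR_ge0 // ltW.
have hq2 : n%:R * m%:R ^+ 2 * q n ^+ 2 / (La n)^-1 <=
    m%:R ^+ 2 * La n ^+ 3 * (C2 * La n ^+ k.-1 * expR (- La n)).
  have -> : n%:R * m%:R ^+ 2 * q n ^+ 2 / (La n)^-1 = m%:R ^+ 2 * La n ^+ 3 * n%:R^-1.
    by rewrite invrK /mean_degree; field; rewrite gt_eqF.
  by apply: ler_wpM2l => //; rewrite mulr_ge0 // exprn_ge0 // ltW.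
apply: le_trans (_ : C * La n ^+ (m * k + 3 + k.-1) * expR (- (2^-1 * La n)) <= _); last first.
  near: n; apply: infty_pow_exp => //; rewrite ?invr_gt0 //.
  by rewrite !mulr_ge0 ?exprn_ge0 ?expR_ge0 // ltW.
have A0 : 0 <= (m * k).+1%:R * (m.+1%:R * La n) ^+ (m * k) :> R.
  by rewrite mulr_ge0 // exprn_ge0 // mulr_ge0 // ltW.
have B0 : 0 <= n%:R * m%:R ^+ 2 * q n ^+ 2 / (La n)^-1.
  rewrite invrK; apply: mulr_ge0; last exact: ltW.
  apply: mulr_ge0; last exact: exprn_ge0.
  by apply: mulr_ge0 => //; apply: exprn_ge0.
apply: le_trans (_ : (C1 ^+ m * expR (m%:R * La n)) * ((m * k).+1%:R * (m.+1%:R * La n) ^+ (m * k) *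
   (expR 1 * expR (- ((m%:R - 2^-1) * La n))) *
   (m%:R ^+ 2 * La n ^+ 3 * (C2 * La n ^+ k.-1 * expR (- La n)))) <= _).
  apply: ler_pM hpow _; first by apply: exprn_ge0.
    by apply: mulr_ge0 => //; apply: mulr_ge0 => //; rewrite exprn_ge0 ?expR_ge0.
  apply: ler_pM hq2 => //; first by apply: mulr_ge0 => //; rewrite exprn_ge0 ?expR_ge0.
  exact: ler_wpM2l.
rewrite le_eqVlt; apply/orP; left; apply/eqP.
have -> : - (2^-1 * La n) = m%:R * La n + (- ((m%:R - 2^-1) * La n)) + (- La n).
  by field.
rewrite !expRD exprMn !exprD /C; ring.
Unshelve. all: by end_near. Qed.

(** [eta = 1 / La] tends to 0, so the comparison is sharp in the limit, yet so slowly that Markov's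
    inequality loses only a factor [La]. The bound is uniform in [T], as it will be summed over all
    sets of size [m]. *)
Lemma low_moment_upper (m : nat) : (0 < m)%N -> exists2 u : R^nat, u n @[n --> \oo] --> (lam ^+ m : R) &
  forall eps : R, 0 < eps -> \forall n \near \oo, forall T : {set 'I_n}, #|T| = m ->
    n%:R ^+ m * low_moment T <= u n + eps.
Proof.
move=> m0.
pose u n : R := (1 - 2 * (La n)^-1)^-1 * expR (2 * (La n)^-1) * (1 - m%:R * q n)^-1 ^+ (m * k) *
   (n%:R * bin_low k (q n) (n - m)) ^+ m.
have iLa := infty_inv_cvg0 La_oo.
have iLa2 : (2 * (La n)^-1) @[n --> \oo] --> (0 : R).
  by rewrite -[X in _ --> X](mulr0 2); apply: cvgMl_tmp.
exists u.
  rewrite -[lam ^+ m]mul1r -[X in X * _](expr1n _ (m * k)) -{1}[1]mul1r.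
  apply: cvg_mul; last by apply: cvg_pow; apply: (bin_low_cvg H).
  rewrite mul1r -[1 ^+ (m * k)]mul1r; apply: cvg_mul; last first.
    apply: cvg_pow; rewrite -[X in _ --> X]invr1; apply: cvgV; first exact: oner_neq0.
    by rewrite -[X in _ --> X]subr0; apply: cvgB; [exact: cvg_cst | apply: (cvg_edge H)].
  rewrite -[X in _ --> X]mulr1; apply: cvg_mul; last exact: expR_cvg1.
  rewrite -[X in _ --> X]invr1; apply: cvgV; first exact: oner_neq0.
  by rewrite -[X in _ --> X]subr0; apply: cvgB; [exact: cvg_cst | exact: iLa2].
have d0 : (0 < 6 * m)%N by rewrite muln_gt0.
move=> eps e0; near=> n => T Tm.
have n1 : (1 <= n)%N by near: n; apply: nbhs_infty_ge.
have n0 : 0 < n%:R :> R by rewrite ltr0n.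
have m0' : 0 < m%:R :> R by rewrite ltr0n.
have La4 : 4 <= La n by near: n; apply: (cvgry_ge La_oo).
have q0 : 0 <= q n by apply: q_ge0.
have mq : 2 * (m%:R * q n) <= 1.
  by rewrite mulrA; near: n; apply: (small_edge H).
have mq9 : m%:R * q n <= 9 by move: mq; move: (m%:R * q n) => x; lra.
have att : forall (T : {set 'I_n}) (S : {ffun 'I_n -> key_set (K n) (P n)}),
  #|T|%:R * q n <= 9 -> expanding (6 * m) (threshold R K P (6 * m) n) T S ->
  pat_law (p n) T S finset.set0 <= expR (- ((1 - 3 / (6 * m)%:R) * (#|T|%:R * q n))).
  by near: n; apply: (attach_near H d0).
have := @moment_upper R n (K n) (P n) (p n) k (K_le_P n1) (p_prob n1) T n1.
rewrite Tm => /(_ mq (expanding (6 * m) (threshold R K P (6 * m) n) T) (La n)^-1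
   (expR (- ((1 - 3 / (6 * m)%:R) * (m%:R * q n)))) (m.+1%:R * La n)).
have iLa4 : (La n)^-1 <= 4^-1 by rewrite lef_pV2 ?posrE //; lra.
have iLa0 : 0 < (La n)^-1 by rewrite invr_gt0; lra.
move=> /(_ iLa0) h; have {h}h := h _ (expR_ge0 _).
have {}h := h _ _ _.
have h1 : 2 * (La n)^-1 < 1 by lra.
have h2 : 1 <= m.+1%:R * La n.
  by apply: le_trans (_ : La n <= _); [lra | rewrite ler_peMl ?ler1n //; lra].
have h3 : n%:R * (m%:R * edge_prob (K n) (P n) (p n)) <= m.+1%:R * La n.
  by rewrite mulrCA /mean_degree ler_wpM2r ?ler_nat // mulr_ge0.
have {}h := h h1 h2 h3.
have h4 : forall S : {ffun 'I_n -> key_set (K n) (P n)},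
   expanding (6 * m) (threshold R K P (6 * m) n) T S ->
   pat_law (p n) T S finset.set0 <= expR (- ((1 - 3 / (6 * m)%:R) * (m%:R * q n))).
  by move=> S eS; have := att T S; rewrite Tm => /(_ mq9 eS).
have {}h := h h4; rewrite -/(low_moment T) in h.
have nm0 : 0 <= n%:R ^+ m :> R by apply: exprn_ge0.
apply: le_trans (ler_wpM2l nm0 h) _; rewrite !mulrDr -addrA; apply: lerD.
  rewrite /u exprMn.
  have F0 : 0 <= bin_low k (q n) (n - m) ^+ m.
    apply/exprn_ge0/sumr_ge0 => d _; rewrite !mulr_ge0 ?exprn_ge0 // subr_ge0.
    exact: edge_prob_le1 (K_le_P n1) (p_prob n1).
  rewrite [X in X <= _]mulrCA mulrA -!mulrA; apply: ler_wpM2l; first by rewrite invr_ge0; lra.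
  have y0 : 0 <= (La n)^-1 / n%:R by rewrite divr_ge0 // ltW.
  rewrite [X in X <= _]mulrCA; apply: ler_pM.
  - by apply: exprn_ge0; rewrite addr_ge0 // mulr_ge0.
  - apply: mulr_ge0 => //; apply: mulr_ge0 => //; apply: exprn_ge0; rewrite invr_ge0.
    by move: mq; rewrite /edge_seq; move: (m%:R * _) => x; lra.
  - apply: le_trans (_ : expR (2 * ((La n)^-1 / n%:R)) ^+ n <= _).
      apply: lerXn2r; rewrite ?nnegrE ?expR_ge0 ?expR_ge1Dx //.
      by rewrite addr_ge0 // mulr_ge0.
    by rewrite -expRM_natl (_ : n%:R * _ = 2 * (La n)^-1) //; field; rewrite !gt_eqF //; lra.
  - by rewrite [X in X <= _]mulrCA.
have t1 : n%:R ^+ m * ((m * k).+1%:R * (m.+1%:R * La n) ^+ (m * k) *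
   expR (- ((1 - 3 / (6 * m)%:R) * (m%:R * q n))) ^+ (n - m - m * k) *
   (n%:R * m%:R ^+ 2 * q n ^+ 2 / (La n)^-1)) <= eps / 2.
  by near: n; apply: moment_tail_small; rewrite ?divr_gt0.
have t2 : forall T : {set 'I_n}, #|T| = m ->
  Ex (@kw R n (K n) (P n)) (fun S => (~~ expanding (6 * m) (threshold R K P (6 * m) n) T S)%:R)
   <= n%:R^-1 ^+ m.+1.
  by near: n; apply: (not_expanding_fixed_near H d0).
have t3 : 2 / eps <= n%:R by near: n; apply: near_nat_ge.
rewrite [eps in _ <= eps]splitr; apply: lerD => //.
apply: le_trans (ler_wpM2l nm0 (t2 T Tm)) _.
rewrite exprSr mulrA -exprMn divff ?gt_eqF // expr1n mul1r.
by rewrite -[eps / 2]invrK lef_pV2 ?posrE ?invr_gt0 ?divr_gt0 // invf_div.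
Unshelve. all: by end_near. Qed.

(** Again [eta = 1 / La], which forces [zeta = 1 / La ^ 2] in [moment_lower]. Crowded keys are
    simply discarded, so no expansion enters. *)
Lemma low_moment_lower (m : nat) : (0 < m)%N -> exists2 u : R^nat, u n @[n --> \oo] --> (lam ^+ m : R) &
  \forall n \near \oo, forall T : {set 'I_n}, #|T| = m -> u n <= n%:R ^+ m * low_moment T.
Proof.
move=> m0.
pose u n : R := (1 - m%:R ^+ 2 * q n - m%:R ^+ 2 * La n ^+ 3 / n%:R) *
  (1 - 2 * m%:R ^+ 2 * La n ^+ 2 / n%:R) * expR (- (2 * m%:R ^+ 2 * La n ^+ 2 / n%:R)) *
  (1 - (La n)^-1 ^+ 2) ^+ (m * k) * (n%:R * bin_low k (q n) (n - m)) ^+ m.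
have m20 : 0 <= m%:R ^+ 2 :> R by apply: exprn_ge0.
have iLa := infty_inv_cvg0 La_oo.
exists u.
  have -> : lam ^+ m = (1 - 0 - 0) * (1 - 0) * expR (- 0) * (1 - 0 ^+ 2) ^+ (m * k) * lam ^+ m :> R.
    by rewrite oppr0 expR0 !addr0 expr0n /= oppr0 addr0 expr1n !mul1r.
  apply: cvg_mul; last by apply: cvg_pow; apply: (bin_low_cvg H).
  apply: cvg_mul; last first.
    by apply: cvg_pow; apply: cvgB; [exact: cvg_cst | apply: cvg_pow].
  apply: cvg_mul; last first.
    rewrite oppr0 expR0; apply: expR_cvg1; rewrite -[X in _ --> X]oppr0; apply: cvgN.
    by apply: (cvg_small_over_nat H); rewrite mulr_ge0.
  apply: cvg_mul; last first.
    by apply: cvgB; [exact: cvg_cst | apply: (cvg_small_over_nat H); rewrite mulr_ge0].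
  apply: cvgB; last exact: (cvg_small_over_nat H).
  by apply: cvgB; [exact: cvg_cst | exact: (cvg_edge H)].
near=> n => T Tm.
have n1 : (1 <= n)%N by near: n; apply: nbhs_infty_ge.
have n0 : 0 < n%:R :> R by rewrite ltr0n.
have m0' : 0 < m%:R :> R by rewrite ltr0n.
have La4 : 4 <= La n by near: n; apply: (cvgry_ge La_oo).
have La0 : 0 < La n by lra.
have q0 : 0 <= q n by apply: q_ge0.
have mq : 2 * (m%:R * q n) <= 1.
  by rewrite mulrA; near: n; apply: (small_edge H).
have := @moment_lower R n (K n) (P n) (p n) k (K_le_P n1) (p_prob n1) T n1.
rewrite Tm => /(_ mq (La n)^-1 ((La n)^-1 ^+ 2)) h.
have iLa4 : (La n)^-1 <= 4^-1 by rewrite lef_pV2 ?posrE //; lra.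
have iLa0 : 0 < (La n)^-1 by rewrite invr_gt0; lra.
have z1 : (La n)^-1 ^+ 2 < 1 by rewrite expr2; move: iLa4 iLa0; move: (La n)^-1 => x; nra.
have ez : (La n)^-1 = (La n)^-1 ^+ 2 * (n%:R * edge_prob (K n) (P n) (p n)).
  by rewrite -/(edge_seq K P p n) -/(La n) expr2 -mulrA mulVf ?mulr1 // gt_eqF.
have E1 : n%:R * m%:R ^+ 2 * edge_prob (K n) (P n) (p n) ^+ 2 / (La n)^-1 =
    m%:R ^+ 2 * La n ^+ 3 / n%:R.
  by rewrite invrK /mean_degree /edge_seq; field; rewrite gt_eqF.
have E2 : 2 * n%:R * m%:R ^+ 2 * edge_prob (K n) (P n) (p n) ^+ 2 = 2 * m%:R ^+ 2 * La n ^+ 2 / n%:R.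
  by rewrite /mean_degree /edge_seq; field; rewrite gt_eqF.
rewrite E1 E2 in h.
have s1 : m%:R ^+ 2 * q n <= 2^-1.
  by near: n; apply: (small_edge H) => //; rewrite invr_gt0.
have s2 : m%:R ^+ 2 * La n ^+ 3 / n%:R <= 2^-1.
  by near: n; apply: (small_over_nat H) => //; rewrite invr_gt0.
have s3 : 2 * m%:R ^+ 2 * La n ^+ 2 / n%:R <= 1.
  by near: n; apply: (small_over_nat H) => //; rewrite mulr_ge0.
have {}h := h iLa0 ez (exprn_ge0 2 (ltW iLa0)) z1.
have {}h : (1 - m%:R ^+ 2 * q n - m%:R ^+ 2 * La n ^+ 3 / n%:R) *
   ((1 - 2 * m%:R ^+ 2 * La n ^+ 2 / n%:R) * bin_low k (q n) (n - m) ^+ m) <=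
   (1 + 2 * m%:R ^+ 2 * q n ^+ 2) ^+ n * (1 - (La n)^-1 ^+ 2)^-1 ^+ (m * k) * low_moment T.
  apply: h => //; rewrite -/(q n).
  by move: s1 s2; move: (m%:R ^+ 2 * q n) (m%:R ^+ 2 * La n ^+ 3 / n%:R) => x y; lra.
have c1 : (1 + 2 * m%:R ^+ 2 * q n ^+ 2) ^+ n <= expR (2 * m%:R ^+ 2 * La n ^+ 2 / n%:R).
  have -> : 2 * m%:R ^+ 2 * La n ^+ 2 / n%:R = n%:R * (2 * m%:R ^+ 2 * q n ^+ 2).
    by rewrite /mean_degree; field; rewrite gt_eqF.
  rewrite expRM_natl; apply: lerXn2r; rewrite ?nnegrE ?expR_ge0 ?expR_ge1Dx //.
  by rewrite addr_ge0 // mulr_ge0 ?exprn_ge0 // mulr_ge0.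
set w := 1 - (La n)^-1 ^+ 2 in h *; have w0 : 0 < w by rewrite /w subr_gt0.
have lm0 : 0 <= low_moment T.
  apply: Ex_ge0 => [i|i x|S]; first exact: kw1 (K_le_P n1) _.
    exact: kw0.
  by apply: Ex_ge0 => [e|e b|c //]; [exact: cw1 | exact: cw0 (p_prob n1) _ _].
rewrite /u [(n%:R * bin_low _ _ _) ^+ m]exprMn -/w; set X := 2 * m%:R ^+ 2 * La n ^+ 2 / n%:R in h c1 *.
set Y := 1 - _ - _ in h *; set F := bin_low k _ _ in h *.
have eW : 0 < expR (- X) * w ^+ (m * k) by rewrite mulr_gt0 ?expR_gt0 ?exprn_gt0.
have -> : Y * (1 - X) * expR (- X) * w ^+ (m * k) * (n%:R ^+ m * F ^+ m) =
   n%:R ^+ m * ((expR (- X) * w ^+ (m * k)) * (Y * ((1 - X) * F ^+ m))) by ring.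
apply: ler_wpM2l; first by apply: exprn_ge0.
apply: le_trans (ler_wpM2l (ltW eW) h) _.
rewrite mulrA -[X in _ <= X]mul1r; apply: ler_wpM2r => //.
have -> : expR (- X) * w ^+ (m * k) * ((1 + 2 * m%:R ^+ 2 * q n ^+ 2) ^+ n * w^-1 ^+ (m * k)) =
   expR (- X) * (1 + 2 * m%:R ^+ 2 * q n ^+ 2) ^+ n * (w * w^-1) ^+ (m * k) by rewrite [(w / w) ^+ _]exprMn mulrACA.
rewrite divff ?gt_eqF // expr1n mulr1 expRN mulrC ler_pdivrMr ?expR_gt0 // mul1r.
exact: c1.
Unshelve. all: by end_near. Qed.

End Moments.

Lemma sum_by_card (R : numDomainType) (n : nat) (Q : pred nat) (b : nat -> R) :
  \sum_(T : {set 'I_n} | Q #|T|) b #|T| = \sum_(r < n.+1 | Q r) 'C(n, r)%:R * b r.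
Proof.
have cT (T : {set 'I_n}) : (#|T| < n.+1)%N by rewrite ltnS -[X in (_ <= X)%N]card_ord max_card.
rewrite (partition_big (fun T : {set 'I_n} => inord #|T| : 'I_n.+1) (fun r : 'I_n.+1 => Q r)) /=.
  apply: eq_bigr => r Qr.
  rewrite (eq_bigl (fun T : {set 'I_n} => T \in [set A : {set 'I_n} | #|A| == r]%SET)).
    transitivity (\sum_(T in [set A : {set 'I_n} | #|A| == r]%SET) b r).
      by apply: eq_bigr => T; rewrite finset.in_set => /eqP ->.
    by rewrite sumr_const card_draws card_ord mulr_natl.
  move=> T; rewrite finset.inE -val_eqE /= inordK //.
  by case: eqP => [->|]; rewrite ?Qr ?andbF.
by move=> T QT; rewrite inordK.
Qed.

(** The power [r ^ r] produced by the cut bound for sets of size [r] is cancelled by the factorial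
    in the number of such sets. *)
Lemma bin_self_pow (R : realType) (n r : nat) :
  'C(n, r)%:R * r%:R ^+ r <= (expR 1 * n%:R) ^+ r :> R.
Proof.
have h : r%:R ^+ r <= r`!%:R * expR 1 ^+ r :> R.
  have := @pow_fact_le_expR R r; rewrite ler_pdivrMr ?ltr0n ?fact_gt0 // mulrC.
  by rewrite -[in expR r%:R](mulr1 r%:R) expRM_natl.
rewrite exprMn; apply: le_trans (ler_wpM2l (ler0n _ _) h) _.
by rewrite mulrA mulrC; apply: ler_wpM2l; [rewrite exprn_ge0 ?expR_ge0 | apply: bin_le_pow].
Qed.

Lemma geometric_from2_le (R : realType) (d : R) (n : nat) : 0 <= d -> 2 * d <= 1 ->
  \sum_(r < n.+1 | (1 < r)%N) d ^+ r <= 2 * d ^+ 2.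
Proof.
move=> d0 d1; rewrite big_mkcond big_ord_recl /= add0r.
case: n => [|n]; first by rewrite big_ord0 mulr_ge0 ?exprn_ge0.
rewrite big_ord_recl /= add0r.
rewrite (eq_bigr (fun i : 'I_n => d * d ^+ i.+1)); last by move=> i _; rewrite -exprS.
by rewrite -mulr_sumr expr2 mulrCA; apply: ler_wpM2l => //; apply: geometric_le.
Qed.

(** * Small cuts are unlikely *)

Section CutSum.
Variables (R : realType) (k : nat) (K P : nat -> nat) (p alpha : nat -> R) (a : R).
Hypothesis H : regime k K P p alpha a.
Let k_ge1 := regime_k H.
Let K_le_P := regime_KP H.
Let p_prob := regime_p H.

Local Notation q := (edge_seq K P p).
Local Notation La := (mean_degree K P p).
Local Notation M := (threshold R K P 12).

Let La_oo : La n @[n --> \oo] --> +oo := mean_degree_infty H.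

Let q_ge0 n : (1 <= n)%N -> 0 <= q n.
Proof. by move=> n1; apply: edge_prob_ge0; apply: p_prob. Qed.

Definition cut_prob (n : nat) (T : {set 'I_n}) : R :=
  EE (p n) (fun (S : {ffun 'I_n -> key_set (K n) (P n)}) c =>
    (expanding 12 (M n) T S && no_isolated T S c)%:R *
    (#|touched (pattern T S c)| <= k.-1)%N%:R).

(** Costs per node: [2 ^ (k - 1)] bounds [r ^ (k - 1)], [expR 8] pays for the missing [r + k - 1]
    nodes in the exponent, and 6 is [2 * c0] in [no_isolated_bound] with [c0 = 3]. *)
Local Notation G := (2 ^+ k.-1 * expR 8 * 6 : R).

Lemma cut_prob_small : \forall n \near \oo, forall T : {set 'I_n},
  (1 < #|T|)%N -> (2 * #|T| <= n)%N -> #|T|%:R * q n <= 9 ->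
  cut_prob T <= 2 * k%:R * La n ^+ k.-1 *
    (G * expR (- (3 / 4 * La n)) * Num.sqrt (q n) * #|T|%:R) ^+ #|T|.
Proof.
have d0 : (0 < 12)%N by [].
near=> n => T T1 Tn Tq.
have n1 : (1 <= n)%N by near: n; apply: nbhs_infty_ge.
have nk : (2 * k <= n)%N by near: n; apply: nbhs_infty_ge.
have La1 : 1 <= La n by near: n; apply: (cvgry_ge La_oo).
have La0 : 0 < La n by lra.
have q0 : 0 <= q n by apply: q_ge0.
have hq : k%:R * q n <= 1 by near: n; apply: (small_edge H).
have att : forall (T : {set 'I_n}) (S : {ffun 'I_n -> key_set (K n) (P n)}),
  #|T|%:R * q n <= 9 -> expanding 12 (M n) T S ->
  pat_law (p n) T S finset.set0 <= expR (- ((1 - 3 / 12%:R) * (#|T|%:R * q n))).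
  by near: n; apply: (attach_near H d0).
have dep : depends_on T (fun S : {ffun 'I_n -> key_set (K n) (P n)} => expanding 12 (M n) T S).
  exact: expanding_dep.
set r := #|T| in T1 Tn Tq *.
have r1 : 1 <= r%:R :> R by rewrite ler1n ltnW.
have rq0 : 0 <= r%:R * q n by apply: mulr_ge0.
pose phi := expR (- (3 / 4 * (r%:R * q n))).
have hphi (S : {ffun 'I_n -> key_set (K n) (P n)}) : expanding 12 (M n) T S ->
    pat_law (p n) T S finset.set0 <= phi.
  move=> eS; have := att T S Tq eS; rewrite -/r /phi.
  by rewrite (_ : 1 - 3 / 12%:R = 3 / 4 :> R) //; field.
have z1 : 1 <= r%:R * La n by apply: le_trans (_ : La n <= _) => //; rewrite ler_peMl // ltW.
have hz : n%:R * (r%:R * edge_prob (K n) (P n) (p n)) <= r%:R * La n by rewrite mulrCA.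
have h1 : cut_prob T <= _ := @cut_term_small R n (K n) (P n) (p n) (K_le_P n1) (p_prob n1) T _ phi _ k.-1
  dep (expR_ge0 _) z1 hz hphi.
rewrite -/r in h1.
set t := Num.sqrt (r%:R * q n).
have t2 : t ^+ 2 = r%:R * edge_prob (K n) (P n) (p n) by rewrite sqr_sqrtr.
have t3 : t <= 3.
  by rewrite -(@ler_pXn2r _ 2) ?nnegrE ?sqrtr_ge0 // t2; apply: le_trans Tq _; lra.
have h2 := @no_isolated_bound R n (K n) (P n) (p n) (K_le_P n1) (p_prob n1) T t 3
  (sqrtr_ge0 _) t2 (ler1n _ 3) t3.
rewrite -/r in h2.
have tr : t <= r%:R * Num.sqrt (q n).
  rewrite /t sqrtrM ?ler0n //; apply: ler_wpM2r; first exact: sqrtr_ge0.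
  rewrite -(@ler_pXn2r _ 2) ?nnegrE ?sqrtr_ge0 // sqr_sqrtr ?ler0n // expr2 ler_peMr //.
(* [(r + k - 1) q <= 9 + 1], and [3/4] of 10 is below 8. *)
have hexp : phi ^+ (n - r - k.-1) <= (expR 8 * expR (- (3 / 4 * La n))) ^+ r.
  rewrite /phi -expRD -!expRM_natl ler_expR -subnDA natrB; last first.
    by move: nk Tn; move: (r) => x; clear; lia.
  have rk : (r + k.-1)%:R * q n <= 10.
    apply: le_trans (_ : (r + k)%:R * q n <= _); first by apply: ler_wpM2r; rewrite // ler_nat leq_add2l leq_pred.
    by rewrite natrD mulrDl; move: Tq hq; move: (r%:R * q n) (k%:R * q n) => x y; lra.
  have -> : (n%:R - (r + k.-1)%:R) * - (3 / 4 * (r%:R * q n)) =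
    r%:R * (3 / 4 * ((r + k.-1)%:R * q n) - 3 / 4 * (n%:R * q n)) by ring.
  apply: ler_wpM2l => //; rewrite -/(La n).
  by move: rk; move: ((r + k.-1)%:R * q n) (La n) => x y; lra.
have hr : r%:R ^+ k.-1 <= (2 ^+ k.-1) ^+ r :> R.
  by rewrite -exprM mulnC exprM; apply: lerXn2r; rewrite ?nnegrE // -natrX ler_nat ltnW // ltn_expl.
apply: le_trans h1 _; rewrite prednK //.
have -> : 2 * k%:R * La n ^+ k.-1 * (G * expR (- (3 / 4 * La n)) * Num.sqrt (q n) * r%:R) ^+ r =
  (k%:R * ((2 ^+ k.-1) ^+ r * La n ^+ k.-1)) * (expR 8 * expR (- (3 / 4 * La n))) ^+ r *
  (2 * (2 * 3 * (r%:R * Num.sqrt (q n))) ^+ r).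
  have -> : G * expR (- (3 / 4 * La n)) * Num.sqrt (q n) * r%:R =
    2 ^+ k.-1 * (expR 8 * expR (- (3 / 4 * La n))) * (2 * 3 * (r%:R * Num.sqrt (q n))) by ring.
  have key (x y z w : R) : 2 * k%:R * w * (x * y * z) ^+ r =
    (k%:R * (x ^+ r * w)) * y ^+ r * (2 * z ^+ r) by rewrite !(exprMn r); ring.
  exact: key.
have s0 := sqrtr_ge0 (q n); have tt0 : 0 <= t by apply: sqrtr_ge0.
apply: ler_pM.
- by rewrite !mulr_ge0 ?exprn_ge0 ?expR_ge0 // mulr_ge0 // ltW.
- apply: Ex_ge0 => [i|i x|S]; [exact: kw1 (K_le_P n1) _ | exact: kw0 |].
  by apply: Ex_ge0 => [e|e b|c //]; [exact: cw1 | exact: cw0 (p_prob n1) _ _].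
- apply: ler_pM hexp; rewrite ?exprn_ge0 ?expR_ge0 //.
    by rewrite mulr_ge0 // exprn_ge0 // mulr_ge0 // ltW.
  rewrite exprMn; apply: ler_wpM2l => //; apply: ler_wpM2r => //.
  by rewrite exprn_ge0 // ltW.
- apply: le_trans h2 _; apply: ler_wpM2l => //; apply: lerXn2r; rewrite ?nnegrE.
  + by rewrite mulr_ge0.
  + by rewrite mulr_ge0 // mulr_ge0.
  + exact: ler_wpM2l.
Unshelve. all: by end_near. Qed.

(** A node missing [T] misses every subset, and one of suitable size is missed with probability at
    most [1/64]. As [T] has at most half of the nodes, [2 ^ n * 64 ^ (- n / 2) = 4 ^ (- n)], which
    outweighs the [2 ^ n] choices of [T]. *)
Lemma cut_prob_large : \forall n \near \oo, forall T : {set 'I_n},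
  (2 * #|T| <= n)%N -> 9 < #|T|%:R * q n -> cut_prob T <= 64 ^+ k * 4^-1 ^+ n.
Proof.
have d0 : (0 < 12)%N by [].
near=> n => T Tn Tq.
have n1 : (1 <= n)%N by near: n; apply: nbhs_infty_ge.
have q0 : 0 <= q n by apply: q_ge0.
have q1 : 1 * q n <= 1 by near: n; apply: (small_edge H).
rewrite mul1r in q1.
have qp : 0 < q n.
  by rewrite lt_neqAle q0 andbT; apply: contraTneq Tq => <-; rewrite mulr0 -leNgt.
have att : forall (T : {set 'I_n}) (S : {ffun 'I_n -> key_set (K n) (P n)}),
  #|T|%:R * q n <= 9 -> expanding 12 (M n) T S ->
  pat_law (p n) T S finset.set0 <= expR (- ((1 - 3 / 12%:R) * (#|T|%:R * q n))).
  by near: n; apply: (attach_near H d0).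
have dep : depends_on T (fun S : {ffun 'I_n -> key_set (K n) (P n)} => expanding 12 (M n) T S).
  exact: expanding_dep.
(* The largest size to which [attach_near] applies; rounding costs at most [q <= 1], so [s q >= 8]
   and the exponent is at least [3/4 * 8 = 6]. *)
pose s := Num.truncn (9 / q n).
have x0 : 0 <= 9 / q n by rewrite divr_ge0.
have /andP[lo up] := truncn_itv x0; rewrite -/s in lo up.
have s9 : s%:R * q n <= 9 by rewrite -ler_pdivlMr.
have s8 : 8 <= s%:R * q n.
  move: up; rewrite ltr_pdivrMr // -[s.+1%:R]natr1 mulrDl mul1r.
  by move: (s%:R * q n) => y; lra.
have sT : (s <= #|T|)%N.
  by rewrite -(ler_nat R); apply: le_trans lo _; rewrite ler_pdivrMr // ltW.
have c0 : (#|finset.set0 : {set 'I_n}| <= s)%N by rewrite cards0.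
have [T' [_ T'T T's]] := intermediate_set (sub0set T) c0 sT.
have hphi (S : {ffun 'I_n -> key_set (K n) (P n)}) : expanding 12 (M n) T S ->
    pat_law (p n) T S finset.set0 <= 64^-1.
  move=> eS; apply: le_trans (pat_law0_mono (p_prob n1) S T'T) _.
  have := att T' S; rewrite T's => /(_ s9 (expanding_mono T'T eS)) h; apply: le_trans h _.
  apply: le_trans (_ : expR (- 6) <= _).
    by rewrite ler_expR; move: s8; move: (s%:R * q n) => y; lra.
  rewrite expRN lef_pV2 ?posrE ?expR_gt0 //.
  have -> : 6 = 6%:R * 1 :> R by rewrite mulr1.
  rewrite expRM_natl; have e2 : 2 <= expR 1 :> R by apply: le_trans (expR_ge1Dx 1); lra.
  apply: le_trans (_ : 2 ^+ 6 <= _); first by rewrite -natrX ler_nat.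
  by apply: lerXn2r; rewrite ?nnegrE ?expR_ge0.
have i64 : 0 <= 64^-1 :> R by rewrite invr_ge0.
have h : cut_prob T <= _ := @cut_term_large R n (K n) (P n) (p n) (K_le_P n1) (p_prob n1) T _ _ k.-1
  dep i64 hphi.
apply: le_trans h _.
rewrite !exprVn ler_pdivlMr ?exprn_gt0 // mulrAC ler_pdivrMr ?exprn_gt0 //.
rewrite -!natrX -!natrM ler_nat -expnMn -expnD (_ : 64 = 8 ^ 2)%N // -expnM.
by rewrite (_ : 2 * 4 = 8)%N // leq_exp2l //; move: Tn k_ge1; move: #|T| => x; clear; lia.
Unshelve. all: by end_near. Qed.

(** For [#|T| q <= 9], summing over the sets of size [r] gives a geometric series of ratio about
    [n sqrt q expR (- 3/4 La)]. Up to powers of [La], [n sqrt q] is at most [expR (La / 2)], so the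
    ratio decays like [expR (- La / 4)]. *)
Lemma cut_sum_small (eps : R) : 0 < eps -> \forall n \near \oo,
  \sum_(T : {set 'I_n} | (1 < #|T|)%N && (2 * #|T| <= n)%N) cut_prob T <= eps.
Proof.
move=> e0.
pose C1 := expR (1 - a); pose Be := G * expR 1 * (1 + C1).
have C10 : 0 < C1 by apply: expR_gt0.
have G0 : 0 < G by rewrite !mulr_gt0 ?exprn_gt0 ?expR_gt0.
have Be0 : 0 < Be by rewrite !mulr_gt0 ?expR_gt0 //; lra.
have q14 : 0 < 4^-1 :> R by rewrite invr_gt0.
have q12 : 0 < 2^-1 :> R by rewrite invr_gt0.
have Be0' := ltW Be0.
have C30 : 0 <= 4 * k%:R * Be ^+ 2 by rewrite mulr_ge0 ?exprn_ge0 // mulr_ge0.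
have e20 : 0 < eps / 2 by rewrite divr_gt0.
near=> n.
have n1 : (1 <= n)%N by near: n; apply: nbhs_infty_ge.
have n0 : 0 < n%:R :> R by rewrite ltr0n.
have La1 : 1 <= La n by near: n; apply: (cvgry_ge La_oo).
have La0 : 0 < La n by lra.
have q0 : 0 <= q n by apply: q_ge0.
have hn : n%:R <= C1 * expR (La n) by near: n; apply: (nat_le_exp H).
have hs : forall T : {set 'I_n}, (1 < #|T|)%N -> (2 * #|T| <= n)%N -> #|T|%:R * q n <= 9 ->
  cut_prob T <= 2 * k%:R * La n ^+ k.-1 *
    (G * expR (- (3 / 4 * La n)) * Num.sqrt (q n) * #|T|%:R) ^+ #|T|.
  by near: n; apply: cut_prob_small.
have hl : forall T : {set 'I_n}, (2 * #|T| <= n)%N -> 9 < #|T|%:R * q n ->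
  cut_prob T <= 64 ^+ k * 4^-1 ^+ n by near: n; apply: cut_prob_large.
have b1 : (2 * Be) * La n ^+ 1 * expR (- (4^-1 * La n)) <= 1.
  by near: n; apply: infty_pow_exp => //; apply: mulr_ge0.
have b2 : (4 * k%:R * Be ^+ 2) * La n ^+ k.+1 * expR (- (2^-1 * La n)) <= eps / 2.
  by near: n; apply: infty_pow_exp.
have b3 : 64 ^+ k / (eps / 2) <= n%:R by near: n; apply: near_nat_ge.
pose A := 2 * k%:R * La n ^+ k.-1; pose B := G * expR (- (3 / 4 * La n)) * Num.sqrt (q n).
have A0 : 0 <= A by apply: mulr_ge0; [apply: mulr_ge0 | apply: exprn_ge0; exact: ltW].
have B0 : 0 <= B by rewrite mulr_ge0 ?sqrtr_ge0 // mulr_ge0 ?expR_ge0 // ltW.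
pose beta := Be * La n * expR (- (4^-1 * La n)).
have be0 : 0 <= beta by rewrite mulr_ge0 ?expR_ge0 // mulr_ge0 // ltW.
(* After squaring, the left side is [n La], and [n <= C1 expR La]. Using [1 + C1] for the square
   root of [C1] and [La] for that of [La] avoids further roots. *)
have hsq : n%:R * Num.sqrt (q n) <= (1 + C1) * La n * expR (2^-1 * La n).
  have X0 : 0 <= n%:R * Num.sqrt (q n) by rewrite mulr_ge0 ?sqrtr_ge0.
  have Y0 : 0 <= (1 + C1) * La n * expR (2^-1 * La n).
    by apply: mulr_ge0; [apply: mulr_ge0; [rewrite addr_ge0 // ltW | exact: ltW] | exact: expR_ge0].
  rewrite -(@ler_pXn2r _ 2) ?nnegrE //.
  rewrite exprMn sqr_sqrtr // expr2 -mulrA -/(La n).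
  apply: le_trans (ler_wpM2r (ltW La0) hn) _.
  have -> : ((1 + C1) * La n * expR (2^-1 * La n)) ^+ 2 = (1 + C1) ^+ 2 * La n ^+ 2 * expR (La n).
    have e2 : expR (2^-1 * La n) ^+ 2 = expR (La n).
      by rewrite -expRM_natl mulrA mulfV ?mul1r // pnatr_eq0.
    by rewrite exprMn e2 exprMn.
  rewrite mulrAC; apply: ler_wpM2r; first exact: expR_ge0.
  apply: ler_pM; rewrite ?(ltW C10) ?(ltW La0) //.
    by have := C10; move: (C1) => x x0; nra.
  by rewrite expr2 ler_peMl // ltW.
have hB : B * (expR 1 * n%:R) <= beta.
  have -> : beta = G * expR 1 * expR (- (3 / 4 * La n)) * ((1 + C1) * La n * expR (2^-1 * La n)).
    rewrite /beta; have -> : - (4^-1 * La n) = - (3 / 4 * La n) + 2^-1 * La n by field.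
    by rewrite expRD /Be; ring.
  have -> : B * (expR 1 * n%:R) = G * expR 1 * expR (- (3 / 4 * La n)) * (n%:R * Num.sqrt (q n)).
    by rewrite /B; ring.
  by apply: ler_wpM2l => //; rewrite !mulr_ge0 ?expR_ge0 // ltW.
have s1 : \sum_(T : {set 'I_n} | (1 < #|T|)%N) A * (B * #|T|%:R) ^+ #|T| <= eps / 2.
  rewrite (sum_by_card n (fun r => (1 < r)%N) (fun r => A * (B * r%:R) ^+ r)).
  apply: le_trans (_ : \sum_(r < n.+1 | (1 < r)%N) A * beta ^+ r <= _).
    apply: ler_sum => r _; rewrite mulrCA; apply: ler_wpM2l => //.
    rewrite exprMn mulrCA; apply: le_trans (ler_wpM2l (exprn_ge0 _ B0) (bin_self_pow _ _ _)) _.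
    rewrite -exprMn; apply: lerXn2r; rewrite ?nnegrE //.
    by rewrite mulr_ge0 // mulr_ge0 ?expR_ge0.
  rewrite -mulr_sumr; apply: le_trans (ler_wpM2l A0 (geometric_from2_le n be0 _)) _.
    by apply: le_trans b1; rewrite /beta expr1 !mulrA.
  apply: le_trans b2; rewrite le_eqVlt; apply/orP; left; apply/eqP.
  have -> : - (2^-1 * La n) = - (4^-1 * La n) + - (4^-1 * La n) by field.
  have -> : k.+1 = (k.-1 + 2)%N by rewrite addn2 prednK.
  by rewrite /A /beta expRD exprD; ring.
have s2 : \sum_(T : {set 'I_n}) (64 ^+ k * 4^-1 ^+ n) <= eps / 2 :> R.
  rewrite sumr_const -cardsE.
  have -> : #|[set T : {set 'I_n} | true]%SET| = (2 ^ n)%N.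
    by rewrite -[in RHS](card_ord n) -cardsT -card_powerset; apply: eq_card => X; rewrite !inE subsetT.
  rewrite -[X in X <= _]mulr_natr natrX -mulrA -exprMn (_ : 4^-1 * 2 = 2^-1 :> R); last by field.
  rewrite exprVn ler_pdivrMr ?exprn_gt0 // mulrC -ler_pdivrMr //.
  by apply: le_trans b3 _; rewrite -natrX ler_nat ltnW // ltn_expl.
apply: le_trans (_ : \sum_(T : {set 'I_n} | (1 < #|T|)%N && (2 * #|T| <= n)%N)
  (A * (B * #|T|%:R) ^+ #|T| + 64 ^+ k * 4^-1 ^+ n) <= _).
  apply: ler_sum => T /andP[T1 Tn]; have [Tq|Tq] := leP (#|T|%:R * q n) 9.
    apply: le_trans (hs T T1 Tn Tq) _; rewrite lerDl; by apply: mulr_ge0; apply: exprn_ge0.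
  apply: le_trans (hl T Tn Tq) _; rewrite lerDr; apply: mulr_ge0 => //; apply: exprn_ge0.
  exact: mulr_ge0.
rewrite big_split /= [eps in _ <= eps]splitr; apply: lerD.
  apply: le_trans s1; rewrite big_mkcond [X in _ <= X]big_mkcond; apply: ler_sum => T _.
  case: (1 < #|T|)%N => //=; case: ifP => // _.
  by rewrite mulr_ge0 // exprn_ge0 // mulr_ge0.
apply: le_trans s2; rewrite big_mkcond; apply: ler_sum => T _; case: ifP => // _.
Unshelve. all: by end_near. Qed.

End CutSum.

(** * Poisson limit and conclusion *)

Section Final.
Variables (R : realType) (k : nat) (K P : nat -> nat) (p alpha : nat -> R) (a : R).
Hypothesis H : regime k K P p alpha a.
Let k_ge1 := regime_k H.
Let K_le_P := regime_KP H.
Let p_prob := regime_p H.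

Local Notation lam := (expR (- a) / (k.-1)`!%:R).

Definition binomial_moment (j n : nat) : R :=
  EE (p n) (fun (S : {ffun 'I_n -> key_set (K n) (P n)}) c => 'C(#|low_set k S c|, j)%:R).

Lemma binomial_moment_cvg (j : nat) :
  binomial_moment j n @[n --> \oo] --> (lam ^+ j / j`!%:R : R).
Proof.
case: (posnP j) => [->|j0].
  rewrite expr0 fact0 divr1; apply: cvg_near_cst; near=> n.
  have n1 : (1 <= n)%N by near: n; apply: nbhs_infty_ge.
  rewrite /binomial_moment /EE -[RHS](@Ex_cst _ _ _ (@kw R n (K n) (P n)) (fun i => kw1 R (K_le_P n1) i) 1).
  apply: eq_Ex => S; rewrite -[RHS](@Ex_cst _ _ _ (@cw R n (p n)) (@cw1 _ _ _) 1).
  by apply: eq_Ex => c; rewrite bin0.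
have [u ul hu] := low_moment_upper H j0; have [v vl hv] := low_moment_lower H j0.
(* The [- 0] matches [bin_ratio_cvg] at [m = 0]. As [c n] is the scaled number of sets of size [j],
   the uniform bounds on [n ^ j] times one moment sum to this factor, of limit [1 / j!]. *)
pose c n : R := 'C(n - 0, j)%:R / n%:R ^+ j.
have cl : c n @[n --> \oo] --> (j`!%:R^-1 : R) by apply: bin_ratio_cvg.
have cu : (u n * c n) @[n --> \oo] --> (lam ^+ j / j`!%:R : R) by apply: cvg_mul.
have cv : (v n * c n) @[n --> \oo] --> (lam ^+ j / j`!%:R : R) by apply: cvg_mul.
apply/cvgrPdist_le => e e0.
have e20 : 0 < e / 2 by rewrite divr_gt0.
near=> n.
have n1 : (1 <= n)%N by near: n; apply: nbhs_infty_ge.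
have n0 : 0 < n%:R :> R by rewrite ltr0n.
have hun : forall T : {set 'I_n}, #|T| = j -> n%:R ^+ j * low_moment k K P p T <= u n + e / 2.
  by near: n; apply: hu.
have hvn : forall T : {set 'I_n}, #|T| = j -> v n <= n%:R ^+ j * low_moment k K P p T.
  by near: n; apply: hv.
have un : u n * c n <= lam ^+ j / j`!%:R + e / 2.
  by near: n; apply: (cvgr_le _ cu); rewrite ltrDl.
have vn : lam ^+ j / j`!%:R - e <= v n * c n.
  by near: n; apply: (cvgr_ge _ cv); rewrite ltrBlDr ltrDl.
have nj : 0 < n%:R ^+ j :> R by apply: exprn_gt0.
have c1 : c n <= 1.
  rewrite /c subn0 ler_pdivrMr // mul1r; apply: le_trans (bin_le_pow R n j).
  by rewrite ler_peMr // ler1n fact_gt0.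
have c0 : 0 <= c n by rewrite divr_ge0 // ltW.
have E : binomial_moment j n = \sum_(T : {set 'I_n} | #|T| == j) low_moment k K P p T.
  exact: EE_binomial_low.
have S (x : R) : \sum_(T : {set 'I_n} | #|T| == j) x / n%:R ^+ j = x * c n.
  transitivity (\sum_(T in [set A : {set 'I_n} | #|A| == j]%SET) x / n%:R ^+ j).
    by apply: eq_bigl => T; rewrite finset.in_set.
  by rewrite sumr_const card_draws card_ord -[LHS]mulr_natl /c subn0 mulrCA.
rewrite E distrC ler_distl; apply/andP; split.
  apply: le_trans vn _; rewrite -S; apply: ler_sum => T /eqP Tj.
  by rewrite ler_pdivrMr // mulrC; apply: hvn.
apply: le_trans (_ : (u n + e / 2) * c n <= _).
  rewrite -S; apply: ler_sum => T /eqP Tj.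
  by rewrite ler_pdivlMr // mulrC; apply: hun.
rewrite mulrDl [X in _ <= _ + X]splitr addrA; apply: lerD un _.
by rewrite ler_piMr // ltW.
Unshelve. all: by end_near. Qed.

Definition no_low (n : nat) : R :=
  EE (p n) (fun (S : {ffun 'I_n -> key_set (K n) (P n)}) c => (#|low_set k S c| == 0)%N%:R).

Lemma alternating_moment_cvg (N : nat) :
  (\sum_(j < N) (-1) ^+ j * binomial_moment j n) @[n --> \oo] -->
  (series (exp_coeff (- lam)) N : R).
Proof.
have -> : series (exp_coeff (- lam)) N = \sum_(j < N) (-1) ^+ j * (lam ^+ j / j`!%:R) :> R.
  rewrite /series /= big_mkord; apply: eq_bigr => j _; rewrite /exp_coeff /=.
  by rewrite [(- (expR _ / _)) ^+ j]exprNn -mulrA.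
apply: cvg_big => [|j _]; first exact: add_continuous.
by apply: cvg_mul; [exact: cvg_cst | exact: binomial_moment_cvg].
Qed.

(** The truncation [l] is fixed first, from the exponential series; only then does [n] grow, with
    finitely many moments involved. *)
Lemma no_low_cvg : no_low n @[n --> \oo] --> (expR (- lam) : R).
Proof.
have sl : series (exp_coeff (- lam)) N @[N --> \oo] --> (expR (- lam) : R).
  exact: is_cvg_series_exp_coeff.
apply/cvgrPdist_le => e e0.
have e20 : 0 < e / 2 by rewrite divr_gt0.
have [l hl] : exists l, forall N, (l <= N)%N -> `|expR (- lam) - series (exp_coeff (- lam)) N| <= e / 2.
  have [l _ hl] := (@cvgrPdist_le _ _ _ _ _ _ _).1 sl (e / 2) e20.
  by exists l => N lN; apply: hl.
have := hl (l.*2).+1; have := hl (l.*2).+2.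
have -> : (l <= (l.*2).+2)%N by rewrite -addnn; lia.
have -> : (l <= (l.*2).+1)%N by rewrite -addnn; lia.
move=> /(_ isT); rewrite ler_distlC => /andP[lo _] /(_ isT); rewrite ler_distlC => /andP[_ up].
near=> n.
have n1 : (1 <= n)%N by near: n; apply: nbhs_infty_ge.
have h1 : \sum_(j < (l.*2).+1) (-1) ^+ j * binomial_moment j n <= series (exp_coeff (- lam)) (l.*2).+1 + e / 2.
  by near: n; apply: (cvgr_le _ (@alternating_moment_cvg _)); rewrite ltrDl.
have h2 : series (exp_coeff (- lam)) (l.*2).+2 - e / 2 <= \sum_(j < (l.*2).+2) (-1) ^+ j * binomial_moment j n.
  by near: n; apply: (cvgr_ge _ (@alternating_moment_cvg _)); rewrite ltrBlDr ltrDl.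
have sumE N : \sum_(j < N) (-1) ^+ j * binomial_moment j n =
   EE (p n) (fun (S : {ffun 'I_n -> key_set (K n) (P n)}) c =>
     \sum_(j < N) (-1) ^+ j * 'C(#|low_set k S c|, j)%:R).
  by rewrite EE_sum; apply: eq_bigr => j _; rewrite EEZl.
have u1 : no_low n <= \sum_(j < (l.*2).+1) (-1) ^+ j * binomial_moment j n.
  by rewrite sumE; apply: (EE_le (p_prob n1)) => S c; apply: bonferroni_up.
have u2 : \sum_(j < (l.*2).+2) (-1) ^+ j * binomial_moment j n <= no_low n.
  by rewrite sumE; apply: (EE_le (p_prob n1)) => S c; apply: bonferroni_low.
rewrite ler_distlC; apply/andP; split; lra.
Unshelve. all: by end_near. Qed.

(** The difference from [no_low] is squeezed between 0 and the failure of expansion plus the cut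
    sum. Precision [d = 12] makes the exponent [1 - 3/12 = 3/4]. *)
Lemma Pr_k_connected_cvg :
  Pr_k_connected k n (K n) (P n) (p n) @[n --> \oo] --> (expR (- lam) : R).
Proof.
have d0 : (0 < 12)%N by [].
apply/cvgrPdist_le => e e0.
have e40 : 0 < e / 4 by rewrite divr_gt0.
near=> n.
have n1 : (1 <= n)%N by near: n; apply: nbhs_infty_ge.
have kn : (k < n)%N by near: n; apply: nbhs_infty_gt.
have up := @Pr_k_connected_le R n (K n) (P n) (p n) k (p_prob n1) k_ge1 kn.
have lo := @Pr_k_connected_ge R n (K n) (P n) (p n) k (p_prob n1) k_ge1
  (fun T S => expanding 12 (threshold R K P 12 n) T S) (@expandingS _ _ _ _ _).
rewrite -/(no_low n) in up lo.
have g : Ex (@kw R n (K n) (P n)) (fun S => (~~ expanding 12 (threshold R K P 12 n) finset.setT S)%:R) <= e / 4.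
  by near: n; apply: (not_expanding_global_near H d0).
have s : \sum_(T : {set 'I_n} | (1 < #|T|)%N && (2 * #|T| <= n)%N) cut_prob k K P p T <= e / 4.
  by near: n; apply: (cut_sum_small H).
have b1 : no_low n <= expR (- lam) + e / 4.
  by near: n; apply: (cvgr_le _ no_low_cvg); rewrite ltrDl.
have b2 : expR (- lam) - e / 4 <= no_low n.
  by near: n; apply: (cvgr_ge _ no_low_cvg); rewrite ltrBlDr ltrDl.
rewrite ler_distlC; apply/andP; split; last by lra.
have {}lo : no_low n <= Pr_k_connected k n (K n) (P n) (p n) + e / 4 + e / 4.
  by apply: le_trans lo _; apply: lerD => //; apply: lerD.
lra.
Unshelve. all: by end_near. Qed.

End Final.

Theorem theorem1 (R : realType) (k : nat) (K P : nat -> nat)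
    (p alpha : nat -> R) (alpha_star : R)
    (k_ge1 : (1 <= k)%N)
    (K_gt0 : forall n : nat, (1 <= n)%N -> (0 < K n)%N)
    (K_le_P : forall n : nat, (1 <= n)%N -> (K n <= P n)%N)
    (p_prob : forall n : nat, (1 <= n)%N -> 0 <= p n <= 1)
    (P_Omega : (fun n : nat => (P n)%:R : R) =Omega_\oo
               (fun n : nat => n%:R : R))
    (KP_o1 : (fun n : nat => (K n)%:R / (P n)%:R : R) =o_\oo
             (fun _ : nat => 1 : R))
    (alpha_def : forall n : nat, (2 <= n)%N ->
       edge_prob (K n) (P n) (p n) =
       (ln (n%:R : R) + k.-1%:R * ln (ln (n%:R : R)) + alpha n) / n%:R)
    (alpha_cvg : alpha n @[n --> \oo] --> alpha_star) :
  Pr_k_connected k n (K n) (P n) (p n) @[n --> \oo] -->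
  expR (- (expR (- alpha_star) / (k.-1)`!%:R)).
Proof. by apply: Pr_k_connected_cvg; apply: Regime alpha_def alpha_cvg. Qed.
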